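(* For every $\theta \in [n^{-1/5},1]$ there is a randomized algorithm $\mathrm{GAP\text{-}UB}_\theta$ which, on input strings $x,y$ of length $n$, outputs a number $u$ such that (1) $d_{\mathrm{edit}}(x,y) \le u$, and (2) on every input with $d_{\mathrm{edit}}(x,y) \le \theta n$, we have $u \le 840\,\theta n$ with probability at least $1-n^{-7}$. The running time of $\mathrm{GAP\text{-}UB}_\theta$ is $\widetilde{O}(n^{2-2/7}\theta^{4/7})$.
   Context: $d_{\mathrm{edit}}(x,y)$ denotes the edit (Levenshtein) distance: the minimum number of character insertions, deletions and substitutions needed to transform $x$ into $y$. $\widetilde{O}(\cdot)$ hides polylogarithmic factors in $n$. *)

(* Defs.v *)
From mathcomp Require Import all_boot all_order all_algebra.
From mathcomp Require Import boolp reals exp.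

Set Implicit Arguments.
Unset Strict Implicit.
Unset Printing Implicit Defensive.

Section EditDistance.
Variable Sigma : Type.
Implicit Types s t : seq Sigma.

Inductive edit1 : seq Sigma -> seq Sigma -> Prop :=
| Insertion s t a : edit1 (s ++ t) (s ++ a :: t)
| Deletion s t a : edit1 (s ++ a :: t) (s ++ t)
| Substitution s t a b : edit1 (s ++ a :: t) (s ++ b :: t).

Inductive edits : nat -> seq Sigma -> seq Sigma -> Prop :=
| Edits0 s : edits 0 s s
| EditsS k s t u : edit1 s t -> edits k t u -> edits k.+1 s u.

Lemma edits_ex s t : exists k, `[< edits k s t >].
Proof.
have del u : edits (size u + size t) u t.
  elim: u => [|a u IHu]; last exact: EditsS (Deletion [::] u a) IHu.
  have ins v v' : edits (size v) v' (v' ++ v).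
    elim: v v' => [|a v IHv] v'; first by rewrite cats0; exact: Edits0.
    apply: EditsS (_ : edit1 _ (v' ++ [:: a])) _.
      by rewrite -{1}(cats0 v'); exact: Insertion.
    by move: (IHv (v' ++ [:: a])); rewrite -catA.
  exact: ins t [::].
by exists (size s + size t); apply/asboolP.
Qed.

Definition edit_distance s t : nat := ex_minn (edits_ex s t).

End EditDistance.

(* Randomized word RAM, programmed in a while language.  Registers, memory    *)
(* cells and addresses are w-bit words, i.e. naturals below 2 ^ w; programs   *)
(* are finite syntactic objects that depend neither on w nor on the input.    *)

Inductive binop := OpAdd | OpSub | OpMul | OpDiv | OpMod | OpLt | OpEq.

Inductive expr :=
| Const of nat
| Reg of nat
| Fetch of expr
| Bin of binop & expr & expr.

Inductive cmd :=
| Skip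
| Assign of nat & expr
| Store of expr & expr
| Flip of nat
| Seq of cmd & cmd
| If of expr & cmd & cmd
| While of expr & cmd.

Record state := State {
  reg : nat -> nat;
  mem : nat -> nat;
  coins : seq bool
}.

Definition upd (f : nat -> nat) (a v : nat) : nat -> nat :=
  fun b => if b == a then v else f b.

(* Subtraction is truncated at 0; m %/ 0 = 0 and m %% 0 = m. *)
Definition eval_op (o : binop) (m n : nat) : nat :=
  match o with
  | OpAdd => m + n
  | OpSub => m - n
  | OpMul => m * n
  | OpDiv => m %/ n
  | OpMod => m %% n
  | OpLt => m < n
  | OpEq => m == n
  end.

Fixpoint eval (w : nat) (s : state) (e : expr) : nat :=
  match e with
  | Const c => c %% 2 ^ w
  | Reg i => reg s i
  | Fetch a => mem s (eval w s a)
  | Bin o e1 e2 => eval_op o (eval w s e1) (eval w s e2) %% 2 ^ w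
  end.

(* A configuration is a stack of pending commands together with a state. *)
Definition step (w : nat) (c : cmd) (k : seq cmd) (s : state) :
    seq cmd * state :=
  match c with
  | Skip => (k, s)
  | Assign i e => (k, State (upd (reg s) i (eval w s e)) (mem s) (coins s))
  | Store a e =>
      (k, State (reg s) (upd (mem s) (eval w s a) (eval w s e)) (coins s))
  | Flip i =>
      (k, State (upd (reg s) i (head false (coins s) %% 2 ^ w)) (mem s)
            (behead (coins s)))
  | Seq c1 c2 => (c1 :: c2 :: k, s)
  | If e c1 c2 => ((if eval w s e != 0 then c1 else c2) :: k, s)
  | While e c1 => (if eval w s e != 0 then c1 :: c :: k else k, s)
  end.

(* Runs for at most T steps; None means that the program has not halted by   *)
(* then.  An expression of the program is evaluated in a single step: it has *)
(* a fixed size, so this only affects constant factors of the running time.  *)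
Fixpoint run (w T : nat) (k : seq cmd) (s : state) : option state :=
  if k is c :: k' then
    if T is T'.+1 then
      let: (k1, s1) := step w c k' s in run w T' k1 s1
    else None
  else Some s.

(* Initially register 0 holds n, register 1 holds the parameter tau, cells    *)
(* 0, ..., n - 1 hold x and cells n, ..., 2 n - 1 hold y; everything else is  *)
(* 0.  Each symbol occupies one word, through the code enc.                   *)
Definition input (Sigma : Type) (enc : Sigma -> nat) (n tau : nat)
    (x y : n.-tuple Sigma) (r : seq bool) : state :=
  State (nth 0 [:: n; tau]) (nth 0 (map enc (x ++ y))) r.

(* The result is read off register 0. *)
Definition output (P : cmd) (w T : nat) (s : state) : option nat :=
  omap (fun s' => reg s' 0) (run w T [:: P] s).

(* Probability of an event over T fair coins.  A run of at most T steps flips *)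
(* at most T coins, so T coins determine it.                                  *)
Definition prob (R : realType) (T : nat) (E : pred (T.-tuple bool)) : R :=
  (#|E|%:R / 2 ^+ T)%R.

(* Main.v *)
(* If n <= 840 tau the answer n will do.  Otherwise a grid dynamic programming
   goes through the windows of x of length w2, each made of m blocks of length
   w1, keeping upper bounds of the distances between prefixes of x and of y on
   the diagonals of a band of width O(tau) that are multiples of g.  Distances
   come from an exact band computation that is a 3-approximation.
   Phase 1 takes w1-long pieces of y at random as pivots and computes the
   distances of each pivot to all blocks of x and all pieces of y in the band.
   If many pieces of y are within O(s) of a block, some pivot is among them and
   the triangle inequality through it estimates the block up to O(s).
   In phase 2, for every level s, the blocks that phase 1 left further than 51 s
   from all pivots are sparse: few pieces of y are within O(s).  Sampling
   O(log n) of these blocks in a window and extending each match to the whole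
   window finds the optimal path through it, unless fewer than a quarter of these
   blocks have cost at most s on that path.  If that is so at all levels, adding
   up over the levels bounds the sum of the phase 1 estimates by O(cost + m g). *)
Require Import Defs.
From mathcomp Require Import all_boot all_order all_algebra zify ring lra.
From mathcomp Require Import boolp reals exp.
Set Implicit Arguments.
Unset Strict Implicit.
Unset Printing Implicit Defensive.
Import Order.TTheory GRing.Theory Num.Theory.

(** * Edit distance of windows *)

(** The lower bound on theta is what makes the grid step at least 1: balancing the costs forces [g]
    to be about (tau^5 / n^4)^(1/7). It enters as [n ^ 4 <= tau.+1 ^ 5]. The optimal path is fixed
    before any coin is tossed, so the blocks that are cheap on it do not depend on the coins. Pivots
    and samples read disjoint coins: once the pivots are known the far blocks are determined, and
    the samples are still fresh. The same random numbers serve all blocks, windows and levels, since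
    the failures are only added up in a union bound. The thresholds form a chain. A block of cost at
    most s, seen from a diagonal within s of the path, is at distance at most 3 s + 2 s, hence
    estimated by at most 15 s. Moving a window by at most s more gives 17 s, and the 3-approximation
    to a pivot there gives 51 s. A window costs 595 + 11 times its share of the path plus 204 + 8
    times [m * g] for rounding; rounding and cut-off ends are small against tau, which leaves room
    below 840. The algorithm has to be one program for all n, so it is written with bounded loops,
    whose time and absence of overflow are derived along with the result. *)

Section Alignments.
Variable T : Type.
Implicit Types s t u p : seq T.

(** [edits] may touch any position at any time; an alignment reads both strings once from left to
    right, so induction on it follows the strings. *)
Inductive align : nat -> seq T -> seq T -> Prop :=
| AlignNil : align 0 [::] [::]
| AlignMatch a k s t : align k s t -> align k (a :: s) (a :: t)
| AlignSub a b k s t : align k s t -> align k.+1 (a :: s) (b :: t)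
| AlignIns b k s t : align k s t -> align k.+1 s (b :: t)
| AlignDel a k s t : align k s t -> align k.+1 (a :: s) t.

(** An edit can also cheapen an alignment, by touching a symbol that it already pays for; hence a
    bound instead of an exact cost in the lemmas on single edits. *)
Definition align_le k s t := exists2 k', k' <= k & align k' s t.

Lemma align_refl s : align 0 s s.
Proof. by elim: s => [|a s IH]; constructor. Qed.

Lemma align_sym k s t : align k s t -> align k t s.
Proof. by elim=> *; constructor. Qed.

Lemma align_cat k1 s1 t1 k2 s2 t2 :
  align k1 s1 t1 -> align k2 s2 t2 -> align (k1 + k2) (s1 ++ s2) (t1 ++ t2).
Proof. by move=> A1 A2; elim: A1 => // *; constructor. Qed.

Lemma align_del_left k p a t u :
  align k (p ++ a :: t) u -> align_le k.+1 (p ++ t) u.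
Proof.
move E: (p ++ a :: t) => s A; elim: A p E => {k s u}
  [|c k s u A IH|c b k s u A IH|b k s u A IH|c k s u A IH] [|e p] //=.
- by case=> _ ->; exists k.+1 => //; constructor.
- by case=> -> /IH[k' lek A']; exists k' => //; constructor.
- by case=> _ ->; exists k.+1; [lia | constructor].
- by case=> -> /IH[k' lek A']; exists k'.+1; [lia | constructor].
- by move=> E; have [k' lek A'] := IH [::] E; exists k'.+1; [lia | constructor].
- by move=> E; have [k' lek A'] := IH (e :: p) E; exists k'.+1; [lia | constructor].
- by case=> _ ->; exists k; [lia |].
- by case=> -> /IH[k' lek A']; exists k'.+1; [lia | constructor].
Qed.

Lemma align_ins_left k p a t u :
  align k (p ++ t) u -> align_le k.+1 (p ++ a :: t) u.
Proof.
case: p => [|e p] /=; first by move=> A; exists k.+1 => //; constructor.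
move E: (e :: p ++ t) => s A; elim: A e p E => {k s u}
  [|c k s u A IH|c b k s u A IH|b k s u A IH|c k s u A IH] e p //= E.
- case: E => -> E; case: p E => [|f p] /= E.
    by rewrite E; exists k.+1 => //; do 2!constructor.
  by have [k' lek A'] := IH _ _ E; exists k' => //; constructor.
- case: E => -> E; case: p E => [|f p] /= E.
    by rewrite E; exists k.+2 => //; do 2!constructor.
  by have [k' lek A'] := IH _ _ E; exists k'.+1; [lia | constructor].
- by have [k' lek A'] := IH _ _ E; exists k'.+1; [lia | constructor].
- case: E => -> E; case: p E => [|f p] /= E.
    by rewrite E; exists k.+2 => //; do 2!constructor.
  by have [k' lek A'] := IH _ _ E; exists k'.+1; [lia | constructor].
Qed.

Lemma align_sub_left k p a b t u :
  align k (p ++ b :: t) u -> align_le k.+1 (p ++ a :: t) u.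
Proof.
move E: (p ++ b :: t) => s A; elim: A p E => {k s u}
  [|c k s u A IH|c d k s u A IH|d k s u A IH|c k s u A IH] [|e p] //=.
- by case=> _ ->; exists k.+1 => //; constructor.
- by case=> -> /IH[k' lek A']; exists k' => //; constructor.
- by case=> _ ->; exists k.+1; [lia | constructor].
- by case=> -> /IH[k' lek A']; exists k'.+1; [lia | constructor].
- by move=> E; have [k' lek A'] := IH [::] E; exists k'.+1; [lia | constructor].
- by move=> E; have [k' lek A'] := IH (e :: p) E; exists k'.+1; [lia | constructor].
- by case=> _ ->; exists k.+1; [lia | constructor].
- by case=> -> /IH[k' lek A']; exists k'.+1; [lia | constructor].
Qed.

(** Induction from the end of the edit sequence: an alignment of the later string is adapted to the
    earlier one by undoing one edit on its left side. *)
Lemma edits_align k s t : edits k s t -> align_le k s t.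
Proof.
elim=> {k s t} [s|k s t u E _ [k' lek A]]; first by exists 0 => //; exact: align_refl.
suff [j lej B] : align_le k'.+1 s u by exists j => //; lia.
case: E A => [s' t' a|s' t' a|s' t' a b] A.
- exact: align_del_left A.
- exact: align_ins_left A.
- exact: align_sub_left A.
Qed.

Lemma edits_cons a k s t : edits k s t -> edits k (a :: s) (a :: t).
Proof.
elim=> {k s t} [s|k s t u E _ IH]; first exact: Edits0.
by apply: EditsS IH; case: E => s' t' *; rewrite -!cat_cons; constructor.
Qed.

Lemma align_edits k s t : align k s t -> edits k s t.
Proof.
elim=> {k s t} [|c k s t _ IH|c b k s t _ IH|b k s t _ IH|c k s t _ IH].
- exact: Edits0.
- exact: edits_cons.
- by apply: EditsS (Substitution [::] s c b) _; exact: edits_cons.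
- by apply: EditsS (Insertion [::] s b) _; exact: edits_cons.
- by apply: EditsS (Deletion [::] s c) _.
Qed.

Lemma edits_trans j k s t u : edits j s t -> edits k t u -> edits (j + k) s u.
Proof.
by move=> E F; elim: E F => // {j s t} j s t v E _ IH /IH; exact: EditsS E.
Qed.

Lemma edit_distance_le k s t : edits k s t -> edit_distance s t <= k.
Proof. by rewrite /edit_distance; case: ex_minnP => m _ h /asboolP/h. Qed.

Lemma edit_distance_align_le k s t : align k s t -> edit_distance s t <= k.
Proof. by move/align_edits; exact: edit_distance_le. Qed.

Lemma edit_distance_edits s t : edits (edit_distance s t) s t.
Proof. by rewrite /edit_distance; case: ex_minnP => m /asboolP. Qed.

Lemma edit_distance_align s t : align (edit_distance s t) s t.
Proof.
have [k lek A] := edits_align (edit_distance_edits s t).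
suff <- : k = edit_distance s t by [].
by apply/eqP; rewrite eqn_leq lek edit_distance_align_le.
Qed.

Lemma edit_distance_refl s : edit_distance s s = 0.
Proof. by apply/eqP; rewrite -leqn0 edit_distance_align_le //; exact: align_refl. Qed.

Lemma edit_distance_sym s t : edit_distance s t = edit_distance t s.
Proof.
by apply/eqP; rewrite eqn_leq !edit_distance_align_le //;
  apply: align_sym; exact: edit_distance_align.
Qed.

Lemma edit_distance_trans t s u :
  edit_distance s u <= edit_distance s t + edit_distance t u.
Proof.
by apply/edit_distance_le/(@edits_trans _ _ _ t); exact: edit_distance_edits.
Qed.

Lemma edit_distance_cat s1 s2 t1 t2 :
  edit_distance (s1 ++ s2) (t1 ++ t2) <= edit_distance s1 t1 + edit_distance s2 t2.
Proof.
by apply/edit_distance_align_le/align_cat; exact: edit_distance_align.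
Qed.

Lemma edit_distance_size s t : size s = size t -> edit_distance s t <= size s.
Proof.
elim: s t => [|a s IH] [|b t] //= => [_|[/IH h]].
  by rewrite edit_distance_refl.
apply: leq_trans (_ : edit_distance [:: a] [:: b] + edit_distance s t <= _).
  exact: (edit_distance_cat [:: a] s [:: b] t).
suff: edit_distance [:: a] [:: b] <= 1 by lia.
by apply: edit_distance_align_le; do 2!constructor.
Qed.

(** Delete the first symbol, then append the last one. This prices the move of a window by one
    position, and so each change of diagonal. *)
Lemma edit_distance_cons_rcons a b s :
  edit_distance (a :: s) (rcons s b) <= 2.
Proof.
apply: leq_trans (edit_distance_trans s _ _) _; apply: (@leq_add _ _ 1 1).
  by apply: edit_distance_align_le; constructor; exact: align_refl.
rewrite -{1}[s]cats0 -cats1 -[1%N]/(0 + 1).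
apply/edit_distance_align_le/align_cat; first exact: align_refl.
by do 2!constructor.
Qed.

End Alignments.

Lemma edits_map (S T : Type) (f : S -> T) k s t :
  edits k s t -> edits k (map f s) (map f t).
Proof.
elim=> {k s t} [s|k s t u E _ IH]; first exact: Edits0.
by apply: EditsS IH; case: E => s' t' *; rewrite !map_cat /=; constructor.
Qed.

Lemma align_map_inv (S T : Type) (f : S -> T) k (s t : seq S) :
  injective f -> align k (map f s) (map f t) -> align k s t.
Proof.
move=> injf; move Es: (map f s) => s'; move Et: (map f t) => t' A.
elim: A s t Es Et => {k s' t'} [|c k s t _ IH|c b k s t _ IH|b k s t _ IH|c k s t _ IH].
- by move=> [|//] [|//] _ _; constructor.
- move=> [//|a' s'] [//|b' t'] /= [<- Es] [/injf -> Et].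
  by constructor; apply: IH.
- by move=> [//|a' s'] [//|b' t'] /= [_ Es] [_ Et]; constructor; apply: IH.
- by move=> s' [//|b' t'] /= Es [_ Et]; constructor; apply: IH.
- by move=> [//|a' s'] t' /= [_ Es] Et; constructor; apply: IH.
Qed.

(** The machine sees only the codes of the symbols; injectivity of the code makes the distance of
    the codes the distance of the strings. *)
Lemma edit_distance_map (S T : Type) (f : S -> T) s t : injective f ->
  edit_distance (map f s) (map f t) = edit_distance s t.
Proof.
move=> injf; apply/eqP; rewrite eqn_leq; apply/andP; split.
  by apply/edit_distance_le/edits_map; exact: edit_distance_edits.
by apply/edit_distance_align_le/(align_map_inv injf); exact: edit_distance_align.
Qed.

(* Row i of an alignment starts at position P i of the second string and is *)
(* charged d i: the symbols inserted before it and the cost of its own symbol. *)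
Lemma align_profile k (s t : seq nat) : align k s t ->
  exists P d r, [/\ P 0 = 0,
    forall i, i < size s ->
      [/\ d i = 0 -> P i < size t /\ nth 0 s i = nth 0 t (P i),
          P i.+1 <= (P i).+1 + d i & (P i).+1 <= P i.+1 + d i],
    P (size s) + r = size t & r + \sum_(i < size s) d i <= k].
Proof.
elim=> {k s t} [|c k s t _ IH|c b k s t _ IH|b k s t _ IH|c k s t _ IH].
- by exists (fun=> 0), (fun=> 0), 0; rewrite big_ord0.
- have [P [d [r [P0 Pd Pr sumd]]]] := IH.
  exists (fun i => if i is i'.+1 then (P i').+1 else 0),
    (fun i => if i is i'.+1 then d i' else 0), r.
  split=> //=; [|by lia|by rewrite big_ord_recl /= add0n].
  by move=> [|i] /=; [rewrite P0 | rewrite ltnS => /Pd[h ? ?]; split=> //= /h].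
- have [P [d [r [P0 Pd Pr sumd]]]] := IH.
  exists (fun i => if i is i'.+1 then (P i').+1 else 0),
    (fun i => if i is i'.+1 then d i' else 1), r.
  split=> //=; [|by lia|by rewrite big_ord_recl /= addnCA add1n ltnS].
  by move=> [|i] /=; [rewrite P0 | rewrite ltnS => /Pd[h ? ?]; split=> //= /h].
- have [P [d [r [P0 Pd Pr sumd]]]] := IH.
  case: s => [|a s] in IH Pd Pr sumd *.
    exists (fun=> 0), (fun=> 0), (size t).+1; split=> //.
    by move: Pr sumd; rewrite !big_ord0 P0 /=; lia.
  exists (fun i => if i is i'.+1 then (P i).+1 else 0),
    (fun i => if i is i'.+1 then d i else (d 0).+1), r.
  split=> //=; [|by move: Pr => /=; lia|by move: sumd; rewrite !big_ord_recl /= addSn addnS ltnS].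
  move=> [|i] /= ltis; first by have [_ h1 h2] := Pd 0 isT; split=> //; lia.
  by have [h ? ?] := Pd i.+1 ltis; split=> // /h.
- have [P [d [r [P0 Pd Pr sumd]]]] := IH.
  exists (fun i => if i is i'.+1 then P i' else 0),
    (fun i => if i is i'.+1 then d i' else 1), r.
  split=> //=; [|by rewrite big_ord_recl /= addnCA add1n ltnS].
  by move=> [|i] /=; [rewrite P0 | rewrite ltnS => /Pd[h ? ?]; split=> //= /h].
Qed.

Section Windows.
Variable t : nat -> nat.

(** The text is a total function, so windows exist at every position, also where they leave [x] or
    [y]. *)
Definition window p l := mkseq (fun i => t (p + i)) l.
Definition wdist p q l := edit_distance (window p l) (window q l).

Lemma size_window p l : size (window p l) = l.
Proof. exact: size_mkseq. Qed.

Lemma window_cat p l l' : window p (l + l') = window p l ++ window (p + l) l'.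
Proof.
rewrite /window /mkseq iotaD map_cat add0n; congr (_ ++ _).
by rewrite -[l in iota l]addn0 iotaDl -map_comp; apply: eq_map => i /=; rewrite addnA.
Qed.

Lemma windowS p l : window p l.+1 = t p :: window p.+1 l.
Proof. by rewrite -addn1 addnC window_cat /window /mkseq /= addn0 addn1. Qed.

Lemma windowSr p l : window p l.+1 = rcons (window p l) (t (p + l)).
Proof. by rewrite -addn1 window_cat windowS /= cats1. Qed.

Lemma wdist_refl p l : wdist p p l = 0.
Proof. exact: edit_distance_refl. Qed.

Lemma wdist_sym p q l : wdist p q l = wdist q p l.
Proof. exact: edit_distance_sym. Qed.

Lemma wdist_trans q p r l : wdist p r l <= wdist p q l + wdist q r l.
Proof. exact: edit_distance_trans. Qed.

Lemma wdist_size p q l : wdist p q l <= l.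
Proof. by rewrite -[leqRHS](size_window p) edit_distance_size ?size_window. Qed.

Lemma wdistD p q l l' : wdist p q (l + l') <= wdist p q l + wdist (p + l) (q + l) l'.
Proof. by rewrite /wdist !window_cat edit_distance_cat. Qed.

Lemma wdist1 p q : wdist p q 1 <= (t p != t q).
Proof.
case: eqP => [e|_] /=; last exact: wdist_size.
by rewrite /wdist !windowS e edit_distance_refl.
Qed.

Lemma wdistSr p q l : wdist p q l.+1 <= wdist p q l + (t (p + l) != t (q + l)).
Proof. by rewrite -addn1; apply: leq_trans (wdistD _ _ _ _) _; rewrite leq_add2l wdist1. Qed.

Lemma wdist_next p l : wdist p p.+1 l <= 2.
Proof.
case: l => [|l]; first by rewrite /wdist edit_distance_refl.
by rewrite /wdist windowS windowSr edit_distance_cons_rcons.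
Qed.

Lemma wdist_shift p s l : wdist p (p + s) l <= 2 * s.
Proof.
elim: s => [|s IH]; first by rewrite addn0 wdist_refl.
apply: leq_trans (wdist_trans (p + s) _ _ _) _.
by have := wdist_next (p + s) l; rewrite addnS; lia.
Qed.

Lemma wdist_shiftr p q q' s l : q <= q' + s -> q' <= q + s ->
  wdist p q' l <= wdist p q l + 2 * s.
Proof.
move=> h h'; apply: leq_trans (wdist_trans q _ _ _) _; rewrite leq_add2l.
have [le|lt] := leqP q q'.
  by have := wdist_shift q (q' - q) l; rewrite subnKC //; lia.
by have := wdist_shift q' (q - q') l; rewrite wdist_sym subnKC ?(ltnW lt) //; lia.
Qed.

(** An alignment as a path: row [i] enters at [P i], and [d i] pays for its mismatch and for its
    change of diagonal. The drift left at the end is part of [c]. One path thus gives costs of all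
    subwindows that add up. *)
Definition profile p q L c (P d : nat -> nat) :=
  [/\ P 0 = q,
      forall i, i < L -> [/\ (t (p + i) != t (P i)) <= d i,
          P i.+1 <= (P i).+1 + d i & (P i).+1 <= P i.+1 + d i],
      P L <= q + L & (q + L - P L) + \sum_(0 <= i < L) d i <= c].

Lemma profile_exists p q L : exists P d, profile p q L (wdist p q L) P d.
Proof.
have [P [d [r [P0 Pd Pr sumd]]]] := align_profile (edit_distance_align (window p L) (window q L)).
move: Pr sumd Pd; rewrite !size_window -[edit_distance _ _]/(wdist p q L) => Pr sumd Pd.
exists (fun i => q + P i), d; split; rewrite ?P0 ?addn0 //.
- move=> i ltiL; have [di0 h1 h2] := Pd i ltiL.
  split; [|lia|lia].
  case: (posnP (d i)) => [d0|?]; last by case: eqP.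
  have [ltPi] := di0 d0; rewrite !nth_mkseq // => ->; by rewrite eqxx.
- lia.
- by rewrite big_mkord; lia.
Qed.

(** A row pays [d] for its symbol and [2 * d] for realigning the rest of the window after a drift of
    [d]; hence the factor 3. *)
Lemma profile_window p q L c P d i l : profile p q L c P d -> i + l <= L ->
  wdist (p + i) (P i) l <= 3 * \sum_(i <= k < i + l) d k.
Proof.
case=> _ Pd _ _; elim: l i => [|l IH] i le_iL.
  by rewrite /wdist /window edit_distance_refl.
have ltiL : i < L by lia.
have [d0 d1 d2] := Pd i ltiL.
rewrite -[l.+1]add1n; apply: leq_trans (wdistD _ _ _ _) _.
have := IH i.+1; rewrite addSnnS => /(_ le_iL) h.
rewrite (@big_ltn _ _ _ i) ?mulnDr; last by lia.
have hs : wdist (p + i + 1) (P i + 1) l <= wdist (p + i.+1) (P i.+1) l + 2 * d i.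
  by rewrite addn1 -addnS; apply: wdist_shiftr; lia.
have := leq_trans (wdist1 (p + i) (P i)) d0.
by rewrite add1n; move: h hs; lia.
Qed.

Lemma profile_drift p q L c P d i l : profile p q L c P d -> i + l <= L ->
  P (i + l) <= P i + l + \sum_(i <= k < i + l) d k /\
  P i + l <= P (i + l) + \sum_(i <= k < i + l) d k.
Proof.
case=> _ Pd _ _; elim: l => [|l IH] le_iL; first by rewrite addn0 big_geq; lia.
have [h1 h2] := IH ltac:(lia); have [|_ d1 d2] := Pd (i + l); first by lia.
by rewrite addnS big_nat_recr /=; lia.
Qed.

End Windows.

(** * Band computations *)

Fixpoint sweep_right c (f : nat -> nat) j :=
  if j is j'.+1 then minn (f j) (sweep_right c f j' + c) else f 0.

(* The value at index J.-1 - e; the sweep starts from the last index. *)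
Fixpoint sweep_left_rev c J (f : nat -> nat) e :=
  if e is e'.+1 then minn (f (J.-1 - e)) (sweep_left_rev c J f e' + c)
  else f J.-1.

Definition sweep_left c J f j := sweep_left_rev c J f (J.-1 - j).

(* relax c J f j is the minimum of f i + c |i - j| over i < J. *)
Definition relax c J f := sweep_left c J (sweep_right c f).

Lemma sweep_leftE c J f j : j.+1 < J ->
  sweep_left c J f j = minn (f j) (sweep_left c J f j.+1 + c).
Proof.
move=> ltj; rewrite /sweep_left.
have -> : J.-1 - j = (J.-1 - j.+1).+1 by lia.
by rewrite /=; congr (minn (f _) _); lia.
Qed.

Lemma sweep_left_last c J f j : j.+1 = J -> sweep_left c J f j = f j.
Proof. by move=> <-; rewrite /sweep_left /= subnn. Qed.

Lemma sweep_left_ind J (Pr : nat -> Prop) : (forall j, j.+1 = J -> Pr j) ->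
  (forall j, j.+1 < J -> Pr j.+1 -> Pr j) -> forall j, j < J -> Pr j.
Proof.
move=> Plast Pstep j ltj; have [k ek] : exists k, J = k + j.+1 by exists (J - j.+1); lia.
elim: k j ltj ek => [|k IH] j ltj ek; first by apply: Plast; lia.
by apply: Pstep; [lia | apply: IH; lia].
Qed.

Lemma sweep_right_le c f j : sweep_right c f j <= f j.
Proof. by case: j => //= j; exact: geq_minl. Qed.

Lemma sweep_left_le c J f j : j < J -> sweep_left c J f j <= f j.
Proof.
move=> ltj; have [ltj'|] := ltnP j.+1 J; first by rewrite sweep_leftE // geq_minl.
by move=> le; rewrite sweep_left_last //; lia.
Qed.

Lemma relax_le c J f j : j < J -> relax c J f j <= f j.
Proof. by move=> ltj; apply: leq_trans (sweep_left_le _ _ ltj) (sweep_right_le _ _ _). Qed.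

Lemma relax_succ c J f j : j.+1 < J ->
  relax c J f j <= relax c J f j.+1 + c /\ relax c J f j.+1 <= relax c J f j + c.
Proof.
move=> ltj; have /= := sweep_left_le c (sweep_right c f) ltj.
by rewrite /relax (sweep_leftE _ _ ltj) /=; lia.
Qed.

Lemma relax_lipschitz c J f s i j : i < J -> j < J -> i <= j + s -> j <= i + s ->
  relax c J f i <= relax c J f j + c * s.
Proof.
have main k e : k + e < J -> relax c J f k <= relax c J f (k + e) + c * e /\
    relax c J f (k + e) <= relax c J f k + c * e.
  elim: e => [|e IH] lt; first by rewrite addn0 muln0 addn0.
  have [h1 h2] := IH ltac:(lia); have [|h3 h4] := @relax_succ c J f (k + e); first by lia.
  by rewrite addnS mulnS; lia.
move=> ltI ltJ h1 h2; have [le|lt] := leqP i j.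
  have [|h _] := main i (j - i); first by lia.
  rewrite subnKC // in h; apply: leq_trans h _.
  by rewrite leq_add2l leq_mul2l; apply/orP; right; lia.
have [|_ h] := main j (i - j); first by lia.
rewrite subnKC ?(ltnW lt) // in h; apply: leq_trans h _.
by rewrite leq_add2l leq_mul2l; apply/orP; right; lia.
Qed.

(** [relax] is the largest function below [f] that changes by at most [c] per step. Window distances
    change by at most 2 per position, so relaxing never pushes an estimate below the true
    distance. *)
Lemma relax_lower c J f (h : nat -> nat) :
  (forall j, j < J -> h j <= f j) ->
  (forall j, j.+1 < J -> h j <= h j.+1 + c /\ h j.+1 <= h j + c) ->
  forall j, j < J -> h j <= relax c J f j.
Proof.
move=> hf hl.
have hr j : j < J -> h j <= sweep_right c f j.
  elim: j => [|j IH] ltj /=; first exact: hf.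
  by have := IH ltac:(lia); have := hf _ ltj; have [|] := hl j; lia.
apply: (@sweep_left_ind J) => [j ej|j ltj IH].
  by rewrite /relax sweep_left_last // hr; lia.
by rewrite /relax sweep_leftE //; have := hr j; have := hl j ltj; move: IH; rewrite /relax; lia.
Qed.

Lemma relax_ext c J f f' : (forall j, j < J -> f j = f' j) ->
  forall j, j < J -> relax c J f j = relax c J f' j.
Proof.
move=> eqf.
have eqr j : j < J -> sweep_right c f j = sweep_right c f' j.
  by elim: j => [|j IH] ltj /=; rewrite eqf // IH //; lia.
apply: (@sweep_left_ind J) => [j ej|j ltj IH].
  by rewrite /relax !sweep_left_last // eqr; lia.
rewrite /relax sweep_leftE // [RHS]sweep_leftE // eqr 1?ltnW //.
by congr (minn _ (_ + _)).
Qed.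

Section WindowMatch.
Variable t : nat -> nat.

(* Estimates of the distances from [window p i] to the windows of the same *)
(* length starting at q + j, computed on the J diagonals j < J only. *)
Fixpoint match_row p q J i : nat -> nat :=
  if i is i'.+1 then
    relax 2 J (fun j => match_row p q J i' j + (t (p + i') != t (q + i' + j)))
  else fun=> 0.

Lemma match_row_lower p q J i j : j < J -> wdist t p (q + j) i <= match_row p q J i j.
Proof.
elim: i j => [|i IH] j ltj; first by rewrite /wdist edit_distance_refl.
apply: (relax_lower (h := fun j => wdist t p (q + j) i.+1)) ltj => {}j ltj.
  apply: leq_trans (wdistSr _ _ _ _) _.
  by rewrite addnAC leq_add2r IH.
by split; apply: (@wdist_shiftr _ _ _ _ 1); lia.
Qed.

Lemma match_row_le p q J i j : j < J -> match_row p q J i j <= i.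
Proof.
elim: i j => [|i IH] j ltj //; apply: leq_trans (relax_le _ _ ltj) _.
by apply: leq_trans (leq_add (IH _ ltj) (leq_b1 _)) _; rewrite addn1.
Qed.

(** The path drifts by at most [c] and thus stays on the [J] diagonals; its mismatches cost 1 and
    its changes of diagonal 2 per unit of [d]. *)
Lemma match_row_profile p q J L c j P d : profile t p (q + j) L c P d ->
  c <= j -> j + c < J -> match_row p q J L j <= 3 * c.
Proof.
move=> pr lecj ltcJ; have [P0 Pd PL sumd] := pr.
have sub_sum i : i <= L -> \sum_(0 <= k < i) d k <= \sum_(0 <= k < L) d k.
  by move=> le; rewrite [leqRHS](@big_cat_nat _ _ _ i) //= leq_addr.
have drift i : i <= L -> P i <= q + j + i + \sum_(0 <= k < i) d k /\
    q + j + i <= P i + \sum_(0 <= k < i) d k.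
  move=> le; have := profile_drift (i := 0) (l := i) pr; rewrite !add0n P0.
  by apply.
have main i : i <= L -> match_row p q J i (P i - (q + i)) <= 3 * \sum_(0 <= k < i) d k.
  elim: i => [|i IH] ltiL; first by rewrite big_geq.
  have := IH (ltnW ltiL); have := drift _ ltiL; have := drift _ (ltnW ltiL).
  have := sub_sum _ ltiL; have := sub_sum _ (ltnW ltiL).
  have [d0 d1 d2] := Pd i ltiL; rewrite big_nat_recr //=.
  set S := \sum_(0 <= k < i) d k; set j1 := P i - (q + i); set j2 := P i.+1 - _.
  move=> s1 s2 [h1 h2] [h3 h4] h5.
  have lip : relax 2 J (fun j => match_row p q J i j + (t (p + i) != t (q + i + j))) j2
     <= relax 2 J (fun j => match_row p q J i j + (t (p + i) != t (q + i + j))) j1 + 2 * d i.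
    by apply: relax_lipschitz; rewrite /j1 /j2; lia.
  apply: leq_trans lip _.
  have ltj1 : j1 < J by rewrite /j1; lia.
  have := relax_le 2 (fun j => match_row p q J i j + (t (p + i) != t (q + i + j))) ltj1.
  have -> : q + i + j1 = P i by rewrite /j1; lia.
  by move: h5 d0; lia.
(* Only rows from 1 on are relaxed, so the empty window is treated apart. *)
case: L => [|L] in pr Pd PL sumd sub_sum drift main *; first by [].
have := main _ (leqnn _); have := drift _ (leqnn _).
set S := \sum_(_ <= k < _) _; set j1 := P _ - _ => -[h1 h2] h3.
(* The path may end on another diagonal than [j]; returning costs 2 per diagonal, paid by the final
   drift in [c]. *)
have lip : match_row p q J L.+1 j <= match_row p q J L.+1 j1 + 2 * (q + j + L.+1 - P L.+1).
  by apply: relax_lipschitz; rewrite /j1; move: sumd; rewrite -/S; lia.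
by apply: leq_trans lip _; move: sumd; rewrite -/S; lia.
Qed.

Lemma match_row_upper p q J L j : wdist t p (q + j) L <= j ->
  j + wdist t p (q + j) L < J -> match_row p q J L j <= 3 * wdist t p (q + j) L.
Proof.
by have [P [d pr]] := profile_exists t p (q + j) L; exact: match_row_profile pr.
Qed.

End WindowMatch.

(** * For-programs and their compilation *)

(* The semantics of for-programs is on unbounded naturals; safe says that no
   value met during a run overflows a word and no access is out of range. *)
Inductive aexp :=
| ANum of nat
| AReg of nat
| AArr of nat & aexp
| AIn of aexp
| ABin of binop & aexp & aexp.

Inductive prog :=
| PSet of nat & aexp
| PSto of nat & aexp & aexp
| PFlip of nat
| PSeq of prog & prog
| PIf of aexp & prog & prog
| PFor of nat & nat & prog.

Record astate := AState {
  areg : nat -> nat;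
  aarr : nat -> nat -> nat;
  ainp : nat -> nat;
  acoins : seq bool
}.

Definition setr s i v :=
  AState (fun j => if j == i then v else areg s j) (aarr s) (ainp s) (acoins s).

Definition seta s r x v :=
  AState (areg s)
    (fun r' x' => if r' == r then if x' == x then v else aarr s r' x' else aarr s r' x')
    (ainp s) (acoins s).

Fixpoint aeval (s : astate) (e : aexp) : nat :=
  match e with
  | ANum c => c
  | AReg i => areg s i
  | AArr r a => aarr s r (aeval s a)
  | AIn a => ainp s (aeval s a)
  | ABin o e1 e2 => eval_op o (aeval s e1) (aeval s e2)
  end.

Definition flip1 s i :=
  let s1 := setr s i (head false (acoins s)) in
  AState (areg s1) (aarr s1) (ainp s1) (behead (acoins s)).

(** A loop reads its bound once and sets its counter itself, while the compiled loop rereads both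
    registers; [wf] keeps the body from writing them, so the two agree. *)
Fixpoint den (p : prog) (s : astate) : astate :=
  match p with
  | PSet i e => setr s i (aeval s e)
  | PSto r e1 e2 => seta s r (aeval s e1) (aeval s e2)
  | PFlip i => flip1 s i
  | PSeq p1 p2 => den p2 (den p1 s)
  | PIf e p1 p2 => if aeval s e != 0 then den p1 s else den p2 s
  | PFor i j q => iteri (areg s j) (fun k s' => setr (den q s') i k.+1) (setr s i 0)
  end.

(** Steps of the compiled code. The outer 3 of a loop are its sequencing, the reset of the counter
    and the last failing test; the inner 3 are test, sequencing and increment. *)
Fixpoint tm (p : prog) (s : astate) : nat :=
  match p with
  | PSet _ _ | PSto _ _ _ | PFlip _ => 1
  | PSeq p1 p2 => (tm p1 s + tm p2 (den p1 s)).+1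
  | PIf e p1 p2 => (if aeval s e != 0 then tm p1 s else tm p2 s).+1
  | PFor i j q =>
    3 + \sum_(0 <= k < areg s j)
      (3 + tm q (iteri k (fun k s' => setr (den q s') i k.+1) (setr s i 0)))
  end.

Fixpoint wr (p : prog) : seq nat :=
  match p with
  | PSet i _ | PFlip i => [:: i]
  | PSto _ _ _ => [::]
  | PSeq p1 p2 | PIf _ p1 p2 => wr p1 ++ wr p2
  | PFor i _ q => i :: wr q
  end.

Fixpoint wa (p : prog) : seq nat :=
  match p with
  | PSet _ _ | PFlip _ => [::]
  | PSto r _ _ => [:: r]
  | PSeq p1 p2 | PIf _ p1 p2 => wa p1 ++ wa p2
  | PFor _ _ q => wa q
  end.

Fixpoint noflip (p : prog) : bool :=
  match p with
  | PSet _ _ | PSto _ _ _ => true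
  | PFlip _ => false
  | PSeq p1 p2 | PIf _ p1 p2 => noflip p1 && noflip p2
  | PFor _ _ q => noflip q
  end.

Fixpoint wfe (e : aexp) : bool :=
  match e with
  | ANum _ | AReg _ => true
  | AArr r a => (r < 16) && wfe a
  | AIn a => wfe a
  | ABin _ e1 e2 => wfe e1 && wfe e2
  end.

(* Register 2 is reserved for the base address of the arrays. *)
Fixpoint wf (p : prog) : bool :=
  match p with
  | PSet i e => (i != 2) && wfe e
  | PSto r e1 e2 => [&& r < 16, wfe e1 & wfe e2]
  | PFlip i => i != 2
  | PSeq p1 p2 => wf p1 && wf p2
  | PIf e p1 p2 => [&& wfe e, wf p1 & wf p2]
  | PFor i j q => [&& i != 2, i != j, i \notin wr q, j \notin wr q & wf q]
  end.

(* The arrays are interleaved: element x of array r is stored in cell *)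
(* b + 16 x + r, where b is the length of the input. *)
Definition caddr r e :=
  Bin OpAdd (Reg 2) (Bin OpAdd (Bin OpMul (Const 16) e) (Const r)).

Fixpoint cexp (e : aexp) : expr :=
  match e with
  | ANum c => Const c
  | AReg i => Reg i
  | AArr r a => Fetch (caddr r (cexp a))
  | AIn a => Fetch (cexp a)
  | ABin o e1 e2 => Bin o (cexp e1) (cexp e2)
  end.

Fixpoint compile (p : prog) : cmd :=
  match p with
  | PSet i e => Assign i (cexp e)
  | PSto r e1 e2 => Store (caddr r (cexp e1)) (cexp e2)
  | PFlip i => Flip i
  | PSeq p1 p2 => Seq (compile p1) (compile p2)
  | PIf e p1 p2 => If (cexp e) (compile p1) (compile p2)
  | PFor i j q =>
    Seq (Assign i (Const 0))
        (While (Bin OpLt (Reg i) (Reg j))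
               (Seq (compile q) (Assign i (Bin OpAdd (Reg i) (Const 1)))))
  end.

(** The written registers and arrays are found syntactically, so that it is settled by computation
    that a program leaves a value alone. *)
Definition frame (p : prog) (s s' : astate) : Prop :=
  [/\ forall i, i \notin wr p -> areg s' i = areg s i,
      forall r, r \notin wa p -> aarr s' r = aarr s r,
      ainp s' = ainp s & noflip p -> acoins s' = acoins s].

Lemma setr_reg s i v j : j != i -> areg (setr s i v) j = areg s j.
Proof. by move=> /negbTE ne; rewrite /= ne. Qed.

Lemma setr_same s i v : areg (setr s i v) i = v.
Proof. by rewrite /= eqxx. Qed.

Lemma den_frame p s : frame p s (den p s).
Proof.
elim: p s => [i e|r e1 e2|i|p1 IH1 p2 IH2|e p1 IH1 p2 IH2|i j q IH] s.
- by split=> // j; rewrite inE; exact: setr_reg.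
- by split=> // r'; rewrite inE => /negbTE ne /=; rewrite ne.
- by split=> // j; rewrite inE; exact: setr_reg.
- have [a1 b1 c1 d1] := IH1 s; have [a2 b2 c2 d2] := IH2 (den p1 s).
  split=> [k|k||] /=; rewrite ?mem_cat ?negb_or.
  + by case/andP=> h1 h2; rewrite a2 // a1.
  + by case/andP=> h1 h2; rewrite b2 // b1.
  + by rewrite c2.
  + by case/andP=> h1 h2; rewrite d2 // d1.
- have [a1 b1 c1 d1] := IH1 s; have [a2 b2 c2 d2] := IH2 s.
  split=> [k|k||] /=; rewrite ?mem_cat ?negb_or.
  + by case/andP=> h1 h2; case: ifP => _; [rewrite a1 | rewrite a2].
  + by case/andP=> h1 h2; case: ifP => _; [rewrite b1 | rewrite b2].
  + by case: ifP.
  + by case/andP=> h1 h2; case: ifP => _; [rewrite d1 | rewrite d2].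
- rewrite /=; elim: (areg s j) => [|n [a b c d]].
    by split=> // k; rewrite inE negb_or => /andP[h _]; exact: setr_reg.
  have [a1 b1 c1 d1] := IH (iteri n (fun k s' => setr (den q s') i k.+1) (setr s i 0)).
  split=> [k|k||h] //; last 2 first.
  + by rewrite /= c1.
  + by rewrite /= d1 // d.
  + move=> kn; have := kn; rewrite inE negb_or => /andP[h1 h2].
    by rewrite iteriS setr_reg // a1 // a.
  + by move=> kn; rewrite /= b1 // b.
Qed.

Section Compilation.
Variables (w b : nat).
Hypothesis w_large : 16 < 2 ^ w.

Fixpoint asafe (s : astate) (e : aexp) : Prop :=
  match e with
  | ANum c => c < 2 ^ w
  | AReg i => True
  | AArr r a => asafe s a /\ b + (16 * aeval s a + r) < 2 ^ w
  | AIn a => asafe s a /\ aeval s a < b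
  | ABin o e1 e2 =>
    [/\ asafe s e1, asafe s e2 & eval_op o (aeval s e1) (aeval s e2) < 2 ^ w]
  end.

Fixpoint safe (p : prog) (s : astate) : Prop :=
  match p with
  | PSet _ e => asafe s e
  | PSto r e1 e2 => [/\ asafe s e1, asafe s e2 & b + (16 * aeval s e1 + r) < 2 ^ w]
  | PFlip _ => True
  | PSeq p1 p2 => safe p1 s /\ safe p2 (den p1 s)
  | PIf e p1 p2 => asafe s e /\ if aeval s e != 0 then safe p1 s else safe p2 s
  | PFor i j q => areg s j < 2 ^ w /\
    forall k, k < areg s j ->
      safe q (iteri k (fun k s' => setr (den q s') i k.+1) (setr s i 0))
  end.

Definition repr (s : astate) (c : state) : Prop :=
  [/\ reg c =1 areg s, areg s 2 = b,
      forall r x, r < 16 -> b + (16 * x + r) < 2 ^ w ->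
        Defs.mem c (b + (16 * x + r)) = aarr s r x,
      forall x, x < b -> Defs.mem c x = ainp s x &
      coins c = acoins s].

Lemma eval_caddr s c r e v : repr s c -> r < 16 -> eval w c e = v ->
  b + (16 * v + r) < 2 ^ w -> eval w c (caddr r e) = b + (16 * v + r).
Proof.
move=> [hr h2 _ _ _] ltr ev lt /=; rewrite ev hr h2.
by rewrite [16 %% _]modn_small // !(@modn_small _ (2 ^ w)) //; lia.
Qed.

Lemma eval_cexp s c e : repr s c -> wfe e -> asafe s e -> eval w c (cexp e) = aeval s e.
Proof.
move=> R; have [hr h2 ha hi hc] := R.
elim: e => [k|i|r e IH|e IH|o e1 IH1 e2 IH2].
- by move=> _ /= lt; rewrite modn_small.
- by rewrite /= hr.
- move=> /andP[ltr wfee] [sa lt].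
  by rewrite -[LHS]/(Defs.mem c (eval w c (caddr r (cexp e)))) (eval_caddr R ltr (IH wfee sa)) // ha.
- by move=> /= wfee [sa lt]; rewrite IH // hi.
- by move=> /andP[wf1 wf2] [s1 s2 lt] /=; rewrite IH1 // IH2 // modn_small.
Qed.

Lemma repr_setr s c i v : i != 2 -> repr s c ->
  repr (setr s i v) (State (upd (reg c) i v) (Defs.mem c) (coins c)).
Proof.
move=> ne [hr h2 ha hi hc]; split=> //; last by rewrite setr_reg // eq_sym.
by move=> j; rewrite /= /upd; case: eqP => //; rewrite hr.
Qed.

(** The pending commands [k] and the remaining time [T] are arbitrary, which is what lets the runs
    of consecutive programs compose. *)
Lemma compile_correct p s c : wf p -> safe p s -> repr s c ->
  exists2 c', repr (den p s) c' &
    forall k T, run w (tm p s + T) (compile p :: k) c = run w T k c'.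
Proof.
elim: p s c => [i e|r e1 e2|i|p1 IH1 p2 IH2|e p1 IH1 p2 IH2|i j q IH] s c.
- move=> /andP[ne wfee] sa R; have := repr_setr (aeval s e) ne R.
  by eexists; [eassumption | move=> k T; rewrite /= (eval_cexp R)].
- move=> /and3P[ltr wf1 wf2] [s1 s2 lt] R; have [hr h2 ha hi hc] := R.
  have ea := eval_caddr R ltr (eval_cexp R wf1 s1) lt.
  exists (State (reg c) (upd (Defs.mem c) (b + (16 * aeval s e1 + r)) (aeval s e2)) (coins c)).
    split=> // [r' x ltr' lt'|x ltx] /=; rewrite /upd.
      case: (r' =P r) => [er|ner].
        subst r'; case: (x =P _) => [->|nex]; first by rewrite eqxx.
        by case: eqP => [?|_]; [lia | rewrite ha].
      by case: eqP => [?|_]; [lia | rewrite ha].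
    by case: eqP => [?|_]; [lia | rewrite hi].
  by move=> k T; rewrite -[LHS]/(run w T k (State (reg c) (upd (Defs.mem c) (eval w c (caddr r (cexp e1)))
       (eval w c (cexp e2))) (coins c))) ea (eval_cexp R wf2 s2).
- move=> ne _ R; have [hr h2 ha hi hc] := repr_setr (head false (acoins s)) ne R.
  have [_ _ _ _ hc'] := R.
  exists (State (upd (reg c) i (head false (acoins s))) (Defs.mem c) (behead (coins c))).
    by split=> //=; rewrite hc'.
  move=> k T; rewrite /= hc' modn_small //.
  by case: (head _ _) => /=; lia.
- move=> /andP[wf1 wf2] [s1 s2] R.
  have [c1 R1 h1] := IH1 _ _ wf1 s1 R; have [c2 R2 h2] := IH2 _ _ wf2 s2 R1.
  by exists c2 => // k T; rewrite /= -addnA h1 h2.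
- move=> /and3P[wfee wf1 wf2] [sa sp] R; rewrite /=.
  case: ifP sp => ev sp.
    have [c1 R1 h1] := IH1 _ _ wf1 sp R.
    by exists c1 => // k T; rewrite /= (eval_cexp R) // ev h1.
  have [c1 R1 h1] := IH2 _ _ wf2 sp R.
  by exists c1 => // k T; rewrite /= (eval_cexp R) // ev h1.
- move=> /and5P[ne2 neij niq njq wfq] [ltj sq] R.
  set F := fun k s' => setr (den q s') i k.+1.
  pose C := While (Bin OpLt (Reg i) (Reg j)) (Seq (compile q) (Assign i (Bin OpAdd (Reg i) (Const 1)))).
  have regs n : areg (iteri n F (setr s i 0)) i = n /\
                areg (iteri n F (setr s i 0)) j = areg s j.
    elim: n => [|n [h1 h2]]; first by rewrite setr_same setr_reg // eq_sym.
    rewrite iteriS /F setr_same setr_reg 1?eq_sym //.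
    by have [-> //] := den_frame q (iteri n F (setr s i 0)).
  (* After [n] rounds the machine stands before the loop command again, in a state representing the
     [n]-th iterate. *)
  have main n : n <= areg s j -> exists2 c', repr (iteri n F (setr s i 0)) c' &
    forall k T, run w (\sum_(0 <= m < n) (3 + tm q (iteri m F (setr s i 0))) + T)
      [:: C & k] (State (upd (reg c) i 0) (Defs.mem c) (coins c)) = run w T (C :: k) c'.
    elim: n => [|n IHn] len.
      by eexists; [exact: (repr_setr 0 ne2 R) | move=> k T; rewrite big_geq].
    have [c1 R1 h1] := IHn (ltnW len).
    have [r1 r2] := regs n.
    have [c2 R2 h2] := IH _ _ wfq (sq n len) R1.
    have [r3] : areg (den q (iteri n F (setr s i 0))) i = n.
      by have [-> //] := den_frame q (iteri n F (setr s i 0)).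
    exists (State (upd (reg c2) i n.+1) (Defs.mem c2) (coins c2)).
      exact: repr_setr R2.
    move=> k T; rewrite big_nat_recr //= -addnA h1.
    have [hr1 _ _ _ _] := R1; have [hr2 _ _ _ _] := R2.
    rewrite (_ : _ + T = (tm q (iteri n F (setr s i 0)) + T.+1).+2); last by lia.
    rewrite /= !hr1 r1 r2 len /= [1 %% _]modn_small /=; last by lia.
    rewrite h2 /= hr2 r3 [1 %% _]modn_small; last by lia.
    by rewrite modn_small addn1 //; lia.
  have [c' R' h'] := main _ (leqnn _).
  exists c' => // k T; have [r1 r2] := regs (areg s j); have [hr _ _ _ _] := R'.
  rewrite -[compile _]/(Seq (Assign i (Const 0)) C) -/F.
  rewrite -[tm _ _]/(3 + \sum_(0 <= m < areg s j) (3 + tm q (iteri m F (setr s i 0)))).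
  rewrite (_ : _ + T = (\sum_(0 <= m < areg s j) (3 + tm q (iteri m F (setr s i 0))) + T.+1).+2);
    last by lia.
  by rewrite /= mod0n h' /= !hr r1 r2 ltnn mod0n.
Qed.

Definition wp (p : prog) (s : astate) (T : nat) (Q : astate -> Prop) : Prop :=
  [/\ safe p s, tm p s <= T & Q (den p s)].

(** The frame comes for free with every use, so specifications need only mention what a program
    computes. *)
Lemma wp_conseq p s T T' (Q Q' : astate -> Prop) :
  wp p s T Q -> T <= T' -> (forall s', frame p s s' -> Q s' -> Q' s') -> wp p s T' Q'.
Proof.
move=> [h1 h2 h3] le h; split=> //; first exact: leq_trans le.
by apply: h h3; exact: den_frame.
Qed.

Lemma wp_set i e s T (Q : astate -> Prop) :
  asafe s e -> 0 < T -> Q (setr s i (aeval s e)) -> wp (PSet i e) s T Q.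
Proof. by []. Qed.

Lemma wp_sto r e1 e2 s T (Q : astate -> Prop) :
  asafe s e1 -> asafe s e2 -> b + (16 * aeval s e1 + r) < 2 ^ w -> 0 < T ->
  Q (seta s r (aeval s e1) (aeval s e2)) -> wp (PSto r e1 e2) s T Q.
Proof. by []. Qed.

Lemma wp_flip i s T (Q : astate -> Prop) : 0 < T -> Q (flip1 s i) -> wp (PFlip i) s T Q.
Proof. by []. Qed.

Lemma wp_seq p1 p2 s T1 T2 T (Q : astate -> Prop) :
  wp p1 s T1 (fun s' => wp p2 s' T2 Q) -> (T1 + T2).+1 <= T -> wp (PSeq p1 p2) s T Q.
Proof.
move=> [h1 h2 [h3 h4 h5]] le; split=> //=.
by apply: leq_trans le; rewrite ltnS leq_add.
Qed.

Lemma wp_if e p1 p2 s T T' (Q : astate -> Prop) : asafe s e -> T'.+1 <= T ->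
  (aeval s e != 0 -> wp p1 s T' Q) -> (aeval s e = 0 -> wp p2 s T' Q) ->
  wp (PIf e p1 p2) s T Q.
Proof.
move=> sa le h1 h2; rewrite /wp /=; case: ifPn => [/h1|/negPn/eqP/h2] [a1 a2 a3];
  by split=> //; apply: leq_trans le; rewrite ltnS.
Qed.

Lemma wp_for i j q s n T tb (Inv : nat -> astate -> Prop) (Q : astate -> Prop) :
  wf (PFor i j q) -> areg s j = n -> n < 2 ^ w ->
  Inv 0 (setr s i 0) ->
  (forall k s', k < n -> areg s' i = k -> frame (PFor i j q) s s' -> Inv k s' ->
     wp q s' tb (fun s'' => Inv k.+1 (setr s'' i k.+1))) ->
  (forall s', areg s' i = n -> frame (PFor i j q) s s' -> Inv n s' -> Q s') ->
  3 + n * (tb + 3) <= T -> wp (PFor i j q) s T Q.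
Proof.
move=> /and5P[ne2 neij niq njq wfq] ej ltn I0 step fin leT.
set F := fun k s' => setr (den q s') i k.+1.
have fr k : frame (PFor i j q) s (iteri k F (setr s i 0)).
  elim: k => [|k [a c d e]].
    by split=> // k; rewrite inE negb_or => /andP[h _]; exact: setr_reg.
  have [a1 c1 d1 e1] := den_frame q (iteri k F (setr s i 0)).
  split=> [m|m||h].
  + move=> mn; have := mn; rewrite inE negb_or => /andP[h1 h2].
    by rewrite iteriS setr_reg // a1 // a.
  + by move=> mn; rewrite /= c1 // c.
  + by rewrite /= d1.
  + by rewrite /= e1 // e.
have ri k : areg (iteri k F (setr s i 0)) i = k by case: k => [|k]; rewrite ?iteriS setr_same.
have inv k : k <= n -> Inv k (iteri k F (setr s i 0)).
  elim: k => [//|k IH] lek.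
  by have [_ _] := step _ _ lek (ri k) (fr k) (IH (ltnW lek)).
have st k : k < n -> wp q (iteri k F (setr s i 0)) tb (fun=> True).
  move=> ltk; have := inv _ (ltnW ltk) => /(step _ _ ltk (ri k) (fr k)) h.
  by apply: (wp_conseq h).
split=> [|/=|/=].
- by rewrite /= ej; split=> // k /st[].
- apply: leq_trans leT; rewrite leq_add2l ej -[n in leqRHS]subn0 -sum_nat_const_nat.
  rewrite big_nat_cond [leqRHS]big_nat_cond; apply: leq_sum => k.
  rewrite andbT => /andP[_ /st[_ h _]].
  by rewrite addnC leq_add2r.
- by rewrite ej; apply: fin => //; apply: inv.
Qed.

End Compilation.

(* Notation for for-programs, and the band routines *)
Declare Scope aexp_scope.
Delimit Scope aexp_scope with a.
Bind Scope aexp_scope with aexp.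
Notation "# c" := (ANum c) (at level 1, format "# c") : aexp_scope.
Notation "$ i" := (AReg i) (at level 1, format "$ i") : aexp_scope.
Notation "r :[ e ]" := (AArr r e) (at level 2, e at level 200, format "r :[ e ]") : aexp_scope.
Notation "x + y" := (ABin OpAdd x y) : aexp_scope.
Notation "x - y" := (ABin OpSub x y) : aexp_scope.
Notation "x * y" := (ABin OpMul x y) : aexp_scope.
Notation "x %/ y" := (ABin OpDiv x y) : aexp_scope.
Notation "x %% y" := (ABin OpMod x y) : aexp_scope.
Notation "x < y" := (ABin OpLt x y) : aexp_scope.
Notation "x == y" := (ABin OpEq x y) : aexp_scope.
Notation "p ;; q" := (PSeq p q) (at level 100, right associativity).
Notation "i ::= e" := (PSet i e%a) (at level 90).

(* The minimum, as subtraction is truncated. *)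
Definition amin (x y : aexp) : aexp := (x - (x - y))%a.

(** The two sweeps, in place. Register 44 holds the number of entries minus one, 45 their offset in
    the array and 46 the cost per step. *)
Definition Prelax r : prog :=
  PFor 48 44 (PSto r ($45 + $48 + #1) (amin (r:[$45 + $48 + #1]) (r:[$45 + $48] + $46)));;
  PFor 48 44 (PSto r ($45 + ($44 - #1 - $48))
     (amin (r:[$45 + ($44 - #1 - $48)]) (r:[$45 + ($44 - #1 - $48) + #1] + $46))).

(* Registers 40 to 45 hold p, R, q, J, J - 1 and the offset of the result in
   array r; array 0 holds the text. *)
Definition Pmatch r : prog :=
  PFor 48 43 (PSto r ($45 + $48) #0);;
  46 ::= #2;;
  PFor 47 41 (
    PFor 48 43 (PSto r ($45 + $48)
      (r:[$45 + $48] + (#1 - (0:[$40 + $47] == 0:[$42 + $47 + $48]))));;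
    Prelax r).

Section Routines.
Variables (w b : nat).
Local Notation wp := (wp w b).

(** [X] bounds the indices and values that occur; [b + 16 * X + 32 < 2 ^ w] then covers the
    addresses of all 16 interleaved arrays as well. *)
Lemma Prelax_spec r s ob J c X (f : nat -> nat) : r < 16 ->
  areg s 45 = ob -> areg s 44 = J.-1 -> areg s 46 = c -> 0 < J ->
  b + 16 * X + 32 < 2 ^ w -> ob + J <= X ->
  (forall j, j < J -> aarr s r (ob + j) = f j) ->
  (forall j, j < J -> f j + c <= X) ->
  wp (Prelax r) s (8 * J) (fun s' =>
    (forall j, j < J -> aarr s' r (ob + j) = relax c J f j) /\
    (forall x, x < ob \/ ob + J <= x -> aarr s' r x = aarr s r x)).
Proof.
move=> ltr e45 e44 e46 J0 bX obX ef bf.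
have wf1 : wf (Prelax r) by rewrite /= ltr.
have [wfa wfb] : wf (PFor 48 44 (PSto r ($45 + $48 + #1)
   (amin (r:[$45 + $48 + #1]) (r:[$45 + $48] + $46)))) /\
   wf (PFor 48 44 (PSto r ($45 + ($44 - #1 - $48))
     (amin (r:[$45 + ($44 - #1 - $48)]) (r:[$45 + ($44 - #1 - $48) + #1] + $46))))
  by rewrite /= ltr.
apply: (@wp_seq _ _ _ _ _ (3 + J.-1 * 4) (3 + J.-1 * 4)); last by lia.
apply: (@wp_for _ _ _ _ _ _ J.-1 _ 1 (fun k s' => forall x, aarr s' r x =
   if (ob <= x) && (x <= ob + k) then sweep_right c f (x - ob) else aarr s r x))
   => //; first by lia.
- move=> x /=; case: ifP => // h; have -> : x = ob + 0 by lia.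
  by rewrite ef // addKn.
- move=> k s' ltk e48 [fr _ _ _] inv.
  have e45' : areg s' 45 = ob by rewrite fr.
  have e46' : areg s' 46 = c by rewrite fr.
  have v1 : aarr s' r (ob + k + 1) = f k.+1.
    by rewrite inv ifF -?addnA ?addn1 ?ef //; lia.
  have v0 : aarr s' r (ob + k) = sweep_right c f k.
    by rewrite inv ifT ?addKn //; lia.
  have b0 := sweep_right_le c f k; have b1 := bf k.+1 ltac:(lia).
  have b2 := bf k ltac:(lia).
  apply: wp_sto => //=; rewrite ?e45' ?e46' ?e48 ?v0 ?v1; do ?split; try lia.
  move=> x; rewrite eqxx inv; case: eqP => [->|ne].
    rewrite ifT; last by lia.
    by rewrite (_ : ob + k + 1 - ob = k.+1) /=; lia.
  by congr (if _ then _ else _); lia.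
move=> s1 _ [fr1 _ _ _] inv1.
have e45' : areg s1 45 = ob by rewrite fr1.
have e46' : areg s1 46 = c by rewrite fr1.
have e44' : areg s1 44 = J.-1 by rewrite fr1.
apply: (@wp_for _ _ _ _ _ _ J.-1 _ 1 (fun k s' => forall x, aarr s' r x =
   if (ob + J.-1 - k <= x) && (x < ob + J) then relax c J f (x - ob) else aarr s1 r x))
   => //; first by lia.
- move=> x /=; case: ifP => // h; have -> : x = ob + J.-1 by lia.
  by rewrite addKn /relax sweep_left_last ?inv1 ?ifT ?addKn //; lia.
- move=> k s' ltk e48 [fr _ _ _] inv.
  have e45'' : areg s' 45 = ob by rewrite fr.
  have e46'' : areg s' 46 = c by rewrite fr.
  have e44'' : areg s' 44 = J.-1 by rewrite fr.
  have [i ei] : exists i, i = J.-1 - 1 - k by eexists.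
  have v1 : aarr s' r (ob + i + 1) = relax c J f i.+1.
    by rewrite inv ifT; [congr relax|]; lia.
  have v0 : aarr s' r (ob + i) = sweep_right c f i.
    by rewrite inv ifF ?inv1 ?ifT ?addKn // ; lia.
  have b0 := sweep_right_le c f i; have b1 := @relax_le c J f i.+1 ltac:(lia).
  have b2 := bf i ltac:(lia); have b3 := bf i.+1 ltac:(lia).
  apply: wp_sto => //=; rewrite ?e45'' ?e46'' ?e48 ?e44'' -?ei ?v0 ?v1; do ?split; try lia.
  + move=> x; rewrite eqxx inv; case: eqP => [->|ne].
      rewrite ifT; last by lia.
      rewrite addKn [in RHS]/relax sweep_leftE; last by lia.
      by rewrite -/(relax c J f i.+1); lia.
    by congr (if _ then _ else _); lia.
move=> s2 _ [fr2 _ _ _] inv2; split=> [j ltj|x hx].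
  by rewrite inv2 ifT ?addKn //; lia.
by rewrite inv2 ifF ?inv1 ?ifF //; lia.
Qed.

Lemma Pmatch_spec r s p R q J ob X : 0 < r < 16 ->
  areg s 40 = p -> areg s 41 = R -> areg s 42 = q -> areg s 43 = J ->
  areg s 44 = J.-1 -> areg s 45 = ob -> 0 < J ->
  b + 16 * X + 32 < 2 ^ w -> p + R <= X -> q + R + J <= X -> ob + J <= X -> R + 4 <= X ->
  wp (Pmatch r) s (20 * (R.+1 * J)) (fun s' =>
    (forall j, j < J -> aarr s' r (ob + j) = match_row (aarr s 0) p q J R j) /\
    (forall x, x < ob \/ ob + J <= x -> aarr s' r x = aarr s r x)).
Proof.
move=> /andP[r0 ltr] e40 e41 e42 e43 e44 e45 J0 bX pX qX obX RX.
have fr0 : 0 \notin [:: r] by rewrite inE; lia.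
apply: (@wp_seq _ _ _ _ _ (3 + J * 4) (2 + (3 + R * (12 * J + 7)))); last by nia.
apply: (@wp_for _ _ _ _ _ _ J _ 1 (fun k s' =>
   (forall j, j < k -> aarr s' r (ob + j) = 0) /\
   (forall x, x < ob \/ ob + J <= x -> aarr s' r x = aarr s r x))) => //;
  [by rewrite /= ltr | by lia | |].
  move=> k s' ltk e48 [fr _ _ _] [inv1 inv2].
  have e45' : areg s' 45 = ob by rewrite fr.
  apply: wp_sto => //=; rewrite ?e45' ?e48; do ?split; try lia.
    by move=> j lj; rewrite eqxx; case: eqP => // ne; apply: inv1; lia.
  by move=> x hx; rewrite eqxx; case: eqP => [?|_]; [lia | exact: inv2].
move=> s1 _ [fr1 fa1 _ _] [inv1 inv2].
apply: (@wp_seq _ _ _ _ _ 1 (3 + R * (12 * J + 7))) => //.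
apply: wp_set => //=; first by lia.
apply: (@wp_for _ _ _ _ _ _ R _ (12 * J + 4) (fun k s' =>
   (forall j, j < J -> aarr s' r (ob + j) = match_row (aarr s 0) p q J k j) /\
   (forall x, x < ob \/ ob + J <= x -> aarr s' r x = aarr s r x))) => //;
  [by rewrite /= ltr | by rewrite /= fr1 | by lia | | by lia].
  move=> k s2 ltk e47 [fr2 fa2 _ _] [inv3 inv4].
  apply: (@wp_seq _ _ _ _ _ (3 + J * 4) (8 * J)); last by lia.
  have e0 : aarr s2 0 = aarr s 0 by rewrite fa2 ?fa1 //= ?mem_cat ?inE; lia.
  have e40' : areg s2 40 = p by rewrite fr2 //= fr1.
  have e42' : areg s2 42 = q by rewrite fr2 //= fr1.
  have e43' : areg s2 43 = J by rewrite fr2 //= fr1.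
  have e44' : areg s2 44 = J.-1 by rewrite fr2 //= fr1.
  have e45' : areg s2 45 = ob by rewrite fr2 //= fr1.
  have e46' : areg s2 46 = 2 by rewrite fr2.
  apply: (@wp_for _ _ _ _ _ _ J _ 1 (fun k' s' =>
     (forall j, j < J -> aarr s' r (ob + j) =
        if j < k' then match_row (aarr s 0) p q J k j +
           (aarr s 0 (p + k) != aarr s 0 (q + k + j))
        else match_row (aarr s 0) p q J k j) /\
     (forall x, x < ob \/ ob + J <= x -> aarr s' r x = aarr s r x))) => //;
    [by rewrite /= ltr | by lia | |].
    move=> k' s3 ltk' e48 [fr3 fa3 _ _] [inv5 inv6].
    have e0' : aarr s3 0 = aarr s 0 by rewrite fa3 // e0.
    have e40'' : areg s3 40 = p by rewrite fr3.
    have e42'' : areg s3 42 = q by rewrite fr3.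
    have e45'' : areg s3 45 = ob by rewrite fr3.
    have e47' : areg s3 47 = k by rewrite fr3.
    have v : aarr s3 r (ob + k') = match_row (aarr s 0) p q J k k' by rewrite inv5 ?ltnn.
    have vb := match_row_le (aarr s 0) p q k ltk'.
    have eb x y : 1 - (x == y :> nat) = (x != y) by case: eqP.
    apply: wp_sto => //=; rewrite ?e45'' ?e48 ?e40'' ?e42'' ?e47' ?e0' ?v ?eb;
      do ?split; try (by case: (_ == _); lia); try (by case: (_ != _); lia); try lia.
      move=> j ltj; rewrite eqxx; case: eqP => [/addnI ->|ne]; first by rewrite ltnSn.
      by rewrite inv5 // (_ : (j < k'.+1) = (j < k')) //; lia.
    by move=> x hx; rewrite eqxx; case: eqP => [?|_]; [lia | exact: inv6].
  move=> s3 _ [fr3 fa3 _ _] [inv5 inv6].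
  have e45'' : areg s3 45 = ob by rewrite fr3.
  have e44'' : areg s3 44 = J.-1 by rewrite fr3.
  have e46'' : areg s3 46 = 2 by rewrite fr3.
  apply: (wp_conseq (Prelax_spec (X := X) ltr e45'' e44'' e46'' J0 bX obX
     (f := fun j => match_row (aarr s 0) p q J k j +
           (aarr s 0 (p + k) != aarr s 0 (q + k + j))) _ _)) => //.
  - by move=> j ltj; rewrite inv5 // ltj.
  - by move=> j ltj; have := match_row_le (aarr s 0) p q k ltj; case: (_ != _) => /=; lia.
  - move=> s4 _ [h1 h2]; split=> [j ltj|x hx]; first exact: h1.
    by rewrite /= h2 // inv6.
Qed.
End Routines.

(** For-programs have no empty command; writing the scratch register 90 serves as one. *)
Definition Pskip : prog := 90 ::= #0.

(** * Phase 1 *)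

(* Arrays: 0 is the text, 1 the random numbers, 2 the distance of each block to
   the nearest pivot, 3 the offset of the row of that pivot in array 4, 4 the
   rows of distances of the pivots to the pieces of y, 8 the costs of the current
   window found by phase 2, 9 the current row of the grid and 10 its copy at the
   start of the window; 5, 6, 7 and 11 are scratch. *)
Definition Ppivots : prog :=
  PFor 50 16 (PSto 2 $50 $5);;
  PFor 50 13 (
    51 ::= 1:[$50];;
    40 ::= $11 - #2 * $8 + $51;;
    41 ::= $5;;
    42 ::= $10 - $18 + $51;;
    43 ::= $18;;
    44 ::= $18 - #1;;
    45 ::= #0;;
    Pmatch 5;;
    42 ::= $40 - $18;;
    43 ::= $19;;
    44 ::= $19 - #1;;
    45 ::= $50 * $19;;
    Pmatch 4;;
    PFor 52 16 (
      53 ::= $52 * $5;;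
      PIf (($53 < $51) * ($51 < $53 + $18 + #1))
        (PIf (5:[$53 + $18 - $51] < 2:[$52])
          (PSto 2 $52 (5:[$53 + $18 - $51]);;
           PSto 3 $52 ($45 + (#5 * $8 + $53 - $51)))
          Pskip)
        Pskip)).

(* pw1 and pw2 are the lengths of blocks and windows, pm the number of blocks of
   a window, pNV and pNK the numbers of windows and blocks, pg the grid step, pH
   half the width of the band, pG = pH / pg, pK1 the number of pivots, pL the
   number of samples, plev the number of levels; pX bounds all array indices. *)
Record params := Params {
  pn : nat; ptau : nat; pa : nat; pb : nat; pw1 : nat; pg : nat; pm : nat;
  pH : nat; pK1 : nat; pL : nat; pNV : nat; plev : nat; pG : nat; pX : nat
}.

Definition pw2 P := pm P * pw1 P.
(** [x] starts here and [y] right behind it. The zeros in front keep every band offset, at most 6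
    half-widths to the left of [y], away from truncated subtraction. *)
Definition pX0 P := 8 * pH P.
Definition pY0 P := 8 * pH P + pn P.
Definition pNK P := pNV P * pm P.
(** A power of two, so that a fixed number of coins gives an exactly uniform number, without
    rejection. *)
Definition pQ P := 2 ^ (pa P + 3).

(* Contents of the registers below 40 after initialization. *)
Definition cenv P : nat -> nat :=
  nth 0 [:: pn P; ptau P; 2 * pn P; pa P; pb P; pw1 P; pg P; pw2 P; pH P; pm P;
            pX0 P; pY0 P; pa P + 3; pK1 P; pL P; pK1 P + pL P; pNK P; pNV P;
            4 * pH P; 8 * pH P; plev P; (2 * pG P).+1; 2 * pG P; 2 * pg P].

Definition cst P (s : astate) := forall i, i < 40 -> areg s i = cenv P i.

Lemma cstE P s : cst P s ->
  ((areg s 0 = (pn P)%N) *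
  (areg s 1 = (ptau P)%N) *
  (areg s 2 = (2 * pn P)%N) *
  (areg s 3 = (pa P)%N) *
  (areg s 4 = (pb P)%N) *
  (areg s 5 = (pw1 P)%N) *
  (areg s 6 = (pg P)%N) *
  (areg s 7 = (pw2 P)%N) *
  (areg s 8 = (pH P)%N) *
  (areg s 9 = (pm P)%N) *
  (areg s 10 = (pX0 P)%N) *
  (areg s 11 = (pY0 P)%N) *
  (areg s 12 = (pa P + 3)%N) *
  (areg s 13 = (pK1 P)%N) *
  (areg s 14 = (pL P)%N) *
  (areg s 15 = (pK1 P + pL P)%N) *
  (areg s 16 = (pNK P)%N) *
  (areg s 17 = (pNV P)%N) *
  (areg s 18 = (4 * pH P)%N) *
  (areg s 19 = (8 * pH P)%N) *
  (areg s 20 = (plev P)%N) *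
  (areg s 21 = ((2 * pG P).+1)%N) *
  (areg s 22 = (2 * pG P)%N) *
  (areg s 23 = (2 * pg P)%N))%type.
Proof. by move=> c; do !split; rewrite c. Qed.

Lemma frame_cst P p s s' : frame p s s' -> all (leq 40) (wr p) -> cst P s -> cst P s'.
Proof.
move=> [fr _ _ _] /allP ge c i lti; rewrite fr ?c //.
by apply/negP => /ge; rewrite leqNgt lti.
Qed.

Lemma setr_cst P s i v : 40 <= i -> cst P s -> cst P (setr s i v).
Proof. by move=> gei c j ltj; rewrite setr_reg ?c //; lia. Qed.

Record wfp P : Prop := WfP {
  n_gt0 : 0 < pn P;
  w1_gt0 : 0 < pw1 P;
  g_gt0 : 0 < pg P;
  m_gt0 : 0 < pm P;
  H_gt0 : 0 < pH P;
  w1_le_H : pw1 P <= pH P;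
  G_def : pG P * pg P = pH P;
  N_le : pNV P * pw2 P <= pn P;
  H_le : 8 * pH P <= pn P;
  w2_le : 100 * pw2 P <= pn P;
  Q_ge : 2 * pn P + 4 * pH P <= pQ P;
  X_Q : 100 * pQ P <= pX P;
  X_n : 100 * pn P <= pX P;
  X_K : 8 * pH P * (pK1 P).+1 <= pX P;
  X_L : pK1 P + pL P + 2 <= pX P;
  X_lev : 51 * (pg P * 2 ^ plev P) <= pX P;
  X_m : 100 * (pw1 P * pm P) <= pX P;
  X_a : pa P + 100 <= pX P
}.

Lemma wp_setq w b i e p s T (Q : astate -> Prop) : asafe w b s e ->
  wp w b p (setr s i (aeval s e)) T Q -> wp w b (PSeq (PSet i e) p) s T.+2 Q.
Proof. by move=> sa h; apply: (@wp_seq _ _ _ _ _ 1 T); [apply: wp_set | lia]. Qed.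

Lemma flat_lt v u j J : v < u -> j < J -> v * J + j < u * J.
Proof.
by move=> lt ltj; apply: leq_trans (_ : v.+1 * J <= _); [rewrite mulSn; lia | rewrite leq_mul2r lt orbT].
Qed.

Ltac safe_split := repeat match goal with
  | |- _ /\ _ => split
  | |- [/\ _, _ & _] => split
  end.

Section Phase1.
Variables (P : params) (w b : nat) (t R : nat -> nat).
Hypotheses (wP : wfp P) (wX : b + 16 * pX P + 32 < 2 ^ w).
Local Notation n := (pn P).
Local Notation w1 := (pw1 P).
Local Notation H := (pH P).
Local Notation wp := (wp w b).

Definition pivot r := pY0 P - 2 * H + r.
(** Exactly the range of [r] for which the index [k * w1 + 4 * H - r] of block [k] falls on the
    [4 * H] diagonals of the band around pivot [r]. *)
Definition near r k := (k * w1 < r) && (r <= k * w1 + 4 * H).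
(** One band computation per pivot serves all near blocks: the first position of the band and the
    index add up to the start of block [k], whatever [r] is. *)
Definition pivot_dist r k :=
  match_row t (pivot r) (pX0 P - 4 * H + r) (4 * H) w1 (k * w1 + 4 * H - r).

Fixpoint best u k :=
  if u is u'.+1 then
    if near (R u') k && (pivot_dist (R u') k < best u' k) then pivot_dist (R u') k
    else best u' k
  else w1.

Definition pivot_row r j := match_row t (pivot r) (pivot r - 4 * H) (8 * H) w1 j.

(** In the row of pivot [R v], entry [5 * H + k * w1 - R v] belongs to the piece of [y] at
    [pY0 P - H + k * w1], the lowest diagonal of the grid; the next [2 * H] entries cover the
    others. *)
Definition tables u (s : astate) :=
  (forall k, k < pNK P -> best u k < w1 -> exists2 v, v < u &
     [/\ near (R v) k, best u k = pivot_dist (R v) k &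
         aarr s 3 k = v * (8 * H) + (5 * H + k * w1 - R v)]) /\
  (forall v j, v < u -> j < 8 * H -> aarr s 4 (v * (8 * H) + j) = pivot_row (R v) j).

Lemma NK_le k : k < pNK P -> k * w1 + w1 <= n.
Proof.
move=> ltk; apply: leq_trans (N_le wP); rewrite /pw2 mulnA -/(pNK P) addnC -mulSn.
by rewrite leq_mul2r ltk orbT.
Qed.

Lemma best_le u k : best u k <= w1.
Proof. by elim: u => //= u IH; case: ifP => // /andP[_ /ltnW h]; exact: leq_trans IH. Qed.

Lemma Ppivots_spec s : cst P s -> aarr s 0 = t ->
  (forall u, u < pK1 P -> aarr s 1 u = R u /\ R u < pQ P) ->
  wp Ppivots s (10 + 4 * pNK P + pK1 P * (480 * (w1 * H) + 24 * pNK P + 60 + 240 * H))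
    (fun s' => (forall k, k < pNK P -> aarr s' 2 k = best (pK1 P) k) /\
      tables (pK1 P) s').
Proof.
move=> cs et eR.
have [n0 w10 g0 m0 H0 w1H Gd Nle Hle _ Qge XQ Xn XK XL Xlev Xm Xa] := wP.
have NKn : pNK P <= n by have := N_le wP; rewrite /pNK /pw2; nia.
apply: (@wp_seq _ _ _ _ _ (3 + pNK P * 4) (3 + pK1 P * (480 * (w1 * H) + 24 * pNK P + 54 + 240 * H))).
  2: by nia.
apply: (@wp_for _ _ _ _ _ _ (pNK P) _ 1 (fun k s' =>
   forall k', k' < k -> aarr s' 2 k' = w1)) => //.
- by rewrite cs.
- by lia.
- move=> k s' ltk e50 [fr _ _ _] inv.
  apply: wp_sto => //=; first by rewrite e50; lia.
  move=> k' ltk'; rewrite e50 fr // cs //=; case: eqP => // ne.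
  by apply: inv; lia.
move=> s1 _ F1 inv1; have [fr1 fa1 _ _] := F1.
have cs1 := frame_cst F1 isT cs.
apply: (@wp_for _ _ _ _ _ _ (pK1 P) _ (480 * (w1 * H) + 24 * pNK P + 51 + 240 * H) (fun u s' =>
   (forall k, k < pNK P -> aarr s' 2 k = best u k) /\ tables u s')) => //.
- by rewrite fr1 // cs.
- by lia.
- by split=> [k /inv1 //|]; split=> // k _; rewrite /= ltnn.
- move=> u s2 ltu e50 F2 [inv2 [tab3 tab4]]; have [fr2 fa2 _ _] := F2.
  have cs2 := frame_cst F2 isT cs1; have c2 := cstE cs2.
  have t2 : aarr s2 0 = t by rewrite fa2 // fa1.
  have R2 : aarr s2 1 u = R u by rewrite fa2 // fa1 //; case: (eR u ltu).
  have ltR : R u < pQ P by case: (eR u ltu).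
  have uK : u * (8 * H) + 8 * H <= pX P by nia.
  have T0 : exists T0, 480 * (w1 * H) + 24 * pNK P + 51 + 240 * H = T0.+4.+4.+4.+2 /\
     T0 = 480 * (w1 * H) + 24 * pNK P + 37 + 240 * H by eexists; split; last by []; lia.
  have [T [-> eT]] := T0.
  do 7 (apply: wp_setq => /=;
    first by rewrite ?c2 ?e50 ?R2 /pX0 /pY0; safe_split; lia).
  rewrite /= !c2 e50 R2.
  set s3 := setr _ 45 0.
  apply: (@wp_seq _ _ _ _ _ (20 * (w1.+1 * (4 * H))) (20 * (w1.+1 * (8 * H)) + 24 * pNK P + 14).+4.+4).
    2: by nia.
  apply: (wp_conseq (@Pmatch_spec _ _ 5 s3 (pivot (R u)) w1 (pX0 P - 4 * H + R u) (4 * H) 0 (pX P)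
     _ _ _ _ _ _ _ _ _ _ _ _ _)) => //=; rewrite ?/pivot /pX0 /pY0; try lia.
  move=> s4 F4 [m4 _]; have [fr4 fa4 _ _] := F4.
  have cs3 : cst P s3 by do !apply: setr_cst.
  have cs4 := frame_cst F4 isT cs3.
  do 4 (apply: wp_setq => /=;
    first by rewrite ?fr4 //= ?c2 ?e50 /pX0 /pY0; safe_split; lia).
  rewrite /= !fr4 //= !c2 !e50.
  set s5 := setr _ 45 _.
  apply: (@wp_seq _ _ _ _ _ (20 * (w1.+1 * (8 * H))) (24 * pNK P + 13)); last by lia.
  apply: (wp_conseq (@Pmatch_spec _ _ 4 s5 (pivot (R u)) w1 (pivot (R u) - 4 * H) (8 * H)
     (u * (8 * H)) (pX P) _ _ _ _ _ _ _ _ _ _ _ _ _)) => //=;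
    rewrite ?fr4 //= ?c2 /pivot /pX0 /pY0; try lia.
  move=> s6 F6 [m6 m6']; have [fr6 fa6 _ _] := F6.
  have {}fa4 r : r != 5 -> aarr s4 r = aarr s2 r.
    by move=> hr; apply: fa4; rewrite /= !inE; lia.
  have {}fa6 r : r != 4 -> aarr s6 r = aarr s4 r.
    by move=> hr; apply: fa6; rewrite /= !inE; lia.
  have {}m4 j : j < 4 * H -> aarr s4 5 j =
      match_row t (pivot (R u)) (pX0 P - 4 * H + R u) (4 * H) w1 j.
    by move=> ltj; rewrite -[j in LHS]add0n m4 // t2.
  have {}m6 j : j < 8 * H -> aarr s6 4 (u * (8 * H) + j) = pivot_row (R u) j.
    by move=> ltj; rewrite m6 //= fa4 // t2.
  have cs6 : cst P s6 by apply: (frame_cst F6) => //; do !apply: setr_cst.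
  have {}c2 := cstE cs6.
  have e50' : areg s6 50 = u by rewrite fr6 //= fr4 //=.
  have e51' : areg s6 51 = R u by rewrite fr6 //= fr4 //=.
  have e45' : areg s6 45 = u * (8 * H) by rewrite fr6.
  (* Blocks before [k] have already been compared with pivot [u], the others not yet. *)
  apply: (@wp_for _ _ _ _ _ _ (pNK P) _ 7 (fun k s' =>
     [/\ forall k', k' < pNK P -> aarr s' 2 k' = best (if k' < k then u.+1 else u) k',
       forall k', k' < pNK P -> best (if k' < k then u.+1 else u) k' < w1 ->
         exists2 v, v < u.+1 & [/\ near (R v) k',
            best (if k' < k then u.+1 else u) k' = pivot_dist (R v) k' &
            aarr s' 3 k' = v * (8 * H) + (5 * H + k' * w1 - R v)] &
       aarr s' 4 = aarr s6 4])) => //.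
  + by rewrite c2.
  + by lia.
  + split=> [k ltk|k ltk|//] /=.
      by rewrite fa6 // fa4 // inv2.
    by rewrite fa6 // fa4 // => /tab3 - /(_ ltk)[v ltv h]; exists v => //; lia.
  + move=> k s7 ltk e52 F7 [i1 i2 i3]; have [fr7 fa7 _ _] := F7.
    have cs7 := frame_cst F7 isT cs6; have c7 := cstE cs7.
    have kn := NK_le ltk.
    have e50'' : areg s7 50 = u by rewrite fr7.
    have e51'' : areg s7 51 = R u by rewrite fr7.
    have e45'' : areg s7 45 = u * (8 * H) by rewrite fr7.
    have v2 : aarr s7 2 k = best u k by rewrite i1 // ltnn.
    have b2 := best_le u k.
    have ltS k' : k' != k -> (k' < k.+1) = (k' < k) by lia.
    (* Shared by the two branches in which pivot [u] is too far away or no improvement for block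
       [k]. *)
    have keep s8 : (near (R u) k && (pivot_dist (R u) k < best u k)) = false ->
        aarr s8 2 = aarr s7 2 -> aarr s8 3 = aarr s7 3 -> aarr s8 4 = aarr s7 4 ->
        [/\ forall k', k' < pNK P -> aarr s8 2 k' = best (if k' < k.+1 then u.+1 else u) k',
         forall k', k' < pNK P -> best (if k' < k.+1 then u.+1 else u) k' < w1 ->
         exists2 v, v < u.+1 & [/\ near (R v) k',
            best (if k' < k.+1 then u.+1 else u) k' = pivot_dist (R v) k' &
            aarr s8 3 k' = v * (8 * H) + (5 * H + k' * w1 - R v)] &
         aarr s8 4 = aarr s6 4].
      move=> hb h2 h3 h4; split=> [k' ltk'|k' ltk'|]; last by rewrite h4.
        have [->|ne] := eqVneq k' k; last by rewrite h2 ltS ?i1.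
        by rewrite h2 v2 ltnSn /= hb.
      have [->|ne] := eqVneq k' k; last by rewrite h3 ltS //; apply: i2.
      by rewrite ltnSn /= hb h3; have := i2 k ltk; rewrite ltnn.
    apply: wp_setq => /=; first by rewrite e52 c7; safe_split; lia.
    rewrite e52 c7; apply: (@wp_if _ _ _ _ _ _ _ 4) => //=.
      by rewrite e51'' c7; safe_split; lia.
      rewrite e51'' c7 => hn; have {hn} nr : near (R u) k.
        by rewrite /near; move: hn; case: (k * w1 < R u) => //=; lia.
      have [nr1 nr2] : k * w1 < R u /\ R u <= k * w1 + 4 * H by move: nr; rewrite /near; lia.
      have v5 : aarr s7 5 (k * w1 + 4 * H - R u) = pivot_dist (R u) k.
        by rewrite fa7 // fa6 // m4 //; lia.
      have b5 : pivot_dist (R u) k <= w1 by apply: match_row_le; lia.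
      apply: (@wp_if _ _ _ _ _ _ _ 3) => //=; rewrite ?e51'' ?c7 ?e52 ?v5 ?v2.
      + by safe_split; lia.
      + move=> hlt; have {}hlt : pivot_dist (R u) k < best u k by lia.
        apply: (@wp_seq _ _ _ _ _ 1 1) => //.
        apply: wp_sto => //=; rewrite ?e51'' ?c7 ?e52 ?v5; safe_split; try lia.
        apply: wp_sto => //=; rewrite ?e45'' ?e51'' ?c7 ?e52 ?v5; safe_split; try lia.
        * move=> k' ltk'; have [->|ne] := eqVneq k' k; last by rewrite ltS // i1.
          by rewrite ltnSn /= nr hlt.
        * move=> k' ltk'; have [->|ne] := eqVneq k' k; last by rewrite ltS //; apply: i2.
          by rewrite ltnSn /= nr hlt => _; exists u => //; split=> //; lia.
        * exact: i3.
      + move=> hlt; apply: wp_set => //=; first by lia.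
        by apply: keep => //; rewrite nr; lia.
    rewrite e51'' c7 => hn; apply: wp_set => //=; first by lia.
    apply: keep => //; rewrite /near; move: hn; case: (k * w1 < R u) => //=; lia.
  + move=> s8 _ F8 [i1 i2 i3]; split=> [k ltk|].
      by have := i1 k ltk; rewrite ltk.
    split=> [k ltk hb|v j ltv ltj] /=.
      by have := i2 k ltk; rewrite ltk => /(_ hb).
    rewrite i3; have [->|ne] := eqVneq v u; first exact: m6.
    rewrite m6'; last by left; apply: flat_lt => //; lia.
    by rewrite fa4 // tab4 //; lia.
  + by lia.
- by lia.
Qed.

End Phase1.

(** * Phase 2 *)

Definition Pfilter r cond val : prog :=
  61 ::= #0;;
  PFor 63 62 (PIf cond (PSto r $61 val;; 61 ::= $61 + #1) Pskip).

Definition Pext : prog :=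
  67 ::= 11:[$66] * $55;;
  40 ::= $10 + $53 * $7;;
  41 ::= $7;;
  42 ::= $11 + $53 * $7 + $67 - $8 - $64;;
  43 ::= #2 * $64 + #1;;
  44 ::= #2 * $64;;
  45 ::= #0;;
  Pmatch 7;;
  PFor 68 65 (PIf ($64 < $67 + $68 * $6 + #1)
    (PSto 8 ($67 + $68 * $6 - $64) (amin (8:[$67 + $68 * $6 - $64]) (7:[$68 * $6])))
    Pskip).

Definition Psample : prog :=
  40 ::= $10 + $60 * $5;;
  41 ::= $5;;
  42 ::= $11 - #2 * $8 + $60 * $5;;
  43 ::= $18;;
  44 ::= $18 - #1;;
  45 ::= #0;;
  Pmatch 5;;
  62 ::= #2 * $8 %/ $55;;
  Pfilter 11 (5:[$8 + $63 * $55] < #15 * $55 + #1) $63;;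
  PIf ($61 * $55 < $7)
    (64 ::= #36 * $55 * $9;;
     65 ::= #2 * ($64 %/ $6) + #1;;
     PFor 66 61 Pext)
    Pskip.

Definition Plevel : prog :=
  62 ::= $9;;
  Pfilter 6 (#51 * $55 < 2:[$53 * $9 + $63]) ($53 * $9 + $63);;
  57 ::= $61;;
  PIf $57
    (PFor 59 14 (60 ::= 6:[1:[$13 + $59] %% $57];; Psample))
    Pskip.

Definition Plevels : prog :=
  55 ::= $6;;
  PFor 56 20 (Plevel;; 55 ::= #2 * $55).

Section Phase2.
Variables (P : params) (w b : nat) (AR : nat -> nat -> nat).
Hypotheses (wP : wfp P) (wX : b + 16 * pX P + 32 < 2 ^ w).
Hypothesis AR_rand : forall u, u < pK1 P + pL P -> AR 1 u < pQ P.
Hypothesis AR_best : forall k, k < pNK P -> AR 2 k <= pw1 P.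
Local Notation n := (pn P).
Local Notation w1 := (pw1 P).
Local Notation w2 := (pw2 P).
Local Notation g := (pg P).
Local Notation m := (pm P).
Local Notation H := (pH P).
Local Notation t := (AR 0).
Local Notation wp := (wp w b).

Definition ctx (s : astate) := cst P s /\ forall r, r < 5 -> aarr s r = AR r.

Lemma frame_ctx p s s' : frame p s s' -> all (leq 40) (wr p) -> all (leq 5) (wa p) ->
  ctx s -> ctx s'.
Proof.
move=> F h1 /allP h2 [cs ar]; split; first exact: frame_cst F h1 cs.
have [_ fa _ _] := F; move=> r ltr; rewrite fa ?ar //.
by apply/negP => /h2; rewrite leqNgt ltr.
Qed.

Lemma setr_ctx s i v : 40 <= i -> ctx s -> ctx (setr s i v).
Proof. by move=> gei [cs ar]; split=> //; apply: setr_cst. Qed.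

Lemma Pfilter_spec r cond val s N base (p : pred nat) : 5 < r < 16 -> wfe cond -> wfe val ->
  areg s 62 = N -> N + 2 <= pX P ->
  (forall k s', k < N -> areg s' 63 = k ->
     (forall x, x \notin [:: 61; 63; 90] -> areg s' x = areg s x) ->
     (forall r', r' != r -> aarr s' r' = aarr s r') ->
     [/\ asafe w b s' cond, (aeval s' cond != 0) = p (base + k), asafe w b s' val &
         aeval s' val = base + k]) ->
  wp (Pfilter r cond val) s (5 + 7 * N) (fun s' =>
    let l := [seq k <- iota base N | p k] in
    areg s' 61 = size l /\ forall x, x < size l -> aarr s' r x = nth 0 l x).
Proof.
move=> /andP[gtr ltr] wfc wfv e62 NX hyp.
have -> : 5 + 7 * N = (3 + 7 * N).+2 by lia.
apply: wp_setq => //=; first by lia.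
pose l k := [seq x <- iota base k | p x].
have lS k : l k.+1 = if p (base + k) then rcons (l k) (base + k) else l k.
  by rewrite /l -addn1 iotaD filter_cat /=; case: ifP => _; rewrite ?cats1 ?cats0.
have szl k : size (l k) <= k by rewrite /l size_filter -[leqRHS](size_iota base k) count_size.
apply: (@wp_for _ _ _ _ _ _ N _ 4 (fun k s' => areg s' 61 = size (l k) /\
   forall x, x < size (l k) -> aarr s' r x = nth 0 (l k) x)) => //.
- by rewrite /= wfc wfv ltr.
- by lia.
- move=> k s' ltk e63 [fr fa _ _] [i1 i2].
  have [||sc pc sv ev] := hyp k s' ltk e63.
  + by move=> x; rewrite !inE !negb_or => /and3P[h1 h2 h3]; rewrite fr //= ?(negbTE h1) // !inE;
      rewrite !negb_or h1 h2 h3.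
  + by move=> r' hr; rewrite fa //= inE.
  have szk := szl k.
  apply: (@wp_if _ _ _ _ _ _ _ 3) => //; rewrite -?pc.
    move=> hc; apply: (@wp_seq _ _ _ _ _ 1 1) => //.
    apply: wp_sto => //=; first by rewrite i1; lia.
    apply: wp_set => //=; rewrite ?i1; safe_split; try lia; rewrite lS -pc hc size_rcons ?addn1 //.
    move=> x ltx; rewrite eqxx ev nth_rcons; case: (x =P size (l k)) => [->|ne].
      by rewrite ltnn.
    by rewrite ifT ?i2 //; lia.
  move=> hc; apply: wp_set => //=; first by lia.
  by rewrite lS -pc hc.
- by lia.
Qed.

Definition sound v (C : nat -> nat) := forall j, j <= 2 * pG P ->
  wdist t (pX0 P + v * w2) (pY0 P - H + j * g + v * w2) w2 <= C (j * g).

(** Later updates only decrease the table and keep it sound, so what one sample has achieved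
    survives all later ones. *)
Definition lowers v (C C' : nat -> nat) :=
  (forall e, C' e <= C e) /\ (sound v C -> sound v C').

Lemma lowers_refl v C : lowers v C C.
Proof. by split. Qed.

Lemma lowers_trans v C1 C2 C3 : lowers v C1 C2 -> lowers v C2 C3 -> lowers v C1 C3.
Proof. by move=> [a1 a2] [b1 b2]; split=> [e|/a2/b2//]; exact: leq_trans (b1 e) (a1 e). Qed.

(** Wide enough for a path whose cost in the window is a small multiple of [s * m]; the factor 36
    leaves 32 after the losses in [start_level]. *)
Definition halfband s := 36 * s * m.

Definition ext v s i f :=
  match_row t (pX0 P + v * w2) (pY0 P + v * w2 + i * s - H - halfband s)
    (2 * halfband s + 1) w2 f.

(** The table is indexed by diagonals and only multiples of [g] matter. As [g] divides [s] and the
    half-width, stepping by [g] from the edge of the band meets all of them. *)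
Definition extended v s i (C : nat -> nat) := forall f, f * g <= 2 * halfband s ->
  halfband s <= i * s + f * g -> C (i * s + f * g - halfband s) <= ext v s i (f * g).

Lemma extended_lowers v s i C C' : lowers v C C' -> extended v s i C -> extended v s i C'.
Proof. by move=> [a1 _] ex f h1 h2; apply: leq_trans (a1 _) (ex _ h1 h2). Qed.

Lemma Pext_spec st v s i : ctx st -> v < pNV P -> areg st 53 = v -> areg st 55 = s ->
  areg st 64 = halfband s -> areg st 65 = 2 * (halfband s %/ g) + 1 ->
  aarr st 11 (areg st 66) = i -> areg st 66 <= pX P -> i * s <= 2 * H -> g %| s -> 0 < s -> s <= w1 ->
  halfband s <= w2 -> (forall e, aarr st 8 e <= w2) ->
  wp Pext st (45 * (w2.+1 * (2 * halfband s).+1)) (fun st' =>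
    lowers v (aarr st 8) (aarr st' 8) /\ extended v s i (aarr st' 8)).
Proof.
move=> cx ltv e53 e55 e64 e65 e11 b66 iH gs s0 sw1 hw2 C0.
have [n0 w10 g0 m0 H0 w1H Gd Nle Hle w2le Qge XQ Xn XK XL Xlev Xm Xa] := wP.
set h := halfband s in e64 e65 hw2 *.
have gh : g %| h by rewrite /h /halfband dvdn_mulr // dvdn_mull.
have vn : v * w2 + w2 <= n by apply: leq_trans Nle; rewrite addnC -mulSn leq_mul2r ltv orbT.
have h0 : 0 < h by rewrite /h /halfband !muln_gt0 s0 m0.
have -> : 45 * (w2.+1 * (2 * h).+1) = ((20 * (w2.+1 * (2 * h).+1) + 25 * (w2.+1 * (2 * h).+1) - 14)).+4.+4.+4.+2.
  have : 1 <= w2.+1 * (2 * h).+1 by rewrite muln_gt0. lia.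
have c2 := cstE cx.1.
do 7 (apply: wp_setq => /=;
  first by rewrite ?c2 ?e53 ?e55 ?e64 ?e11 /pX0 /pY0; safe_split; lia).
rewrite /= !c2 e53 e55 e64 e11.
set s3 := setr _ 45 0.
have cx3 : ctx s3 by do !apply: setr_ctx.
apply: (@wp_seq _ _ _ _ _ (20 * (w2.+1 * (2 * h + 1))) (3 + 5 * (2 * h + 1))); last first.
  rewrite addn1; have : (2 * h).+1 * 2 <= w2.+1 * (2 * h).+1 by rewrite mulnC leq_mul2r; lia.
  lia.
apply: (wp_conseq (@Pmatch_spec _ _ 7 s3 (pX0 P + v * w2) w2 (pY0 P + v * w2 + i * s - H - h)
   (2 * h + 1) 0 (pX P) _ _ _ _ _ _ _ _ _ _ _ _ _)) => //=; rewrite ?/pX0 ?/pY0; try lia.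
move=> s4 F4 [m4 _].
have cx4 := frame_ctx F4 isT isT cx3; have c4 := cstE cx4.1.
have [fr4 fa4 _ _] := F4.
have {}m4 f : f < 2 * h + 1 -> aarr s4 7 f = ext v s i f.
  move=> ltf; rewrite -[f in LHS]add0n m4 // /ext.
  by rewrite -[t]cx.2.
have e8 : aarr s4 8 = aarr st 8 by rewrite fa4.
have hdiv : h %/ g * g = h by rewrite divnK.
have e53' : areg s4 53 = v by rewrite fr4.
apply: (@wp_for _ _ _ _ _ _ (2 * (h %/ g) + 1) _ 2 (fun f s' =>
   lowers v (aarr st 8) (aarr s' 8) /\ forall f', f' < f ->
     h <= i * s + f' * g -> aarr s' 8 (i * s + f' * g - h) <= ext v s i (f' * g))) => //.
- by rewrite fr4.
- by have := leq_div h g; lia.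
- by split=> [|//]; rewrite /= e8; exact: lowers_refl.
- move=> f s5 ltf e68 F5 [low ex].
  have cx5 := frame_ctx F5 isT isT cx4; have c5 := cstE cx5.1.
  have [fr5 fa5 _ _] := F5.
  have fg : f * g <= 2 * h by rewrite -hdiv mulnA leq_mul2r; lia.
  have e64' : areg s5 64 = h by rewrite fr5 //= fr4.
  have e67' : areg s5 67 = i * s by rewrite fr5 //= fr4.
  have v7 : aarr s5 7 (f * g) = ext v s i (f * g) by rewrite fa5 // m4 //; lia.
  have b7 : ext v s i (f * g) <= w2 by apply: match_row_le; rewrite -/h; lia.
  have bC e : aarr s5 8 e <= w2 by apply: leq_trans (low.1 e) (C0 e).
  apply: (@wp_if _ _ _ _ _ _ _ 1) => //=; rewrite ?e64' ?e67' ?e68 ?c5; first by safe_split; lia.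
    move=> hn; have {}hn : h <= i * s + f * g by lia.
    have bCe := bC (i * s + f * g - h).
    apply: wp_sto => //=; rewrite ?e64' ?e67' ?e68 ?c5 ?v7; safe_split; try lia.
      apply: lowers_trans low _; split=> [e|so j lej] /=.
        by case: eqP => [->|_]; lia.
      (* Only the entry just written is at stake; its new value is the smaller of two upper bounds
         of the distance. *)
      case: eqP => [ej|_]; last exact: so.
      have so' := so j lej; have eC : aarr s5 8 (j * g) = aarr s5 8 (i * s + f * g - h) by rewrite ej.
      have : wdist t (pX0 P + v * w2) (pY0 P - H + j * g + v * w2) w2 <= ext v s i (f * g).
        rewrite (_ : pY0 P - H + j * g + v * w2 =
          pY0 P + v * w2 + i * s - H - h + f * g); last by rewrite /pY0 ej; lia.
        by apply: match_row_lower; rewrite -/h; lia.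
      by lia.
    move=> f' ltf' hf' /=; case: (f' =P f) => [->|ne]; first by rewrite eqxx; lia.
    have := ex f' ltac:(lia) hf'; case: eqP => [->|_]; last by [].
    by lia.
  move=> hn; apply: wp_set => //=; first by lia.
  split=> // f' ltf' hf'; apply: ex => //.
  by case: (f' =P f) => [ef|ne]; [subst f'; lia | lia].
- move=> s5 _ _ [low ex]; split=> // f fh hf; apply: ex => //.
  by rewrite addn1 ltnS -(leq_pmul2r g0) -mulnA hdiv.
- by have := leq_div h g; lia.
Qed.

(** The band exceeds that of the grid by [H] on each side, so that [match_row_upper] applies on
    every diagonal [H + i * s] inside the grid. *)
Definition samp k j := match_row t (pX0 P + k * w1) (pY0 P - 2 * H + k * w1) (4 * H) w1 j.

(** Testing multiples of [s] suffices. If the block costs at most [s] on the path, the multiple just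
    below the path is at distance at most 3 s + 2 s, and the estimate at most triples this: 15 s. *)
Definition cands k s := [seq i <- iota 0 (2 * H %/ s) | samp k (H + i * s) <= 15 * s].

(** Each candidate stands for [s] positions of [y]. Fewer than [w2] positions keep the extensions
    cheap; with at least [w2], a random pivot hits one of them. *)
Definition sparse k s := size (cands k s) * s < w2.

Definition sampled v s k (C : nat -> nat) := sparse k s ->
  forall i, i \in cands k s -> extended v s i C.

Lemma sampled_lowers v s k C C' : lowers v C C' -> sampled v s k C -> sampled v s k C'.
Proof. by move=> low sa /sa h i /h; exact: extended_lowers. Qed.

Definition Tsample := 100 * (w1.+1 * H) + 40 + 3600 * (m * (w2 * w2.+1)).

Lemma Psample_spec st v s k : ctx st -> v < pNV P -> areg st 53 = v -> areg st 55 = s ->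
  areg st 60 = k -> k < pNK P -> g %| s -> 0 < s -> 51 * s < w1 ->
  (forall e, aarr st 8 e <= w2) ->
  wp Psample st Tsample (fun st' =>
    lowers v (aarr st 8) (aarr st' 8) /\ sampled v s k (aarr st' 8)).
Proof.
move=> cx ltv e53 e55 e60 ltk gs s0 sw1 C0.
have [n0 w10 g0 m0 H0 w1H Gd Nle Hle w2le Qge XQ Xn XK XL Xlev Xm Xa] := wP.
have kn := NK_le wP ltk.
have hw2 : halfband s <= w2.
  by rewrite /halfband /pw2 mulnC leq_mul2l; apply/orP; right; lia.
have c2 := cstE cx.1.
rewrite /Tsample (_ : 100 * _ + 40 + _ =
  (100 * (w1.+1 * H) + 28 + 3600 * (m * (w2 * w2.+1))).+4.+4.+4); last by lia.
do 6 (apply: wp_setq => /=;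
  first by rewrite ?c2 ?e53 ?e55 ?e60 /pX0 /pY0; safe_split; lia).
rewrite /= !c2 e60.
set s3 := setr _ 45 0.
have cx3 : ctx s3 by do !apply: setr_ctx.
apply: (@wp_seq _ _ _ _ _ (20 * (w1.+1 * (4 * H))) (18 * H + 26 + 3600 * (m * (w2 * w2.+1))).+2);
  last by lia.
apply: (wp_conseq (@Pmatch_spec _ _ 5 s3 (pX0 P + k * w1) w1 (pY0 P - 2 * H + k * w1)
   (4 * H) 0 (pX P) _ _ _ _ _ _ _ _ _ _ _ _ _)) => //=; rewrite ?/pX0 ?/pY0; try lia.
move=> s4 F4 [m4 _].
have cx4 := frame_ctx F4 isT isT cx3; have c4 := cstE cx4.1.
have [fr4 fa4 _ _] := F4.
have {}m4 j : j < 4 * H -> aarr s4 5 j = samp k j.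
  by move=> ltj; rewrite -[j in LHS]add0n m4 // /samp -[t]cx.2.
have e55' : areg s4 55 = s by rewrite fr4.
apply: wp_setq => /=; first by rewrite c4 e55'; have h := leq_div (2 * H) s; safe_split; lia.
rewrite c4 e55'; set N := 2 * H %/ s.
have NH : N <= 2 * H by exact: leq_div.
have NsH : N * s <= 2 * H by exact: leq_divM.
set s5 := setr s4 62 N.
have cx5 : ctx s5 by exact: setr_ctx.
have c5 := cstE cx5.1.
apply: (@wp_seq _ _ _ _ _ (5 + 7 * N) (18 + 3600 * (m * (w2 * w2.+1)))); last by lia.
apply: (wp_conseq (@Pfilter_spec 11 _ _ s5 N 0 (fun i => samp k (H + i * s) <= 15 * s)
   _ _ _ _ _ _)) => //; first by lia.
  move=> i s' lti e63 fr fa.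
  have iN : i * s + s <= 2 * H.
    by apply: leq_trans NsH; rewrite addnC -mulSn leq_mul2r lti orbT.
  have c' : areg s' 8 = H by rewrite fr //= c4.
  have e55'' : areg s' 55 = s by rewrite fr.
  have v5 : aarr s' 5 (H + i * s) = samp k (H + i * s) by rewrite fa //= m4; lia.
  have bs : samp k (H + i * s) <= w1 by apply: match_row_le; lia.
  split=> //=; rewrite ?c' ?e55'' ?e63 ?v5 ?add0n //; first by safe_split; lia.
  by lia.
move=> s6 F6 /= [e61 e11].
have cx6 := frame_ctx F6 isT isT cx5; have c6 := cstE cx6.1.
have [fr6 fa6 _ _] := F6.
have e55'' : areg s6 55 = s by rewrite fr6.
have e53'' : areg s6 53 = v by rewrite fr6 //= fr4.
have e8 : aarr s6 8 = aarr st 8 by rewrite fa6 //= fa4.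
have szN : size (cands k s) <= N by rewrite size_filter -[leqRHS](size_iota 0 N) count_size.
rewrite -/(cands k s) in e61 e11.
have szs : size (cands k s) * s <= 2 * H.
  by apply: leq_trans NsH; rewrite leq_mul2r szN orbT.
apply: (@wp_if _ _ _ _ _ _ _ (17 + 3600 * (m * (w2 * w2.+1)))) => //=;
  rewrite ?e61 ?e55'' ?c6.
- by safe_split; lia.
- move=> hsp; have {}hsp : sparse k s by rewrite /sparse; lia.
  have hb : 36 * s * m = halfband s by [].
  rewrite (_ : 17 + _ = (13 + 3600 * (m * (w2 * w2.+1))).+4); last by lia.
  apply: wp_setq => /=; first by rewrite ?e55'' ?c6 hb; safe_split; try lia;
    rewrite /halfband in hw2; move: hw2; rewrite /pw2; nia.
  rewrite e55'' c6 hb.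
  apply: wp_setq => /=; first by rewrite c6; have h := leq_div (halfband s) g; safe_split; lia.
  rewrite c6; set s7 := setr _ 65 _.
  have cx7 : ctx s7 by do !apply: setr_ctx.
  apply: (@wp_for _ _ _ _ _ _ (size (cands k s)) _ (45 * (w2.+1 * (2 * halfband s).+1))
    (fun e s' => lowers v (aarr st 8) (aarr s' 8) /\ forall x, x < e ->
       extended v s (nth 0 (cands k s) x) (aarr s' 8))) => //.
  + by lia.
  + by rewrite /= e8; split=> //; exact: lowers_refl.
  + move=> e s8 lte e66 F8 [low ex].
    have cx8 := frame_ctx F8 isT isT cx7; have [fr8 fa8 _ _] := F8.
    have b8 x : aarr s8 8 x <= w2 by apply: leq_trans (low.1 x) (C0 x).
    have e11' : aarr s8 11 (areg s8 66) = nth 0 (cands k s) e.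
      by rewrite e66 fa8 // e11.
    have iH : nth 0 (cands k s) e * s <= 2 * H.
      apply: leq_trans NsH; rewrite leq_mul2r; apply/orP; right; apply: ltnW.
      have := mem_nth 0 lte; rewrite mem_filter mem_iota => /andP[_ /andP[_]].
      by rewrite add0n.
    have [f53 f55 f64 f65] : [/\ areg s8 53 = v, areg s8 55 = s, areg s8 64 = halfband s &
        areg s8 65 = 2 * (halfband s %/ g) + 1] by split; rewrite fr8.
    apply: (wp_conseq (@Pext_spec s8 v s _ cx8 ltv f53 f55 f64 f65 e11' _ iH gs s0 _ hw2 b8)) => //;
      rewrite ?e66; try lia.
    move=> s9 _ [low' ex']; split; first exact: lowers_trans low low'.
    move=> x; rewrite ltnS leq_eqVlt => /orP[/eqP -> //|ltx].
    by apply: extended_lowers low' (ex x ltx).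
  + move=> s8 _ _ [low ex]; split=> // _ i ic.
    by have := ex _ (_ : index i (cands k s) < _); rewrite index_mem nth_index // => /(_ ic).
  + have sm0 : 0 < s * m by rewrite muln_gt0 s0.
    have h1 : (2 * halfband s).+1 <= 73 * (s * m) by rewrite /halfband -mulnA; lia.
    (* Sparsity pays for the extensions: one takes time about [s * m * w2], and their number times
       [s] is below [w2]. *)
    have h2 : size (cands k s) * s * (m * w2.+1) <= w2 * (m * w2.+1).
      by rewrite leq_mul2r ltnW ?orbT.
    have h3 : 45 * (w2.+1 * (2 * halfband s).+1) + 3 <= 3600 * (s * (m * w2.+1)).
      have h4 : w2.+1 * (2 * halfband s).+1 <= w2.+1 * (73 * (s * m)) by rewrite leq_mul2l h1 orbT.
      have h5 : 1 <= s * (m * w2.+1) by rewrite !muln_gt0 s0 m0.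
      have : w2.+1 * (73 * (s * m)) = 73 * (s * (m * w2.+1)) by ring.
      by lia.
    have h6 : size (cands k s) * (45 * (w2.+1 * (2 * halfband s).+1) + 3) <=
        size (cands k s) * (3600 * (s * (m * w2.+1))) by rewrite leq_mul2l h3 orbT.
    have h7 : size (cands k s) * (3600 * (s * (m * w2.+1))) = 3600 * (size (cands k s) * s * (m * w2.+1)) by ring.
    have h8 : w2 * (m * w2.+1) = m * (w2 * w2.+1) by ring.
    by lia.
- move=> hsp; apply: wp_set => //=; first by lia.
  rewrite e8; split; first exact: lowers_refl.
  by rewrite /sampled /sparse => h; exfalso; lia.
Qed.

End Phase2.

(** * One window of the grid *)

Definition Prow : prog :=
  70 ::= $53 * $9 + $69;;
  PFor 71 21 (PIf (2:[$70] < $5)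
    (PSto 9 $71 (9:[$71] + amin $5 (2:[$70] + 4:[3:[$70] + $71 * $6])))
    (PSto 9 $71 (9:[$71] + $5)));;
  44 ::= $22;;
  45 ::= #0;;
  46 ::= $23;;
  Prelax 9.

Definition Pwin : prog :=
  PFor 54 21 (PSto 8 ($54 * $6) $7;; PSto 10 $54 (9:[$54]));;
  Plevels;;
  PFor 69 9 Prow;;
  PFor 71 21 (PSto 9 $71 (amin (9:[$71]) (10:[$71] + 8:[$71 * $6])));;
  44 ::= $22;;
  45 ::= #0;;
  46 ::= $23;;
  Prelax 9.

Section Phase2.
Variables (P : params) (w b : nat) (AR : nat -> nat -> nat).
Hypotheses (wP : wfp P) (wX : b + 16 * pX P + 32 < 2 ^ w).
Hypothesis AR_rand : forall u, u < pK1 P + pL P -> AR 1 u < pQ P.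
Hypothesis AR_best : forall k, k < pNK P -> AR 2 k <= pw1 P.
Hypothesis AR_tab : forall k, k < pNK P -> AR 2 k < pw1 P ->
  AR 3 k + 2 * pH P <= pX P /\
  forall j, j <= 2 * pG P -> AR 4 (AR 3 k + j * pg P) <= pw1 P.
Local Notation n := (pn P).
Local Notation w1 := (pw1 P).
Local Notation w2 := (pw2 P).
Local Notation g := (pg P).
Local Notation m := (pm P).
Local Notation H := (pH P).
Local Notation wp := (wp w b).
Local Notation ctx := (ctx P AR).
Local Notation lowers := (lowers P AR).
Local Notation sound := (sound P AR).
Local Notation sampled := (sampled P AR).

Definition far v s := [seq k <- iota (v * m) m | 51 * s < AR 2 k].

(** The random numbers depend neither on [v] nor on [s]; a union bound over windows and levels needs
    no independence between them. *)
Definition chosen v s u := nth 0 (far v s) (AR 1 (pK1 P + u) %% size (far v s)).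

Definition processed v s (C : nat -> nat) := forall u, u < pL P ->
  0 < size (far v s) -> sampled v s (chosen v s u) C.

Lemma processed_lowers v s C C' : lowers v C C' -> processed v s C -> processed v s C'.
Proof. by move=> low pr u ltu sz; apply: sampled_lowers low (pr u ltu sz). Qed.

Lemma vm_lt v k : v < pNV P -> k < m -> v * m + k < pNK P.
Proof. exact: flat_lt. Qed.

Definition Tlevel := 20 + 7 * m + pL P * (Tsample P + 10).

Lemma Plevel_spec st v s : ctx st -> v < pNV P -> areg st 53 = v -> areg st 55 = s ->
  g %| s -> 0 < s -> 51 * s <= pX P -> (forall e, aarr st 8 e <= w2) ->
  wp Plevel st Tlevel (fun st' =>
    lowers v (aarr st 8) (aarr st' 8) /\ processed v s (aarr st' 8)).
Proof.
move=> cx ltv e53 e55 gs s0 sX C0.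
have [n0 w10 g0 m0 H0 w1H Gd Nle Hle w2le Qge XQ Xn XK XL Xlev Xm Xa] := wP.
have NKn : pNK P <= n by have := Nle; rewrite /pNK /pw2 mulnA; apply: leq_trans; rewrite leq_pmulr.
have c2 := cstE cx.1.
have mX : m <= pX P by apply: leq_trans Xm; rewrite mulnA leq_pmull // muln_gt0.
have m2X : m + 2 <= pX P.
  have : m <= w2 by rewrite /pw2 leq_pmulr.
  by lia.
have [TL eTL] : exists TL, TL = pL P * (Tsample P + 10) by eexists.
rewrite /Tlevel -eTL (_ : 20 + _ + _ = (18 + 7 * m + TL).+2); last by lia.
apply: wp_setq => //=; rewrite c2; set s1 := setr st 62 m.
have cx1 : ctx s1 by exact: setr_ctx.
apply: (@wp_seq _ _ _ _ _ (5 + 7 * m) (12 + TL)); last by lia.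
apply: (wp_conseq (@Pfilter_spec _ w b wX 6 _ _ s1 m (v * m) (fun k => 51 * s < AR 2 k)
   _ _ _ _ _ _)) => //.
  move=> k s' ltk e63 fr fa; have ltk' := vm_lt ltv ltk; have bk := AR_best ltk'.
  have [f53 f55 f9] : [/\ areg s' 53 = v, areg s' 55 = s & areg s' 9 = m].
    by split; rewrite fr //= c2.
  have f2 : aarr s' 2 = AR 2 by rewrite fa //= cx.2.
  have vmk : v * m <= pX P by lia.
  by split=> //=; rewrite ?f53 ?f55 ?f9 ?e63 ?f2; safe_split; lia.
move=> s6 F6 /= [e61 e6].
have cx6 := frame_ctx F6 isT isT cx1; have c6 := cstE cx6.1.
have [fr6 fa6 _ _] := F6.
have e53' : areg s6 53 = v by rewrite fr6.
have e55' : areg s6 55 = s by rewrite fr6.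
have e8 : aarr s6 8 = aarr st 8 by rewrite fa6.
rewrite -/(far v s) in e61 e6.
rewrite (_ : 12 + _ = (10 + TL).+2); last by lia.
apply: wp_setq => //=; rewrite e61; set s7 := setr s6 57 _.
have cx7 : ctx s7 by exact: setr_ctx.
have szm : size (far v s) <= m by rewrite size_filter -[leqRHS](size_iota (v * m) m) count_size.
apply: (@wp_if _ _ _ _ _ _ _ (8 + TL)); [by [] | by rewrite ltn_add2r | |]; rewrite [aeval _ _]/=.
  move=> sz0; have {}sz0 : 0 < size (far v s) by lia.
  have far_in k : k \in far v s -> [/\ k < pNK P, k <= n & 51 * s < w1].
    rewrite mem_filter mem_iota => /and3P[h1 h2 h3].
    have h4 : k < pNK P by rewrite -(subnKC h2); apply: vm_lt => //; lia.
    by have := AR_best h4; split=> //; lia.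
  have [TS eTS] : exists TS, TS = Tsample P by eexists.
  apply: (@wp_for _ _ _ _ _ _ (pL P) _ TS.+2
    (fun u s' => lowers v (aarr st 8) (aarr s' 8) /\ forall u', u' < u ->
       sampled v s (chosen v s u') (aarr s' 8))).
  + by [].
  + by rewrite /= c6.
  + by lia.
  + by rewrite /= e8; split=> //; exact: lowers_refl.
  + move=> u s8 ltu e59 F8 [low pr].
    have cx8 := frame_ctx F8 isT isT cx7; have c8 := cstE cx8.1; have [fr8 fa8 _ _] := F8.
    have e57 : areg s8 57 = size (far v s) by rewrite fr8.
    have r1 : aarr s8 1 (pK1 P + u) = AR 1 (pK1 P + u) by rewrite cx8.2.
    have ltr := AR_rand (u := pK1 P + u) ltac:(lia).
    have ltm : AR 1 (pK1 P + u) %% size (far v s) < size (far v s) by rewrite ltn_mod.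
    have vch : aarr s8 6 (AR 1 (pK1 P + u) %% size (far v s)) = chosen v s u.
      by rewrite fa8 //= e6.
    have [chK chn sw1] := far_in _ (mem_nth 0 ltm); rewrite -/(chosen v s u) in chK chn.
    rewrite eTS; apply: wp_setq => /=; first by rewrite c8 e59 e57 r1; safe_split; lia.
    rewrite c8 e59 e57 r1 vch; set s9 := setr s8 60 _.
    have cx9 : ctx s9 by exact: setr_ctx.
    have b9 x : aarr s9 8 x <= w2 by apply: leq_trans (low.1 x) (C0 x).
    have f53 : areg s9 53 = v by rewrite /= fr8.
    have f55 : areg s9 55 = s by rewrite /= fr8.
    apply: (wp_conseq (@Psample_spec _ _ _ _ wP wX s9 v s (chosen v s u)
       cx9 ltv f53 f55 _ chK gs s0 sw1 b9)) => //.
    move=> s10 _ [low' ex']; split; first exact: lowers_trans low low'.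
    move=> x; rewrite ltnS leq_eqVlt => /orP[/eqP -> //|ltx].
    by apply: sampled_lowers low' (pr x ltx).
  + by move=> s8 _ _ [low pr]; split=> // u ltu _; exact: pr.
  + have : pL P * TS.+2.+3 <= pL P * (TS + 10) by rewrite leq_mul2l; lia.
    by rewrite eTL -eTS; lia.
move=> sz0; apply: wp_set => //=; first by lia.
by rewrite e8; split=> [|u _]; [exact: lowers_refl | rewrite sz0].
Qed.

Lemma Plevels_spec st v : ctx st -> v < pNV P -> areg st 53 = v ->
  (forall e, aarr st 8 e <= w2) ->
  wp Plevels st (5 + plev P * (Tlevel + 6)) (fun st' =>
    lowers v (aarr st 8) (aarr st' 8) /\
    forall l, l < plev P -> processed v (g * 2 ^ l) (aarr st' 8)).
Proof.
move=> cx ltv e53 C0.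
have [n0 w10 g0 m0 H0 w1H Gd Nle Hle w2le Qge XQ Xn XK XL Xlev Xm Xa] := wP.
have c2 := cstE cx.1.
have l2 l : l <= plev P -> g * 2 ^ l <= g * 2 ^ plev P.
  by move=> lel; rewrite leq_mul2l leq_exp2l // lel orbT.
have levX : plev P <= pX P.
  apply: leq_trans Xlev; apply: leq_trans (ltnW (ltn_expl _ (ltnSn 1))) _.
  by rewrite mulnA leq_pmull // muln_gt0.
apply: wp_setq => //=; rewrite c2; set s1 := setr st 55 g.
have cx1 : ctx s1 by exact: setr_ctx.
apply: (@wp_for _ _ _ _ _ _ (plev P) _ (Tlevel + 2) (fun l s' => areg s' 55 = g * 2 ^ l /\
   (lowers v (aarr st 8) (aarr s' 8) /\ forall l', l' < l ->
     processed v (g * 2 ^ l') (aarr s' 8)))) => //.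
- by rewrite /= c2.
- by lia.
- by rewrite /= muln1; split=> //; split=> //; exact: lowers_refl.
- move=> l s2 ltl e56 F2 [e55 [low pr]].
  have cx2 := frame_ctx F2 isT isT cx1; have [fr2 _ _ _] := F2.
  have f53 : areg s2 53 = v by rewrite fr2.
  have s0 : 0 < g * 2 ^ l by rewrite muln_gt0 g0 expn_gt0.
  have lX := l2 _ ltl; have eS : g * 2 ^ l.+1 = 2 * (g * 2 ^ l) by rewrite expnS; ring.
  have b2 x : aarr s2 8 x <= w2 by apply: leq_trans (low.1 x) (C0 x).
  apply: (@wp_seq _ _ _ _ _ Tlevel 1); last by lia.
  apply: (wp_conseq (@Plevel_spec s2 v (g * 2 ^ l) cx2 ltv f53 e55 _ s0 _ b2)) => //.
  + by rewrite dvdn_mulr.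
  + by lia.
  + move=> s3 F3 [low' pr']; have [fr3 _ _ _] := F3.
    have e55' : areg s3 55 = g * 2 ^ l by rewrite fr3.
    apply: wp_set => //=; rewrite e55'; first by safe_split; lia.
    split=> //; split; first exact: lowers_trans low low'.
    move=> x; rewrite ltnS leq_eqVlt => /orP[/eqP -> //|ltx].
    by apply: processed_lowers low' (pr x ltx).
- by move=> s2 _ _ [_ [low pr]].
- by have : plev P * (Tlevel + 2 + 3) <= plev P * (Tlevel + 6) by rewrite leq_mul2l; lia.
Qed.

End Phase2.

Section Rows.
Variables (P : params) (w b : nat) (AR : nat -> nat -> nat).
Hypotheses (wP : wfp P) (wX : b + 16 * pX P + 32 < 2 ^ w).
Hypothesis AR_rand : forall u, u < pK1 P + pL P -> AR 1 u < pQ P.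
Hypothesis AR_best : forall k, k < pNK P -> AR 2 k <= pw1 P.
Hypothesis AR_tab : forall k, k < pNK P -> AR 2 k < pw1 P ->
  AR 3 k + 2 * pH P <= pX P /\
  forall j, j <= 2 * pG P -> AR 4 (AR 3 k + j * pg P) <= pw1 P.
Local Notation n := (pn P).
Local Notation w1 := (pw1 P).
Local Notation w2 := (pw2 P).
Local Notation g := (pg P).
Local Notation m := (pm P).
Local Notation H := (pH P).
Local Notation JG := (2 * pG P).+1.
Local Notation wp := (wp w b).
Local Notation ctx := (ctx P AR).

(** The triangle inequality through the nearest pivot, capped by the trivial bound, which also
    stands in where there is no useful pivot. *)
Definition est k j :=
  if AR 2 k < w1 then minn w1 (AR 2 k + AR 4 (AR 3 k + j * g)) else w1.

Lemma est_le k j : est k j <= w1.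
Proof. by rewrite /est; case: ifP => // _; exact: geq_minl. Qed.

Fixpoint rows k0 (M : nat -> nat) i : nat -> nat :=
  if i is i'.+1 then relax (2 * g) JG (fun j => rows k0 M i' j + est (k0 + i') j)
  else M.

Lemma rows_le k0 M i B : (forall j, j < JG -> M j <= B) -> forall j, j < JG ->
  rows k0 M i j <= B + i * w1.
Proof.
move=> hM; elim: i => [|i IH] j ltj; first by rewrite mul0n addn0 hM.
apply: leq_trans (relax_le _ _ ltj) _; rewrite [i.+1 * _]mulSnr addnA.
by rewrite leq_add ?IH ?est_le.
Qed.

Lemma Prow_spec st v i (M : nat -> nat) : ctx st -> v < pNV P -> i < m ->
  areg st 53 = v -> areg st 69 = i ->
  (forall j, j < JG -> aarr st 9 j = M j) -> (forall j, j < JG -> M j <= n) ->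
  wp Prow st (30 * JG) (fun st' => forall j, j < JG ->
    aarr st' 9 j = relax (2 * g) JG (fun j => M j + est (v * m + i) j) j).
Proof.
move=> cx ltv lti e53 e69 eM bM.
have [n0 w10 g0 m0 H0 w1H Gd Nle Hle w2le Qge XQ Xn XK XL Xlev Xm Xa] := wP.
have NKn : pNK P <= n by have := Nle; rewrite /pNK /pw2 mulnA; apply: leq_trans; rewrite leq_pmulr.
have ltk : v * m + i < pNK P by exact: vm_lt.
have bk := AR_best ltk.
have gG : pG P <= H by rewrite -Gd leq_pmulr.
have c2 := cstE cx.1.
set k := v * m + i in ltk bk *.
rewrite (_ : 30 * _ = (30 * JG - 2).+2); last by lia.
apply: wp_setq => //=; first by rewrite c2 e53 e69 -/k; safe_split; lia.
rewrite c2 e53 e69 -/k; set s1 := setr st 70 k.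
have cx1 : ctx s1 by exact: setr_ctx.
apply: (@wp_seq _ _ _ _ _ (3 + JG * 5) ((8 * JG).+4.+2)); last by lia.
apply: (@wp_for _ _ _ _ _ _ JG _ 2 (fun x s' => forall j, j < JG ->
   aarr s' 9 j = if j < x then M j + est k j else M j)) => //.
- by rewrite /= c2.
- by lia.
- move=> x s2 ltx e71 F2 inv; have [fr2 fa2 _ _] := F2.
  have cx2 := frame_ctx F2 isT isT cx1; have c3 := cstE cx2.1.
  have e70 : areg s2 70 = k by rewrite fr2.
  have v9 : aarr s2 9 x = M x by rewrite inv // ltnn.
  have v2 : aarr s2 2 k = AR 2 k by rewrite cx2.2.
  have v3 : aarr s2 3 k = AR 3 k by rewrite cx2.2.
  have v4 y : aarr s2 4 y = AR 4 y by rewrite cx2.2.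
  have bx := bM x ltx.
  have xg : x * g <= 2 * H by rewrite -Gd mulnA leq_mul2r; lia.
  have fin V : V = M x + est k x -> forall j, j < JG ->
      (if j == x then V else aarr s2 9 j) = if j < x.+1 then M j + est k j else M j.
    move=> -> j ltj; case: eqP => [->|ne]; first by rewrite ltnSn.
    by rewrite inv // (_ : (j < x.+1) = (j < x)) //; lia.
  apply: (@wp_if _ _ _ _ _ _ _ 1); rewrite /= ?e70 ?c3 ?e71 ?v2.
  + by safe_split; lia.
  + by [].
  + move=> hn; have hb : AR 2 k < w1 by lia.
    have [b3 b4] := AR_tab ltk hb; have {}b4 := b4 x ltac:(lia).
    apply: wp_sto; rewrite /= ?e70 ?c3 ?e71 ?v2 ?v3 ?v4 ?v9; safe_split; try lia.
    by apply: fin; rewrite /est hb minnE.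
  + move=> hn; have hb : (AR 2 k < w1) = false by lia.
    apply: wp_sto; rewrite /= ?e70 ?c3 ?e71 ?v2 ?v3 ?v4 ?v9; safe_split; try lia.
    by apply: fin; rewrite /est hb.
- move=> s2 _ F2 inv; have cx2 := frame_ctx F2 isT isT cx1; have c3 := cstE cx2.1.
  do 3 (apply: wp_setq; rewrite /=; first by rewrite ?c3; safe_split; lia).
  rewrite /= !c3; set s3 := setr _ 46 _.
  apply: (wp_conseq (@Prelax_spec w b 9 s3 0 JG (2 * g) (pX P) (fun j => M j + est k j)
    _ _ _ _ _ _ _ _ _)) => //; try lia.
  + by move=> j ltj; rewrite /= add0n inv // ltj.
  + move=> j ltj; have := bM j ltj; have := est_le k j.
    have : g <= H by rewrite -Gd leq_pmull // lt0n; apply: contraTneq H0 => G0; rewrite -Gd G0.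
    by lia.
  + by move=> s4 _ [h _] j ltj; rewrite -[j in LHS]add0n h.
Qed.

Definition good_boxes v C := [/\ sound P AR v C, forall e, C e <= w2 &
  forall l, l < plev P -> processed P AR v (g * 2 ^ l) C].

Definition Twin := 100 * JG + plev P * (Tlevel P + 6) + m * (30 * JG + 3) + 30.

Lemma Pwin_spec st v (M : nat -> nat) : ctx st -> v < pNV P ->
  areg st 53 = v -> (forall e, aarr st 8 e <= w2) ->
  (forall j, j < JG -> aarr st 9 j = M j) -> (forall j, j < JG -> M j <= v * w2) ->
  wp Pwin st Twin (fun st' => (forall e, aarr st' 8 e <= w2) /\ exists2 C, good_boxes v C &
    forall j, j < JG -> aarr st' 9 j =
      relax (2 * g) JG (fun j => minn (rows (v * m) M m j) (M j + C (j * g))) j).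
Proof.
move=> cx ltv e53 C0 eM bM.
have [n0 w10 g0 m0 H0 w1H Gd Nle Hle w2le Qge XQ Xn XK XL Xlev Xm Xa] := wP.
have gG : pG P <= H by rewrite -Gd leq_pmulr.
have G0 : 0 < pG P by rewrite lt0n; apply: contraTneq H0 => G0; rewrite -Gd G0.
have vn : v * w2 + w2 <= n by apply: leq_trans Nle; rewrite addnC -mulSn leq_mul2r ltv orbT.
have jg j : j < JG -> j * g <= 2 * H by move=> ltj; rewrite -Gd mulnA leq_mul2r; lia.
have mX : m <= n by apply: leq_trans (leq_trans _ vn); rewrite /pw2; [|exact: leq_addl]; rewrite leq_pmulr.
have c2 := cstE cx.1.
have [TV eTV] : exists TV, TV = plev P * (Tlevel P + 6) by eexists.
have [TR eTR] : exists TR, TR = m * (30 * JG + 3) by eexists.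
rewrite /Twin -eTV -eTR.
apply: (@wp_seq _ _ _ _ _ (3 + JG * 6) (94 * JG + TV + TR + 26)); last by lia.
apply: (@wp_for _ _ _ _ _ _ JG _ 3 (fun x s' =>
   [/\ forall e, aarr s' 8 e <= w2, forall j, j < x -> aarr s' 8 (j * g) = w2 &
     forall j, j < x -> aarr s' 10 j = M j])) => //.
- by rewrite /= c2.
- by lia.
- move=> x s2 ltx e54 F2 [i1 i2 i3]; have [fr2 fa2 _ _] := F2.
  have cx2 := frame_ctx F2 isT isT cx; have c3 := cstE cx2.1.
  have v9 : aarr s2 9 x = M x by rewrite fa2 // eM.
  have xg := jg x ltx.
  apply: (@wp_seq _ _ _ _ _ 1 1); last by [].
  apply: wp_sto; rewrite /= ?c3 ?e54; safe_split; try lia.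
  apply: wp_sto; rewrite /= ?c3 ?e54 ?v9; safe_split; try lia.
  + by move=> e; case: eqP => // _; exact: leqnn.
  + move=> j ltj; case: eqP => // ne; apply: i2.
    by case: (j =P x) => [ej|?]; [case: ne; rewrite ej | lia].
  + by move=> j ltj; case: eqP => [->|ne] //; apply: i3; lia.
- move=> s1 _ F1 [i1 i2 i3].
  have cx1 := frame_ctx F1 isT isT cx; have [fr1 fa1 _ _] := F1.
  have e53' : areg s1 53 = v by rewrite fr1.
  apply: (@wp_seq _ _ _ _ _ (5 + TV) (94 * JG + TR + 20)); last by lia.
  rewrite eTV; apply: (wp_conseq (Plevels_spec wP wX AR_rand AR_best cx1 ltv e53' i1)) => //.
  move=> s2 F2 [low pr].
  have cx2 := frame_ctx F2 isT isT cx1; have [fr2 fa2 _ _] := F2; have c3 := cstE cx2.1.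
  (* The initial entries [w2] are sound, as equally long windows differ by at most their length. *)
  have gb : good_boxes v (aarr s2 8).
    split=> //; last by move=> e; apply: leq_trans (low.1 e) (i1 e).
    apply: low.2 => j lej; rewrite i2 //; exact: wdist_size.
  apply: (@wp_seq _ _ _ _ _ (3 + TR) (94 * JG + 16)); last by lia.
  apply: (@wp_for _ _ _ _ _ _ m _ (30 * JG) (fun i s' =>
     forall j, j < JG -> aarr s' 9 j = rows (v * m) M i j)) => //.
  + by rewrite c3.
  + by lia.
  + by move=> j ltj; rewrite /= fa2 // fa1 // eM.
  + move=> i s3 lti e69 F3 inv; have [fr3 fa3 _ _] := F3.
    have cx3 := frame_ctx F3 isT isT cx2.
    have f53 : areg s3 53 = v by rewrite fr3 //= fr2.
    apply: (wp_conseq (Prow_spec (M := rows (v * m) M i) cx3 ltv lti f53 e69 inv _)) => //.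
    move=> j ltj; apply: leq_trans (rows_le (v * m) i bM ltj) _.
    have : i * w1 <= w2 by rewrite /pw2 leq_mul2r ltnW ?orbT.
    by lia.
  + move=> s3 _ F3 inv; have [fr3 fa3 _ _] := F3.
    have cx3 := frame_ctx F3 isT isT cx2; have c4 := cstE cx3.1.
    have v10 j : j < JG -> aarr s3 10 j = M j by move=> ltj; rewrite fa3 // fa2 // i3.
    have e8 : aarr s3 8 = aarr s2 8 by rewrite fa3.
    apply: (@wp_seq _ _ _ _ _ (3 + JG * 4) (90 * JG + 6).+4.+2); last by lia.
    apply: (@wp_for _ _ _ _ _ _ JG _ 1 (fun x s' =>
       forall j, j < JG -> aarr s' 9 j =
         if j < x then minn (rows (v * m) M m j) (M j + aarr s2 8 (j * g))
         else rows (v * m) M m j)) => //.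
    * by rewrite c4.
    * by lia.
    * move=> x s4 ltx e71 F4 inv4; have [fr4 fa4 _ _] := F4.
      have cx4 := frame_ctx F4 isT isT cx3; have c5 := cstE cx4.1.
      have u8 : aarr s4 8 (x * g) = aarr s2 8 (x * g) by rewrite fa4 // e8.
      have u9 : aarr s4 9 x = rows (v * m) M m x by rewrite inv4 // ltnn.
      have u10 : aarr s4 10 x = M x by rewrite fa4 // v10.
      have [_ /(_ (x * g)) b8 _] := gb; have b10 := bM x ltx; have xg := jg x ltx.
      have := rows_le (v * m) m bM ltx; rewrite -/(pw2 P) => b9.
      apply: wp_sto; rewrite /= ?c5 ?e71 ?u8 ?u9 ?u10; safe_split; try lia.
      move=> j ltj; case: eqP => [->|ne]; first by rewrite ltnSn minnE.
      by rewrite inv4 // (_ : (j < x.+1) = (j < x)) //; lia.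
    * move=> s4 _ F4 inv4; have [fr4 fa4 _ _] := F4.
      have cx4 := frame_ctx F4 isT isT cx3; have c5 := cstE cx4.1.
      have gH : g <= H by rewrite -Gd leq_pmull.
      do 3 (apply: wp_setq; rewrite /=; first by rewrite ?c5; safe_split; lia).
      rewrite /= !c5; set s5 := setr _ 46 _.
      apply: (wp_conseq (@Prelax_spec w b 9 s5 0 JG (2 * g) (pX P)
        (fun j => minn (rows (v * m) M m j) (M j + aarr s2 8 (j * g)))
        _ _ _ _ _ _ _ _ _)) => //; try lia.
      -- by move=> j ltj; rewrite /= add0n inv4 // ltj.
      -- move=> j ltj; have := rows_le (v * m) m bM ltj; rewrite -/(pw2 P).
         by have := geq_minl (rows (v * m) M m j) (M j + aarr s2 8 (j * g)); lia.
      -- move=> s6 F6 [h _]; have [_ fa6 _ _] := F6; split.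
           by move=> e; rewrite fa6 //= fa4 // e8; case: gb.
         by exists (aarr s2 8) => // j ltj; rewrite -[j in LHS]add0n h.
  + by rewrite eTR; lia.
Qed.

End Rows.

(** * Initialization *)

(** Doubling with [n] rounds instead of a test for termination: [n] is at hand as a loop bound, and
    linear time is affordable. *)
Definition Plog src : prog :=
  44 ::= $src;;
  43 ::= #0;;
  40 ::= #1;;
  PFor 41 0 (PIf (#2 * $40 < $44 + #1) (40 ::= #2 * $40;; 43 ::= $43 + #1) Pskip).

Definition Ppow (e : aexp) : prog :=
  42 ::= e;;
  43 ::= #1;;
  PFor 41 42 (43 ::= #2 * $43).

Definition Prandom : prog :=
  PFor 50 15 (
    51 ::= #0;;
    PFor 52 12 (PFlip 54;; 51 ::= #2 * $51 + $54);;
    PSto 1 $50 $51).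

Definition Pcopy : prog := PFor 50 2 (PSto 0 ($10 + $50) (AIn $50)).

(** Known registers as an association list, latest value first, so that initialization needs no
    separate fact per register and step. *)
Fixpoint look (l : seq (nat * nat)) i :=
  if l is (j, v) :: l' then if i == j then Some v else look l' i else None.

Definition has_regs s l := forall i v, look l i = Some v -> areg s i = v.

Lemma has_setr s l i v : has_regs s l -> has_regs (setr s i v) ((i, v) :: l).
Proof. by move=> h j u /=; case: eqP => [_ [->]|_ /h]. Qed.

Section Init.
Variables (w b X : nat).
Hypothesis wX : b + 16 * X + 32 < 2 ^ w.
Local Notation wp := (wp w b).

Lemma Plog_spec src s n N l : has_regs s l -> all (fun x => x.1 < 40) l ->
  areg s 0 = n -> areg s src = N -> 0 < N <= n -> 10 * n <= X ->
  wp (Plog src) s (20 + 10 * n) (fun s' => has_regs s' ((43, trunc_log 2 N) :: l)).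
Proof.
move=> hs al en eN Nn nX.
rewrite (_ : 20 + _ = (14 + 10 * n).+4.+2); last by lia.
apply: wp_setq; first by []. rewrite /= eN.
apply: wp_setq; first by rewrite /=; lia.
apply: wp_setq; first by rewrite /=; lia.
rewrite /=; set s1 := setr _ 40 _.
have N2 : N < 2 ^ n by apply: leq_ltn_trans (ltn_expl n (ltnSn 1)); lia.
apply: (@wp_for _ _ _ _ _ _ n _ 5 (fun k s' => exists2 a, [/\ areg s' 43 = a, areg s' 40 = 2 ^ a & 2 ^ a <= N] &
   (a <= k /\ (a = k \/ N < 2 ^ a.+1)))); [by [] | by rewrite /= | by lia | | | | by lia].
- by exists 0; [split=> //; lia | split=> //; left].
- move=> k s' ltk e41' F [a [ea e40' leN] [lea h]]; have [fr _ _ _] := F.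
  have esrc : areg s' 44 = N by rewrite fr.
  have eS : 2 ^ a.+1 = 2 * 2 ^ a by rewrite expnS.
  apply: (@wp_if _ _ _ _ _ _ _ 3); rewrite /= ?e40' ?esrc.
  + by safe_split; lia.
  + by [].
  + move=> hn; have {}hn : 2 * 2 ^ a <= N by lia.
    have lt2a : a < 2 ^ a by exact: ltn_expl.
    apply: (@wp_setq _ _ _ _ _ _ 1); rewrite /= e40'; first by safe_split; lia.
    apply: wp_set => //; rewrite /= ea; first by safe_split; lia.
    by exists a.+1; [split=> //=; lia | split; [lia | case: h; lia]].
  + move=> hn; have {}hn : N < 2 * 2 ^ a by lia.
    apply: wp_set => //; rewrite /=; first by lia.
    by exists a => //; split; [lia | right; lia].
- move=> s2 _ F [a [ea _ leN] [lea h]]; have [fr _ _ _] := F.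
  have ltN : N < 2 ^ a.+1 by case: h => [ea'|//]; move: leN; rewrite ea'; lia.
  have -> : trunc_log 2 N = a by apply/trunc_log_eq => //; rewrite leN.
  move=> i v /=; case: eqP => [->|_ lk]; first by rewrite ea => -[].
  have lti : i < 40.
    elim: (l) al lk => // -[j u] l' IH /= /andP[h1 h2]; case: eqP => [->//|_]; exact: IH.
  by rewrite fr /= ?inE; [do ![rewrite ifF; last lia]; exact: hs | lia].
Qed.

Lemma Ppow_spec e s x l : has_regs s l -> all (fun x => x.1 < 40) l ->
  wfe e -> asafe w b s e -> aeval s e = x -> 2 ^ x.+1 <= X ->
  wp (Ppow e) s (20 + 4 * x) (fun s' => has_regs s' ((43, 2 ^ x) :: l)).
Proof.
move=> hs al wfl se ev bx.
have ltx : x < 2 ^ x by exact: ltn_expl.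
have eS k : 2 ^ k.+1 = 2 * 2 ^ k by rewrite expnS.
rewrite (_ : 20 + _ = (16 + 4 * x).+4); last by lia.
apply: wp_setq => //; rewrite ev.
apply: wp_setq; first by rewrite /=; lia.
rewrite /=; set s1 := setr _ 43 _.
apply: (@wp_for _ _ _ _ _ _ x _ 1 (fun k s' => areg s' 43 = 2 ^ k)); [by [] | by rewrite /= | by have := eS x; lia | by [] | | | by lia].
- move=> k s' ltk _ F ea; have := eS k; have : 2 ^ k <= 2 ^ x by rewrite leq_exp2l // ltnW.
  by move=> h1 h2; have h3 := eS x; apply: wp_set => //; rewrite /= ea; [safe_split; lia | lia].
- move=> s2 _ F ea; have [fr _ _ _] := F.
  move=> i v /=; case: eqP => [->|_ lk]; first by rewrite ea => -[].
  have lti : i < 40.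
    elim: (l) al lk => // -[j u] l' IH /= /andP[h1 h2]; case: eqP => [->//|_]; exact: IH.
  by rewrite fr /= ?inE; [do ![rewrite ifF; last lia]; exact: hs | lia].
Qed.

Lemma has_set43 s dst v x l : has_regs s ((43, x) :: l) -> all (fun y => y.1 < 40) l ->
  dst < 40 -> v = x -> has_regs (setr s dst v) ((dst, x) :: l).
Proof.
move=> h al ld ->; apply: has_setr => i v' lk; apply: h => /=; rewrite ifF //.
apply/eqP => e; subst i; elim: l al lk => //= -[j u] l IH /andP[/= h1 h2].
by case: eqP => [e|_]; [lia | exact: IH].
Qed.

Lemma Plog_set src dst rest s l n N T (Q : astate -> Prop) : has_regs s l ->
  all (fun x => x.1 < 40) l -> areg s 0 = n -> areg s src = N -> 0 < N <= n -> 10 * n <= X ->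
  dst < 40 ->
  (forall s', has_regs s' ((dst, trunc_log 2 N) :: l) -> wp rest s' T Q) ->
  wp (Plog src;; dst ::= $43;; rest) s (T + 23 + 10 * n) Q.
Proof.
move=> hs al en eN Nn nX ld k; apply: (@wp_seq _ _ _ _ _ (20 + 10 * n) T.+2); last by lia.
apply: (wp_conseq (Plog_spec hs al en eN Nn nX)) => // s' _ h.
apply: wp_setq => //; apply: k; apply: has_set43 => //.
exact: (h 43 _ erefl).
Qed.

Lemma Ppow_set e dst rest s l x T (Q : astate -> Prop) : has_regs s l ->
  all (fun x => x.1 < 40) l -> wfe e -> asafe w b s e -> aeval s e = x -> 2 ^ x.+1 <= X ->
  dst < 40 ->
  (forall s', has_regs s' ((dst, 2 ^ x) :: l) -> wp rest s' T Q) ->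
  wp (Ppow e;; dst ::= $43;; rest) s (T + 23 + 4 * x) Q.
Proof.
move=> hs al wfl se ev bx ld k; apply: (@wp_seq _ _ _ _ _ (20 + 4 * x) T.+2); last by lia.
apply: (wp_conseq (Ppow_spec hs al wfl se ev bx)) => // s' _ h.
apply: wp_setq => //; apply: k; apply: has_set43 => //.
exact: (h 43 _ erefl).
Qed.

End Init.

(* Up to constants w1 = (n^3 / tau^2)^(1/7) and w2 = (n^2 tau)^(1/7), which
   balances the costs of phase 1, of phase 2 and of the grid at
   (n^8 tau^4)^(1/7). *)
Definition mkparams n tau :=
  let a := trunc_log 2 n in
  let b := trunc_log 2 tau in
  let w1 := 2 ^ ((3 * a - 2 * b) %/ 7 + 9) in
  let g := 2 ^ ((3 * a - 2 * b) %/ 7 + 1 - (a - b)) in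
  let w2 := 2 ^ ((2 * a + b) %/ 7 + 9) in
  let H := 2 ^ (b + 3) in
  let L := 60 * (a + 1) in
  Params n tau a b w1 g (w2 %/ w1) H (2 ^ (a + 3) %/ w2 * L) L (n %/ w2) (8 + a - b)
    (H %/ g) (2 ^ (4 * a)).

(** * Inequalities between the parameters *)

Definition regime n tau := [/\ 0 < tau, 840 * tau < n & n ^ 4 <= tau.+1 ^ 5].

(** All parameters are powers of two or quotients of them, apart from logarithmic counts and the
    number of windows, so estimates become linear inequalities between [a] and [b]. The last two
    force [b] to be at least 31, which absorbs the additive constants in the exponents. *)
Lemma regime_logs n tau (a := trunc_log 2 n) (b := trunc_log 2 tau) : regime n tau ->
  [/\ 2 ^ a <= n < 2 ^ a.+1, 2 ^ b <= tau < 2 ^ b.+1, b + 9 <= a & 4 * a <= 5 * b + 5].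
Proof.
move=> [t0 tn nt].
have ha : 2 ^ a <= n < 2 ^ a.+1 by apply: trunc_log_bounds; lia.
have hb : 2 ^ b <= tau < 2 ^ b.+1 by apply: trunc_log_bounds; lia.
split=> //.
  (* 840 exceeds 512 = 2 ^ 9. *)
  have : 2 ^ (b + 9) < 2 ^ a.+1 by rewrite expnD; move: ha hb; rewrite -[2 ^ 9]/512; lia.
  by rewrite ltn_exp2l //; lia.
have : 2 ^ (4 * a) <= 2 ^ (5 * b + 5).
  rewrite [4 * a]mulnC (_ : 5 * b + 5 = b.+1 * 5) ?expnM; last by lia.
  apply: leq_trans (leq_trans _ nt) _; first by rewrite leq_exp2r //; case/andP: ha.
  by rewrite leq_exp2r //; case/andP: hb.
by rewrite leq_exp2l.
Qed.

(** [w1] divides [w2] because 3 a - 2 b is at most 2 a + b in this regime. *)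
Lemma mkparams_w2 n tau : regime n tau ->
  pw2 (mkparams n tau) = 2 ^ ((2 * trunc_log 2 n + trunc_log 2 tau) %/ 7 + 9).
Proof.
by move=> /regime_logs[_ _ h1 h2]; rewrite /pw2 /= divnK // dvdn_exp2l //; lia.
Qed.

Lemma mkparams_wf n tau : regime n tau -> wfp (mkparams n tau).
Proof.
move=> rg; have ew2 := mkparams_w2 rg.
have [/andP[a1 a2] /andP[b1 b2] h1 h2] := regime_logs rg.
move: ew2 a1 a2 b1 b2 h1 h2; set a := trunc_log 2 n; set b := trunc_log 2 tau.
move=> ew2 a1 a2 b1 b2 h1 h2.
have eS k : 2 ^ k.+1 = 2 * 2 ^ k by rewrite expnS.
have pw x y : x <= y -> 2 ^ x <= 2 ^ y by move=> h; rewrite leq_exp2l.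
have n0 : 0 < n by apply: leq_trans a1; rewrite expn_gt0.
have lta : a + 1 <= 2 ^ a by rewrite addn1; exact: ltn_expl.
have e7 : 2 ^ 7 = 128 by [].
set q1 := (3 * a - 2 * b) %/ 7; set q2 := (2 * a + b) %/ 7.
have q1b : 7 * q1 <= 3 * a - 2 * b < 7 * q1 + 7.
  by rewrite /q1 {2 3}(divn_eq (3 * a - 2 * b) 7); have := ltn_pmod (3 * a - 2 * b) (isT : 0 < 7); lia.
have q2b : 7 * q2 <= 2 * a + b < 7 * q2 + 7.
  by rewrite /q2 {2 3}(divn_eq (2 * a + b) 7); have := ltn_pmod (2 * a + b) (isT : 0 < 7); lia.
have mg : (2 ^ (q2 + 9) %/ 2 ^ (q1 + 9)) * 2 ^ (q1 + 9) = 2 ^ (q2 + 9).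
  by rewrite divnK // dvdn_exp2l //; lia.
have K : 2 ^ (a + 3) %/ 2 ^ (q2 + 9) * (60 * (a + 1)) <= 2 ^ (a + 3 + 6 + a).
  rewrite (expnD 2 (a + 3 + 6)) (expnD 2 (a + 3)) -mulnA.
  by apply: leq_mul; [exact: leq_div | apply: leq_mul].
have X4 y : y <= 4 * a -> 2 ^ y <= 2 ^ (4 * a) by exact: pw.
have w1X := X4 (q1 + 9 + 7) ltac:(lia); have w2X := X4 (q2 + 9 + 7) ltac:(lia).
have aX := X4 (a + 10) ltac:(lia); have KX := X4 (b + 6 + (a + 3 + 6 + a) + 1) ltac:(lia).
rewrite !(expnD _ _ 7) in w1X w2X; rewrite e7 in w1X w2X.
have e10 : 2 ^ 10 = 1024 by []. rewrite expnD e10 in aX.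
have eb3 : 2 ^ (b + 3) = 8 * 2 ^ b by rewrite expnD mulnC.
have ea3 : 2 ^ (a + 3) = 8 * 2 ^ a by rewrite expnD mulnC.
have ab : 512 * 2 ^ b <= 2 ^ a by apply: leq_trans (pw _ _ h1); rewrite expnD mulnC.
have w2n : 128 * 2 ^ (q2 + 9) <= 2 ^ a by rewrite -e7 mulnC -expnD pw //; lia.
have a100 : 128 <= 2 ^ a by rewrite -e7 pw //; lia.
have KX' : 8 * 2 ^ (b + 3) * (2 ^ (a + 3) %/ 2 ^ (q2 + 9) * (60 * (a + 1))).+1 <= 2 ^ (4 * a).
  apply: leq_trans KX; rewrite -[b + 6 + _ + 1]addnA (expnD 2 (b + 6)).
  have -> : 8 * 2 ^ (b + 3) = 2 ^ (b + 6) by rewrite (expnD 2 b 6) eb3 -[2 ^ 6]/64; lia.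
  rewrite leq_mul2l; apply/orP; right; rewrite (addn1 (a + 3 + 6 + a)) eS.
  have p0 : 0 < 2 ^ (a + 3 + 6 + a) by rewrite expn_gt0.
  by lia.
have b0 : 0 < 2 ^ b by rewrite expn_gt0.
split; rewrite ?ew2; rewrite /= -/a -/b -/q1 -/q2 ?expn_gt0 //.
- by rewrite divn_gt0 ?expn_gt0 // pw //; lia.
- by rewrite pw //; lia.
- by rewrite divnK // dvdn_exp2l //; lia.
- exact: leq_divM.
- by rewrite eb3; lia.
- by lia.
- by rewrite /pQ /= -/a ea3 eb3; move: a2; rewrite eS; lia.
- by rewrite /pQ /= -/a ea3; lia.
- by move: a2; rewrite eS; lia.
- have : 1 * 1 <= 8 * 2 ^ (b + 3) by rewrite leq_mul // expn_gt0.
  move: KX'; set KK := _ %/ _ * _; set HH := 8 * _ => KX' h.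
  have : KK.+1 <= HH * KK.+1 by rewrite leq_pmull.
  have : 60 * (a + 1) <= 60 * 2 ^ a by rewrite leq_mul2l lta orbT.
  have : 2 * KK <= 2 ^ (4 * a).
    apply: leq_trans KX'; apply: leq_mul; last by [].
    by rewrite /HH -(mul1n 2) [1 * 2]mulnC leq_mul // expn_gt0.
  by lia.
- rewrite -expnD; apply: leq_trans (_ : 2 ^ 6 * 2 ^ (q1 + 9) <= _).
    by apply: leq_mul => //; rewrite pw //; lia.
  by rewrite -[2 ^ 6]/64; lia.
- by rewrite [2 ^ _ * _]mulnC mg; lia.
- by lia.
Qed.

Definition Pinit_tail : prog :=
  9 ::= $7 %/ $5;;
  10 ::= #8 * $8;;
  11 ::= #8 * $8 + $0;;
  12 ::= $3 + #3;;
  14 ::= #60 * ($3 + #1);;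
  13 ::= $13 %/ $7 * $14;;
  15 ::= $13 + $14;;
  17 ::= $0 %/ $7;;
  16 ::= $17 * $9;;
  18 ::= #4 * $8;;
  19 ::= #8 * $8;;
  20 ::= #8 + $3 - $4;;
  22 ::= #2 * ($8 %/ $6);;
  21 ::= $22 + #1;;
  23 ::= #2 * $6.

Definition Pinit_regs n tau a b w1 g w2 H m K NV G : seq nat :=
  [:: n; tau; 2 * n; a; b; w1; g; w2; H; m; 8 * H; 8 * H + n; a + 3;
      K * (60 * (a + 1)); 60 * (a + 1); K * (60 * (a + 1)) + 60 * (a + 1);
      NV * m; NV; 4 * H; 8 * H; 8 + a - b; (2 * G).+1; 2 * G; 2 * g].

Lemma Pinit_tail_spec w base X s n tau a b w1 g w2 H A m K NV G :
  w2 %/ w1 = m -> A %/ w2 = K -> n %/ w2 = NV -> H %/ g = G ->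
  base + 16 * X + 32 < 2 ^ w -> 512 <= X -> 100 * n <= X -> 20 * H <= X -> 100 * (a + 1) <= X ->
  g <= H -> m <= n -> NV <= n -> G <= H -> K <= X -> 2 * (K * (60 * (a + 1))) <= X -> NV * m <= n ->
  b <= a ->
  has_regs s ([:: (13, A); (8, H); (7, w2); (6, g); (5, w1); (4, b); (3, a)] ++
    [seq (i, 0) | i <- iota 24 16] ++ [:: (0, n); (1, tau); (2, 2 * n)]) ->
  wp w base Pinit_tail s 30 (fun s' => forall i, i < 40 ->
    areg s' i = nth 0 (Pinit_regs n tau a b w1 g w2 H m K NV G) i).
Proof.
move=> em eK eNV eG wX X1 nX HX aX gH mn NVn GH KX KX2 NKn ba hs.
have e3 := hs 3 _ erefl; have e4 := hs 4 _ erefl; have e5 := hs 5 _ erefl.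
have e6 := hs 6 _ erefl; have e7 := hs 7 _ erefl; have e8 := hs 8 _ erefl.
have e13 := hs 13 _ erefl; have e0 := hs 0 _ erefl; have e1 := hs 1 _ erefl; have e2 := hs 2 _ erefl.
have ez i : 23 < i < 40 -> areg s i = 0.
  move=> hi; apply: hs; move: hi.
  by do 40 (case: i => [|i]; first by []); lia.
clear hs.
do 14 (apply: wp_setq; [rewrite /= ?e3 ?e4 ?e5 ?e6 ?e7 ?e8 ?e13 ?e0 ?em ?eK ?eNV ?eG;
    clear em eK eNV eG ez; by safe_split; lia |
  rewrite [aeval _ _]/= ?e3 ?e4 ?e5 ?e6 ?e7 ?e8 ?e13 ?e0 ?em ?eK ?eNV ?eG]).
apply: wp_set; rewrite /= ?e6; [clear em eK eNV eG; by safe_split; lia | by [] |].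
move=> i lti; rewrite /=.
have [ge|lt] := leqP 24 i; last first.
  by move: lt; do 24 (case: i lti => [|i] lti; first by rewrite /= ?e0 ?e1 ?e2 ?e3 ?e4 ?e5 ?e6 ?e7 ?e8 ?addn1); lia.
by do ![rewrite ifF; last lia]; rewrite ez ?ge // nth_default.
Qed.

Definition Pinit : prog :=
  Plog 0;; 3 ::= $43;;
  Plog 1;; 4 ::= $43;;
  Ppow ((#3 * $3 - #2 * $4) %/ #7 + #9);; 5 ::= $43;;
  Ppow ((#3 * $3 - #2 * $4) %/ #7 + #1 - ($3 - $4));; 6 ::= $43;;
  Ppow ((#2 * $3 + $4) %/ #7 + #9);; 7 ::= $43;;
  Ppow ($4 + #3);; 8 ::= $43;;
  Ppow ($3 + #3);; 13 ::= $43;;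
  Pinit_tail.

Section Init2.
Variables (w n tau : nat).
Hypothesis rg : regime n tau.
Local Notation P := (mkparams n tau).
Local Notation b := (2 * n).
Hypothesis wX : b + 16 * pX P + 32 < 2 ^ w.
Local Notation wp := (wp w b).

Lemma Pinit_spec s : areg s 0 = n -> areg s 1 = tau -> areg s 2 = 2 * n ->
  (forall i, 23 < i < 40 -> areg s i = 0) ->
  wp Pinit s (200 * n) (fun s' => cst P s').
Proof.
move=> r0 r1 r2 r3.
have [/andP[a1 a2] /andP[b1 b2] h1 h2] := regime_logs rg.
have ew2 := mkparams_w2 rg.
have [n0 w10 g0 m0 H0 w1H Gd Nle Hle w2le Qge XQ Xn XK XL Xlev Xm Xa] := mkparams_wf rg.
have [t0 tn nt] := rg.
set a := trunc_log 2 n in a1 a2 h1 h2 ew2.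
set bb := trunc_log 2 tau in b1 b2 h1 h2 ew2.
pose X := pX P.
have XE : X = 2 ^ (4 * a) by [].
have nX10 : 10 * n <= pX P.
  by apply: leq_trans Xn; rewrite leq_mul2r orbT.
have wX' : 2 * n + 16 * X + 32 < 2 ^ w by exact: wX.
have X4 y : y <= 4 * a -> 2 ^ y <= X by move=> h; rewrite XE leq_exp2l.
have aX : 4 * a < X by rewrite XE; exact: ltn_expl.
have an : a < n by apply: leq_trans a1; exact: ltn_expl.
pose l0 := [seq (i, 0) | i <- iota 24 16] ++ [:: (0, n); (1, tau); (2, 2 * n)].
have hs0 : has_regs s l0.
  move=> i v; rewrite /l0 /=.
  do 16 (case: eqP => [-> [<-]|_]; first by rewrite r3).
  by do 3 (case: eqP => [-> [<-] //|_]).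
set q1 := (3 * a - 2 * bb) %/ 7; set q2 := (2 * a + bb) %/ 7.
have q1b : 7 * q1 <= 3 * a - 2 * bb < 7 * q1 + 7.
  by rewrite /q1 {2 3}(divn_eq (3 * a - 2 * bb) 7); have := ltn_pmod (3 * a - 2 * bb) (isT : 0 < 7); lia.
have q2b : 7 * q2 <= 2 * a + bb < 7 * q2 + 7.
  by rewrite /q2 {2 3}(divn_eq (2 * a + bb) 7); have := ltn_pmod (2 * a + bb) (isT : 0 < 7); lia.
have nX : 100 * n <= X by exact: Xn.
have n00 : 0 < n by lia.
have HX : 8 * pH P <= n by exact: Hle.
have ew1 : 2 ^ (q1 + 9) = pw1 P by [].
have eg : 2 ^ (q1 + 1 - (a - bb)) = pg P by [].
have eH : 2 ^ (bb + 3) = pH P by [].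
have qX : 2 ^ (a + 3) <= X by apply: X4; lia.
have aXn : a + 1 <= X by lia.
have X20 : 512 <= X by apply: leq_trans (X4 9 _) => //; lia.
have K1X : 2 ^ (a + 3) %/ 2 ^ (q2 + 9) * (60 * (a + 1)) <= X by move: XL; rewrite /= -/a -/bb -/q2 -/X; lia.
have mX : 2 ^ (q2 + 9) %/ 2 ^ (q1 + 9) <= X by apply: leq_trans (leq_div _ _) _; apply: X4; lia.
eapply wp_conseq.
- apply: (Plog_set wX hs0 _ r0 r0 _ _ _) => [//|||//|s1 hs1]; [by rewrite n00 leqnn | exact: nX10 |].
  have e0 := hs1 0 _ erefl; have e1 := hs1 1 _ erefl.
  apply: (Plog_set wX hs1 _ e0 e1 _ _ _) => [//|||//|s2 hs2 {s1 hs1 e0 e1}]; [by rewrite t0; clear -tn; lia | exact: nX10 |].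
  rewrite -/a -/bb in hs2.
  have e3 := hs2 3 _ erefl; have e4 := hs2 4 _ erefl.
  have [v1 v2] : (3 * a - 2 * bb) %/ 7 = q1 /\ (2 * a + bb) %/ 7 = q2 by [].
  apply: (Ppow_set (x := q1 + 9) wX hs2) => [//|//|||||s3 hs3 {s2 hs2 e3 e4}];
    [by rewrite /= ?e3 ?e4 ?v1; safe_split;
      clear -aX wX' X20 nX n00 HX q1b q2b h1 b1 t0 tn; clearbody X q1 q2 a bb; lia
     | by rewrite /= e3 e4
     | by apply: X4;
       clear -aX wX' X20 nX n00 HX q1b q2b h1 b1 t0 tn; clearbody X q1 q2 a bb; lia
     | by [] |].
  have e3 := hs3 3 _ erefl; have e4 := hs3 4 _ erefl.
  apply: (Ppow_set (x := q1 + 1 - (a - bb)) wX hs3) => [//|//|||||s4 hs4 {s3 hs3 e3 e4}];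
    [by rewrite /= ?e3 ?e4 ?v1; safe_split;
      clear -aX wX' X20 nX n00 HX q1b q2b h1 b1 t0 tn; clearbody X q1 q2 a bb; lia
     | by rewrite /= e3 e4
     | by apply: X4;
       clear -aX wX' X20 nX n00 HX q1b q2b h1 b1 t0 tn; clearbody X q1 q2 a bb; lia
     | by [] |].
  have e3 := hs4 3 _ erefl; have e4 := hs4 4 _ erefl.
  apply: (Ppow_set (x := q2 + 9) wX hs4) => [//|//|||||s5 hs5 {s4 hs4 e3 e4}];
    [by rewrite /= ?e3 ?e4 ?v2; safe_split;
      clear -aX wX' X20 nX n00 HX q1b q2b h1 b1 t0 tn; clearbody X q1 q2 a bb; lia
     | by rewrite /= e3 e4
     | by apply: X4;
       clear -aX wX' X20 nX n00 HX q1b q2b h1 b1 t0 tn; clearbody X q1 q2 a bb; lia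
     | by [] |].
  have e4 := hs5 4 _ erefl.
  apply: (Ppow_set (x := bb + 3) wX hs5) => [//|//|||||s6 hs6 {s5 hs5 e4}];
    [by rewrite /= ?e4; safe_split;
      clear -aX wX' X20 nX n00 HX q1b q2b h1 b1 t0 tn; clearbody X q1 q2 a bb; lia
     | by rewrite /= e4
     | by apply: X4;
       clear -aX wX' X20 nX n00 HX q1b q2b h1 b1 t0 tn; clearbody X q1 q2 a bb; lia
     | by [] |].
  have e3 := hs6 3 _ erefl.
  apply: (Ppow_set (x := a + 3) wX hs6) => [//|//|||||s7 hs7 {s6 hs6 e3}];
    [by rewrite /= ?e3; safe_split;
      clear -aX wX' X20 nX n00 HX q1b q2b h1 b1 t0 tn; clearbody X q1 q2 a bb; lia
     | by rewrite /= e3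
     | by apply: X4;
       clear -aX wX' X20 nX n00 HX q1b q2b h1 b1 t0 tn; clearbody X q1 q2 a bb; lia
     | by [] |].
  have gH : pg P <= pH P by rewrite -Gd leq_pmull // lt0n; apply: contraTneq H0 => G0; rewrite -Gd G0.
  have GH : pG P <= pH P by rewrite -Gd leq_pmulr.
  have mn : pm P <= n by apply: leq_trans (leq_trans _ w2le); rewrite /pw2; [exact: leq_pmulr w10 | rewrite leq_pmull].
  have NVn : pNV P <= n by exact: leq_div.
  have NKn : pNV P * pm P <= n.
    by apply: leq_trans Nle; rewrite /pw2 mulnA leq_pmulr.
  have KX2 : 2 * (2 ^ (a + 3) %/ 2 ^ (q2 + 9) * (60 * (a + 1))) <= X.
    by apply: leq_trans XK; apply: leq_mul; [lia | exact: leqnSn].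
  have KX1 : 2 ^ (a + 3) %/ 2 ^ (q2 + 9) <= X by apply: leq_trans (leq_div _ _) _.
  have HX20 : 20 * pH P <= X by lia.
  have aX100 : 100 * (a + 1) <= X by lia.
  have ba : bb <= a by lia.
  exact: (Pinit_tail_spec (X := X) (m := pm P) (K := 2 ^ (a + 3) %/ 2 ^ (q2 + 9)) (NV := pNV P) (G := pG P)
    erefl erefl erefl erefl wX X20 nX HX20 aX100 gH mn NVn GH KX1 KX2 NKn ba hs7).
- by lia.
- move=> s' _ h i lti; rewrite h // /Pinit_regs /cenv ew2.
  by [].
Qed.

Lemma Prandom_spec s q K : areg s 15 = K -> areg s 12 = q -> 2 ^ q.+1 <= pX P -> K + 2 <= pX P ->
  wp Prandom s (5 + K * (10 + 6 * q)) (fun s' => forall u, u < K ->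
    aarr s' 1 u = foldl (fun r i => 2 * r + nth false (acoins s) (u * q + i)) 0 (iota 0 q)).
Proof.
move=> eK eq qX KX.
pose rnd c u k := foldl (fun r i => 2 * r + nth false c (u * q + i)) 0 (iota 0 k).
have qX' : q <= pX P by apply: leq_trans qX; apply: ltnW; apply: leq_trans (ltn_expl q (ltnSn 1)) _; rewrite leq_exp2l.
have rS c u k : rnd c u k.+1 = 2 * rnd c u k + nth false c (u * q + k).
  by rewrite /rnd -(addn1 k) iotaD foldl_cat.
have rnd_lt c u k : rnd c u k < 2 ^ k.
  by elim: k => // k IH; rewrite rS expnS; have := leq_b1 (nth false c (u * q + k)); lia.
have fl c : behead c = drop 1 c by case: c => [|? []].
have hd (c : seq bool) i : head false (drop i c) = nth false c i.
  by rewrite -nth0 nth_drop addn0.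
apply: (@wp_for _ _ _ _ _ _ K _ (7 + 6 * q) (fun u s' => acoins s' = drop (u * q) (acoins s) /\
  forall u', u' < u -> aarr s' 1 u' = rnd (acoins s) u' q)).
- by [].
- by [].
- by lia.
- by rewrite /= drop0.
- move=> u s1 ltu e50 F1 [ec inv]; have [fr1 fa1 _ _] := F1.
  have eq1 : areg s1 12 = q by rewrite fr1.
  apply: (@wp_setq _ _ _ _ _ _ (5 + 6 * q)); first by rewrite /=; lia.
  rewrite /=; set s2 := setr s1 51 0.
  apply: (@wp_seq _ _ _ _ _ (3 + q * 6) 1); last by lia.
  apply: (@wp_for _ _ _ _ _ _ q _ 3 (fun k s' => [/\ acoins s' = drop (u * q + k) (acoins s),
     areg s' 51 = rnd (acoins s) u k & forall x, aarr s' 1 x = aarr s1 1 x])).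
  + by [].
  + by rewrite /= eq1.
  + by lia.
  + by rewrite /= addn0 ec.
  + move=> k s3 ltk e52 F3 [ec3 e51 e1]; have [fr3 _ _ _] := F3.
    have kq : 2 ^ k.+1 <= 2 ^ q by rewrite leq_exp2l.
    have rk := rnd_lt (acoins s) u k.+1; rewrite rS in rk.
    have qS : 2 ^ q.+1 = 2 * 2 ^ q by rewrite expnS.
    apply: (@wp_seq _ _ _ _ _ 1 1); last by [].
    apply: wp_flip => //; apply: wp_set => //; rewrite /= e51 ec3 hd.
      by safe_split; lia.
    by split; rewrite ?rS // fl drop_drop; congr (drop _ _); lia.
  + move=> s3 _ F3 [ec3 e51 e1]; have [fr3 _ _ _] := F3.
    have e50' : areg s3 50 = u by rewrite fr3.
    apply: wp_sto; rewrite /= ?e50' //; first by lia.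
    split=> [|u' ltu']; first by rewrite ec3 mulSn addnC.
    by case: eqP => [->|ne]; rewrite ?e51 // e1 inv //; lia.
  + by lia.
- by move=> s1 _ _ [_ inv].
- by lia.
Qed.

Lemma Pcopy_spec s : cst P s -> wp Pcopy s (5 + 8 * n) (fun s' =>
  (forall i, i < 2 * n -> aarr s' 0 (pX0 P + i) = ainp s i) /\
  (forall x, x < pX0 P \/ pX0 P + 2 * n <= x -> aarr s' 0 x = aarr s 0 x)).
Proof.
move=> cs; have c := cstE cs.
have [n0 w10 g0 m0 H0 w1H Gd Nle Hle w2le Qge XQ Xn XK XL Xlev Xm Xa] := mkparams_wf rg.
apply: (@wp_for _ _ _ _ _ _ (2 * n) _ 1 (fun k s' =>
  (forall i, i < k -> aarr s' 0 (pX0 P + i) = ainp s i) /\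
  (forall x, x < pX0 P \/ pX0 P + 2 * n <= x -> aarr s' 0 x = aarr s 0 x))).
- by [].
- by rewrite c.
- have : 100 * n <= pX P by exact: Xn.
  by lia.
- by [].
- move=> k s1 ltk e50 F1 [i1 i2]; have [fr1 _ ei _] := F1.
  have c1 := cstE (frame_cst F1 isT cs).
  have x0n : pX0 P <= n by exact: Hle.
  have nX : 100 * n <= pX P by exact: Xn.
  apply: wp_sto; rewrite /= ?c1 ?e50; safe_split; try lia.
  + move=> i lti; case: eqP => [/addnI ->|ne]; first by rewrite ei.
    by apply: i1; case: (i =P k) => [ik|]; [case: ne; rewrite ik | lia].
  + by move=> x hx; case: eqP => [?|_]; [lia | exact: i2].
- by move=> s1 _ _.
- by lia.
Qed.

End Init2.

(** * The grid *)

Definition Pbig : prog :=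
  Pinit;; Prandom;; Pcopy;; Ppivots;; PFor 53 17 Pwin;;
  0 ::= 9:[$22 %/ #2] + ($0 - $17 * $7).

Fixpoint dp P AR (C : nat -> nat -> nat) v : nat -> nat :=
  if v is v'.+1 then
    relax (2 * pg P) (2 * pG P).+1 (fun j =>
      minn (rows P AR (v' * pm P) (dp P AR C v') (pm P) j)
           (dp P AR C v' j + C v' (j * pg P)))
  else fun=> 0.

Lemma rows_ext P AR k0 M M' i : (forall j, j < (2 * pG P).+1 -> M j = M' j) ->
  forall j, j < (2 * pG P).+1 -> rows P AR k0 M i j = rows P AR k0 M' i j.
Proof.
move=> eM; elim: i => [|i IH] j ltj /=; first exact: eM.
by apply: relax_ext => // j' ltj'; rewrite IH.
Qed.

Lemma dp_ext P AR C C' v : (forall v', v' < v -> C v' = C' v') ->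
  forall j, dp P AR C v j = dp P AR C' v j.
Proof.
move=> eC; elim: v eC => // v IH eC j.
have {}IH : dp P AR C v = dp P AR C' v by apply/funext => i; apply: IH => v' ltv; apply: eC; lia.
by rewrite /= IH eC.
Qed.

Lemma dp_le P AR C v j : j < (2 * pG P).+1 -> dp P AR C v j <= v * pw2 P.
Proof.
elim: v j => // v IH j ltj; apply: leq_trans (relax_le _ _ ltj) _.
apply: leq_trans (geq_minl _ _) _.
apply: leq_trans (@rows_le P AR (v * pm P) _ (pm P) (v * pw2 P) _ j ltj) _; first exact: IH.
by rewrite [v.+1 * _]mulSnr.
Qed.

Definition text P (inp : nat -> nat) i :=
  if (pX0 P <= i) && (i < pX0 P + 2 * pn P) then inp (i - pX0 P) else 0.

Definition rand q (c : seq bool) u :=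
  foldl (fun r i => 2 * r + nth false c (u * q + i)) 0 (iota 0 q).

(** All that the analysis needs of a run, free of the machine: [AR] gives the arrays after phase 1
    and [C v] the costs found for window [v]. *)
Record outcome P inp c AR C out : Prop := Outcome {
  out_text : AR 0 = text P inp;
  out_rand : forall u, u < pK1 P + pL P -> AR 1 u = rand (pa P + 3) c u;
  out_best : forall k, k < pNK P -> AR 2 k = best P (text P inp) (rand (pa P + 3) c) (pK1 P) k;
  out_near : forall k, k < pNK P -> AR 2 k < pw1 P ->
    exists2 v, v < pK1 P & [/\ near P (AR 1 v) k, AR 2 k = pivot_dist P (AR 0) (AR 1 v) k &
      AR 3 k = v * (8 * pH P) + (5 * pH P + k * pw1 P - AR 1 v)];
  out_rows : forall v j, v < pK1 P -> j < 8 * pH P ->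
    AR 4 (v * (8 * pH P) + j) = pivot_row P (AR 0) (AR 1 v) j;
  out_boxes : forall v, v < pNV P -> good_boxes P AR v (C v);
  out_value : out = dp P AR C (pNV P) (pG P) + (pn P - pNV P * pw2 P)
}.

Definition Tbig P :=
  200 * pn P + (5 + (pK1 P + pL P) * (10 + 6 * (pa P + 3))) + (5 + 8 * pn P) +
  (10 + 4 * pNK P + pK1 P * (480 * (pw1 P * pH P) + 24 * pNK P + 60 + 240 * pH P)) +
  (3 + pNV P * (Twin P + 3)) + 10.

Section Big.
Variables (w n tau : nat).
Hypothesis rg : regime n tau.
Local Notation P := (mkparams n tau).
Local Notation b := (2 * n).
Hypothesis wX : b + 16 * pX P + 32 < 2 ^ w.
Local Notation wp := (wp w b).

Lemma rand_lt q c u : rand q c u < 2 ^ q.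
Proof.
suff h q' : foldl (fun r i => 2 * r + nth false c (u * q' + i)) 0 (iota 0 q) < 2 ^ q by exact: h.
elim: q => // q IH; rewrite -(addn1 q) iotaD foldl_cat /= addn1 expnS.
by have := leq_b1 (nth false c (u * q' + (0 + q))); lia.
Qed.

Lemma Pbig_spec s : areg s 0 = n -> areg s 1 = tau -> areg s 2 = 2 * n ->
  (forall i, 23 < i < 40 -> areg s i = 0) -> (forall r x, aarr s r x = 0) ->
  wp Pbig s (Tbig P) (fun s' => exists AR C, outcome P (ainp s) (acoins s) AR C (areg s' 0)).
Proof.
move=> r0 r1 r2 r3 ar0; have wP := mkparams_wf rg.
have qX : 2 ^ (pa P + 3).+1 <= pX P.
  by rewrite expnS -/(pQ P); have := X_Q wP; lia.
have KX : pK1 P + pL P + 2 <= pX P.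
  exact: X_L wP.
have [Ta eTa] : exists T, T = 200 * n by eexists.
have [Tb eTb] : exists T, T = 5 + (pK1 P + pL P) * (10 + 6 * (pa P + 3)) by eexists.
have [Tc eTc] : exists T, T = 5 + 8 * n by eexists.
have [Td eTd] : exists T, T = 10 + 4 * pNK P + pK1 P * (480 * (pw1 P * pH P) + 24 * pNK P + 60 + 240 * pH P)
  by eexists.
have [Te eTe] : exists T, T = 3 + pNV P * (Twin P + 3) by eexists.
apply: (@wp_conseq _ _ _ _ (Ta + (Tb + (Tc + (Td + (Te + 1).+1).+1).+1).+1).+1).
2: by rewrite /Tbig -eTb -eTd -eTe eTa eTc; rewrite -[pn P]/n; clear; lia.
2: by move=> s' _ h; exact: h.
apply: wp_seq (leqnn _); rewrite eTa.
apply: (wp_conseq (Pinit_spec rg wX r0 r1 r2 r3)) => [//|s1 F1 cs1].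
have [_ fa1 in1 co1] := F1; have {}co1 := co1 isT; have c1 := cstE cs1.
apply: wp_seq (leqnn _); rewrite eTb.
have c15 : areg s1 15 = pK1 P + pL P by rewrite c1.
have c12 : areg s1 12 = pa P + 3 by rewrite c1.
apply: (wp_conseq (Prandom_spec wX c15 c12 qX KX)) => [//|s2 F2 rnd2].
have [_ fa2 in2 _] := F2; have cs2 := frame_cst F2 isT cs1.
apply: wp_seq (leqnn _); rewrite eTc.
apply: (wp_conseq (Pcopy_spec rg wX cs2)) => [//|s3 F3 [cp1 cp2]].
have [_ fa3 in3 _] := F3; have cs3 := frame_cst F3 isT cs2.
have text3 : aarr s3 0 = text P (ainp s).
  apply/funext => i; rewrite /text; case: ifP => hi.
    have -> : i = pX0 P + (i - pX0 P) by lia.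
    by rewrite cp1 ?addKn ?in2 ?in1 //; move: hi; rewrite -[pn P]/n; lia.
  rewrite cp2; last by move: hi; rewrite -[pn P]/n; lia.
  by rewrite fa2 // fa1.
have rand3 u : u < pK1 P + pL P -> aarr s3 1 u = rand (pa P + 3) (acoins s) u /\
    rand (pa P + 3) (acoins s) u < pQ P.
  by move=> ltu; split; [rewrite fa3 // rnd2 // co1 | exact: rand_lt].
apply: wp_seq (leqnn _); rewrite eTd.
apply: (wp_conseq (Ppivots_spec wP wX cs3 text3 (R := rand (pa P + 3) (acoins s)) _)) => [u ltu|//|s4 F4 [best4 [tab3 tab4]]].
  by apply: rand3; lia.
have [_ fa4 _ _] := F4; have cs4 := frame_cst F4 isT cs3; have c4 := cstE cs4.
pose AR := aarr s4.
have AR0 : AR 0 = text P (ainp s) by rewrite /AR fa4.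
have AR1 u : u < pK1 P + pL P -> AR 1 u = rand (pa P + 3) (acoins s) u.
  by move=> ltu; rewrite /AR fa4 //; case: (rand3 u ltu).
have near4 k : k < pNK P -> AR 2 k < pw1 P ->
    exists2 v, v < pK1 P & [/\ near P (AR 1 v) k, AR 2 k = pivot_dist P (AR 0) (AR 1 v) k &
      AR 3 k = v * (8 * pH P) + (5 * pH P + k * pw1 P - AR 1 v)].
  move=> ltk hk; rewrite /AR best4 // in hk; have [v ltv [t1 t2 t3]] := tab3 k ltk hk.
  by exists v => //; rewrite AR1 ?AR0; [split=> //; rewrite /AR best4 | lia].
have rows4 v j : v < pK1 P -> j < 8 * pH P ->
    AR 4 (v * (8 * pH P) + j) = pivot_row P (AR 0) (AR 1 v) j.
  by move=> ltv ltj; rewrite /AR tab4 // -/AR AR0 AR1 //; lia.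
have AR_rand u : u < pK1 P + pL P -> AR 1 u < pQ P.
  by move=> ltu; rewrite AR1 //; case: (rand3 u ltu).
have AR_best k : k < pNK P -> AR 2 k <= pw1 P by move=> ltk; rewrite /AR best4 //; exact: best_le.
have AR_tab k : k < pNK P -> AR 2 k < pw1 P -> AR 3 k + 2 * pH P <= pX P /\
    forall j, j <= 2 * pG P -> AR 4 (AR 3 k + j * pg P) <= pw1 P.
  move=> ltk hk; have [v ltv [/andP[n1 n2] _ e3]] := near4 k ltk hk.
  have vK : v * (8 * pH P) + 8 * pH P <= pX P.
    apply: leq_trans (X_K wP); rewrite [_ + 8 * pH P]addnC -mulSn mulnC leq_mul2l; apply/orP; right.
    exact: leq_trans ltv (leqnSn _).
  have gG j : j <= 2 * pG P -> j * pg P <= 2 * pH P.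
    by move=> lej; rewrite -(G_def wP) mulnA leq_mul2r lej orbT.
  split; first by rewrite e3; lia.
  move=> j /gG hj; rewrite e3 -addnA rows4 //; last by lia.
  by apply: match_row_le; lia.
have eG : 2 * pG P %/ 2 = pG P by rewrite mulKn.
apply: wp_seq (leqnn _); rewrite eTe.
apply: (@wp_for _ _ _ _ _ _ (pNV P) _ (Twin P) (fun v s' =>
  (forall e, aarr s' 8 e <= pw2 P) /\ exists2 C, forall v', v' < v -> good_boxes P AR v' (C v') &
  forall j, j < (2 * pG P).+1 -> aarr s' 9 j = dp P AR C v j)).
- by [].
- by rewrite c4.
- apply: leq_ltn_trans (leq_trans (leq_pmulr _ _) (N_le wP)) _.
    by rewrite /pw2 muln_gt0 m_gt0 // w1_gt0.
  have hX := X_n wP; clear - wX hX; rewrite -[pn P]/n in hX *; lia.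
- split; first by move=> e; rewrite /= fa4 // fa3 // fa2 // fa1 // ar0.
  exists (fun=> fun=> 0) => // j _.
  by rewrite /= fa4 // fa3 // fa2 // fa1 // ar0.
- move=> v s5 ltv e53 F5 [C0 [C gb M5]].
  have [_ fa5 _ _] := F5; have cs5 := frame_cst F5 isT cs4.
  have cx5 : ctx P AR s5.
    by split=> // r ltr; rewrite /AR fa5 //=; move: ltr; do 5 (case: r => [|r] //).
  apply: (wp_conseq (Pwin_spec wP wX AR_rand AR_best AR_tab cx5 ltv e53 C0 M5 _)) => [j ltj|//|s6 F6].
    exact: dp_le.
  move=> [C0' [C' gb' M6]]; split=> //.
  (* The new table is added for window [v]; by [dp_ext] the rows up to [v] do not see it. *)
  pose D := fun v' => if v' == v then C' else C v'.
  have eD v' : v' < v -> D v' = C v' by rewrite /D; case: eqP => // ->; rewrite ltnn.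
  exists D => [v'|j ltj].
    rewrite ltnS leq_eqVlt => /orP[/eqP ->|ltv']; first by rewrite /D eqxx.
    by rewrite eD //; exact: gb.
  rewrite /= M6 //; apply: relax_ext => // i lti.
  have eDv : D v = C' by rewrite /D eqxx.
  rewrite eDv (dp_ext _ _ eD) (rows_ext _ _ _ _ (M := dp P AR D v) (M' := dp P AR C v)) //.
  by move=> i' _; exact: dp_ext.
- move=> s5 _ F5 [_ [C gb M5]]; have cs5 := frame_cst F5 isT cs4; have c5 := cstE cs5.
  have Glt : pG P < (2 * pG P).+1 by lia.
  have := dp_le AR C (pNV P) Glt; have := N_le wP; have Xn := X_n wP => hN hd.
  have := G_def wP; have := g_gt0 wP; have := H_le wP => Hle gg Gd.
  have GX : 2 * pG P <= 2 * pH P by rewrite leq_mul2l -Gd leq_pmulr.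
  apply: wp_set; rewrite /= ?c5 ?eG ?M5 //; last by exists AR, C; split.
  by safe_split; lia.
- by [].
Qed.

End Big.

(** * Sums over the levels, and soundness of the output *)

Lemma geom_sum_lt g c L :
  \sum_(0 <= l < L) g * 2 ^ l * (g * 2 ^ l < c) <= g * 2 ^ L /\
  \sum_(0 <= l < L) g * 2 ^ l * (g * 2 ^ l < c) <= 2 * c.
Proof.
elim: L => [|L [IH1 IH2]]; first by rewrite big_geq.
rewrite big_nat_recr //= expnS; case: ltnP => h; rewrite ?muln1 ?muln0 ?addn0; last by lia.
by have := IH1; move: (\sum_(_ <= _ < _) _) => S; lia.
Qed.

(** A dyadic layer-cake bound: up to the factor [K], the levels that [x] exceeds add up to at least
    [x], the levels below [l0] being replaced by one term. *)
Lemma layer_cake K g l0 L x : l0 <= L -> x <= K * (g * 2 ^ L) ->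
  x <= K * (g * 2 ^ l0 + \sum_(l0 <= l < L) g * 2 ^ l * (K * (g * 2 ^ l) < x)).
Proof.
move=> le0 hx.
(* Either the bound is reached, or [x] has exceeded every level so far and the sum has telescoped to
   [g * 2 ^ M]. *)
have main M : l0 <= M ->
  let S := g * 2 ^ l0 + \sum_(l0 <= l < M) g * 2 ^ l * (K * (g * 2 ^ l) < x) in
  x <= K * S \/ (S = g * 2 ^ M /\ K * (g * 2 ^ M) < x).
  elim: M => [|M IH].
    rewrite leqn0 => /eqP ->; rewrite big_geq // addn0 /=.
    by case: (leqP x (K * (g * 2 ^ 0))); [left | right].
  rewrite leq_eqVlt => /orP[/eqP <-|lt0].
    rewrite big_geq // addn0 /=.
    by case: (leqP x (K * (g * 2 ^ l0))); [left | right].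
  rewrite big_nat_recr //= addnA; case: (IH lt0) => /= [h|[eS h]].
    by left; apply: leq_trans h _; rewrite leq_mul2l leq_addr orbT.
  rewrite eS h muln1 addnn -mul2n (_ : 2 * (g * 2 ^ M) = g * 2 ^ M.+1); last by rewrite expnS; ring.
  by case: (leqP x (K * (g * 2 ^ M.+1))); [left | right].
case: (main L le0) => // -[_ h].
by rewrite leqNgt h in hx.
Qed.

Section Analysis.
Variables (P : params) (inp : nat -> nat) (c : seq bool) (AR C : nat -> nat -> nat) (out : nat).
Hypotheses (wP : wfp P) (w1H : 2 * pw1 P <= pH P) (oc : outcome P inp c AR C out).
Local Notation n := (pn P).
Local Notation w1 := (pw1 P).
Local Notation w2 := (pw2 P).
Local Notation g := (pg P).
Local Notation m := (pm P).
Local Notation H := (pH P).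
Local Notation X0 := (pX0 P).
Local Notation Y0 := (pY0 P).
Local Notation JG := (2 * pG P).+1.
Local Notation t := (AR 0).
Local Notation wd := (wdist t).

Let g0 : 0 < g := g_gt0 wP.
Let H0 : 0 < H := H_gt0 wP.
Let Gd : pG P * g = H := G_def wP.

Let Y0E : Y0 = 8 * H + n.
Proof. by []. Qed.

Let X0E : X0 = 8 * H.
Proof. by []. Qed.

Lemma jg_le j : j < JG -> j * g <= 2 * H.
Proof. by rewrite ltnS => lej; rewrite -Gd mulnA leq_mul2r lej orbT. Qed.

Lemma near_bounds k : k < pNK P -> AR 2 k < w1 ->
  exists r, [/\ k * w1 < r, r <= k * w1 + 4 * H,
    wd (pivot P r) (X0 + k * w1) w1 <= AR 2 k &
    forall j, j < JG -> AR 4 (AR 3 k + j * g) =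
      match_row t (pivot P r) (pivot P r - 4 * H) (8 * H) w1 (5 * H + k * w1 - r + j * g)].
Proof.
move=> ltk hk; have [u ltu [/andP[n1 n2] e2 e3]] := out_near oc ltk hk.
exists (AR 1 u); split=> //.
  rewrite e2 /pivot_dist; have := @match_row_lower t (pivot P (AR 1 u)) (X0 - 4 * H + AR 1 u) (4 * H) w1
    (k * w1 + 4 * H - AR 1 u).
  rewrite (_ : X0 - 4 * H + AR 1 u + (k * w1 + 4 * H - AR 1 u) = X0 + k * w1); last by rewrite X0E; lia.
  by apply; lia.
move=> j /jg_le hj; by rewrite e3 -addnA (out_rows oc) //; lia.
Qed.

Lemma est_lower k j : k < pNK P -> j < JG ->
  wd (X0 + k * w1) (Y0 - H + j * g + k * w1) w1 <= est P AR k j.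
Proof.
move=> ltk ltj; rewrite /est; case: ifP => hk; last exact: wdist_size.
have [r [r1 r2 h1 h2]] := near_bounds ltk hk.
rewrite leq_min wdist_size /= h2 //.
apply: leq_trans (wdist_trans _ (pivot P r) _ _ _) _; rewrite leq_add //.
  by rewrite wdist_sym.
have hj := jg_le ltj.
have := @match_row_lower t (pivot P r) (pivot P r - 4 * H) (8 * H) w1 (5 * H + k * w1 - r + j * g).
rewrite (_ : pivot P r - 4 * H + _ = Y0 - H + j * g + k * w1); last by rewrite /pivot Y0E; lia.
by apply; lia.
Qed.

(** Moving to the next grid diagonal shifts a window by [g], so distances change by at most [2 * g],
    the cost used in [relax]. *)
Lemma rows_lower v (M : nat -> nat) i : v < pNV P -> i <= m ->
  (forall j, j < JG -> wd X0 (Y0 - H + j * g) (v * w2) <= M j) ->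
  forall j, j < JG -> wd X0 (Y0 - H + j * g) (v * w2 + i * w1) <= rows P AR (v * m) M i j.
Proof.
move=> ltv; elim: i => [|i IH] lei hM j ltj; first by rewrite mul0n addn0 hM.
have ltk : v * m + i < pNK P by exact: flat_lt.
have vw : (v * m + i) * w1 = v * w2 + i * w1 by rewrite /pw2 mulnDl mulnA.
apply: (relax_lower (h := fun j => wd X0 (Y0 - H + j * g) (v * w2 + i.+1 * w1))) ltj => {}j ltj.
  rewrite [i.+1 * _]mulSnr addnA; apply: leq_trans (wdistD _ _ _ _ _) _.
  rewrite leq_add ?IH //; first by lia.
  by have := est_lower ltk ltj; rewrite vw addnA.
by split; apply: wdist_shiftr; rewrite mulSn; lia.
Qed.

Lemma dp_lower v j : v <= pNV P -> j < JG ->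
  wd X0 (Y0 - H + j * g) (v * w2) <= dp P AR C v j.
Proof.
elim: v j => [|v IH] j lev ltj; first by rewrite /wdist edit_distance_refl.
apply: (relax_lower (h := fun j => wd X0 (Y0 - H + j * g) (v.+1 * w2))) ltj => {}j ltj.
  rewrite leq_min [v.+1 * _]mulSnr; apply/andP; split.
    by apply: rows_lower => // i lti; apply: IH => //; exact: ltnW.
  apply: leq_trans (wdistD _ _ _ _ _) _; rewrite leq_add ?IH //; first exact: ltnW.
  by have [so _ _] := out_boxes oc lev; apply: so; rewrite -ltnS.
by split; apply: wdist_shiftr; rewrite mulSn; lia.
Qed.

(** Column [pG P] is the diagonal on which [x] meets the start of [y]; the symbols beyond the last
    full window are paid in full. *)
Lemma outcome_lower : wd X0 Y0 (pNV P * w2) + (n - pNV P * w2) <= out.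
Proof.
rewrite (out_value oc) leq_add2r.
have := @dp_lower (pNV P) (pG P) (leqnn _) ltac:(lia).
by rewrite Gd (_ : Y0 - H + H = Y0) // Y0E; lia.
Qed.

End Analysis.

(** * Approximation *)

(** Numbers giving a pivot close to block [k]. The margins at both ends keep the block inside the
    pivot's band, so that the estimate there is within a factor 3. *)
Definition hits P t k e := [seq r <- iota 0 (pQ P) |
  [&& k * pw1 P + pH P <= r, r + pw1 P <= k * pw1 P + 4 * pH P &
      wdist t (pX0 P + k * pw1 P) (pivot P r) (pw1 P) <= e]].

Definition segment_cost (d : nat -> nat) i l := \sum_(i <= j < i + l) d j.

Lemma band_shift Y V I B h e : B + h <= Y -> I <= e + h ->
  Y + V + I - B - h + (e + h - I) = Y - B + V + e.
Proof. by lia. Qed.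

Section Approximation.
Variables (P : params) (inp : nat -> nat) (c : seq bool) (AR C : nat -> nat -> nat) (out : nat).
Hypotheses (wP : wfp P) (w1H : 2 * pw1 P <= pH P) (oc : outcome P inp c AR C out).
Hypothesis w1lev : pw1 P <= 51 * (pg P * 2 ^ plev P).
Local Notation n := (pn P).
Local Notation w1 := (pw1 P).
Local Notation w2 := (pw2 P).
Local Notation g := (pg P).
Local Notation m := (pm P).
Local Notation H := (pH P).
Local Notation X0 := (pX0 P).
Local Notation Y0 := (pY0 P).
Local Notation JG := (2 * pG P).+1.
Local Notation t := (AR 0).
Local Notation wd := (wdist t).
Local Notation N := (pNV P * pw2 P).
(** One path, chosen independently of the coins. The hypotheses [hit] and [lucky] below are the good
    events: dense blocks get a pivot, and windows with many cheap far blocks get a cheap sample. *)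
Variables (c0 : nat) (pos d : nat -> nat).
Hypotheses (pr : profile t X0 Y0 N c0 pos d) (hc : 2 * c0 <= H).
Local Notation cost := (segment_cost d).
Local Notation cw k := (cost (k * w1) w1).
Local Notation cW v := (cost (v * w2) w2).

Hypothesis hit : forall k l, k < pNK P -> l < plev P ->
  w2 <= size (hits P t k (17 * (g * 2 ^ l))) ->
  exists2 u, u < pK1 P & AR 1 u \in hits P t k (17 * (g * 2 ^ l)).

Hypothesis lucky : forall v l, v < pNV P -> l < plev P ->
  0 < size (far P AR v (g * 2 ^ l)) ->
  size (far P AR v (g * 2 ^ l)) <=
    4 * count (fun k => cw k <= g * 2 ^ l) (far P AR v (g * 2 ^ l)) ->
  exists2 u, u < pL P & cw (chosen P AR v (g * 2 ^ l) u) <= g * 2 ^ l.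

Let g0 : 0 < g := g_gt0 wP.
Let H0 : 0 < H := H_gt0 wP.
Let m0 : 0 < m := m_gt0 wP.
Let Gd : pG P * g = H := G_def wP.

Let Y0E : Y0 = 8 * H + n.
Proof. by []. Qed.

Let X0E : X0 = 8 * H.
Proof. by []. Qed.

Lemma NK_N : pNK P * w1 = N.
Proof. by rewrite /pNK /pw2 mulnA. Qed.

(** The diagonal of the path at row [i], counted from the lowest of the grid; [jx] rounds it down to
    a grid column. *)
Definition off i := pos i - (Y0 - H + i).
Definition jx i := off i %/ g.

Lemma cost_le i l : i + l <= N -> cost i l <= c0.
Proof.
move=> le; have [_ _ _ h] := pr; apply: leq_trans (leq_trans _ h); last exact: leq_addl.
rewrite (@big_cat_nat _ _ _ i) //=; last by lia.
rewrite (@big_cat_nat _ _ _ (i + l) i) //=; last by lia.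
by rewrite /segment_cost; lia.
Qed.

Lemma off_bounds i : i <= N ->
  [/\ pos i = Y0 - H + i + off i, H - c0 <= off i & off i <= H + c0].
Proof.
move=> le; have [P0 _ _ _] := pr; have := @cost_le 0 i ltac:(lia).
have [] := profile_drift (i := 0) (l := i) pr ltac:(lia).
by rewrite -/(cost 0 i) add0n P0 /off Y0E => h1 h2 h3; split; lia.
Qed.

Lemma off_drift i l : i + l <= N ->
  off (i + l) <= off i + cost i l /\ off i <= off (i + l) + cost i l.
Proof.
move=> le; have [e1 _ _] := @off_bounds i ltac:(lia); have [e2 _ _] := off_bounds le.
by have [] := profile_drift pr le; rewrite -/(cost i l) e1 e2; lia.
Qed.

Lemma jx_bounds i : i <= N -> [/\ jx i < JG, jx i * g <= off i & off i < jx i * g + g].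
Proof.
move=> le; have [_ _ h] := off_bounds le.
split; rewrite /jx.
- by rewrite ltn_divLR // mulSn -mulnA Gd; lia.
- exact: leq_divM.
- by rewrite addnC -mulSn -ltn_divLR.
Qed.

Lemma window_cost i l : i + l <= N ->
  wd (X0 + i) (Y0 - H + i + jx i * g) l <= 3 * cost i l + 2 * g.
Proof.
move=> le; have [e _ _] := @off_bounds i ltac:(lia); have [_ j1 j2] := @jx_bounds i ltac:(lia).
apply: leq_trans (@wdist_shiftr t _ (pos i) _ g _ _ _) _; [by lia | by lia |].
by rewrite leq_add2r; exact: profile_window pr le.
Qed.

(** A pivot within 17 s is estimated by at most 3 * 17 s = 51 s, the threshold in [far]. *)
Lemma hit_best k l : k < pNK P -> l < plev P ->
  w2 <= size (hits P t k (17 * (g * 2 ^ l))) -> AR 2 k <= 51 * (g * 2 ^ l).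
Proof.
move=> ltk ltl /(hit ltk ltl)[u ltu]; rewrite mem_filter => /andP[/and3P[r1 r2 r3] _].
have eR : AR 1 u = rand (pa P + 3) c u by rewrite (out_rand oc) //; lia.
rewrite (out_best oc ltk) -(out_text oc).
have main v : u < v -> best P t (rand (pa P + 3) c) v k <= pivot_dist P t (AR 1 u) k.
  elim: v => // v IH; rewrite ltnS leq_eqVlt /= => /orP[/eqP <-|/IH h].
    rewrite -eR (_ : near P (AR 1 u) k) /=; last by rewrite /near; lia.
    by case: ltnP => // _; exact: leqnn.
  by case: ifP => // /andP[_ h']; lia.
apply: leq_trans (main _ ltu) _.
have e : wd (pivot P (AR 1 u)) (X0 - 4 * H + AR 1 u + (k * w1 + 4 * H - AR 1 u)) w1 =
   wd (X0 + k * w1) (pivot P (AR 1 u)) w1.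
  by rewrite wdist_sym; congr (wdist t _ _ _); rewrite X0E; lia.
have := wdist_size t (X0 + k * w1) (pivot P (AR 1 u)) w1 => hs.
apply: leq_trans (match_row_upper _ _) _; rewrite e; lia.
Qed.

Lemma far_mem v s k : k \in far P AR v s ->
  [/\ v * m <= k, k < v * m + m & 51 * s < AR 2 k].
Proof. by rewrite mem_filter mem_iota => /and3P[]. Qed.

Lemma AR2_le k : k < pNK P -> AR 2 k <= w1.
Proof. by move=> ltk; rewrite (out_best oc ltk) best_le. Qed.

Lemma win_in v k : v < pNV P -> v * m <= k -> k < v * m + m ->
  [/\ k < pNK P, v * w2 <= k * w1, k * w1 + w1 <= v * w2 + w2 & v * w2 + w2 <= N].
Proof.
move=> ltv h1 h2; have vw : v * w2 = v * m * w1 by rewrite /pw2 mulnA.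
split.
- by rewrite -(subnKC h1); apply: flat_lt => //; lia.
- by rewrite vw leq_mul2r h1 orbT.
- by rewrite vw /pw2 -mulnDl [_ + w1]addnC -mulSn leq_mul2r h2 orbT.
- by rewrite addnC -mulSn leq_mul2r ltv orbT.
Qed.

(** Contraposition: if the candidates cover [w2] positions, each position within [s] above a
    candidate is a hit, at distance at most 15 s + 2 s; then a pivot is hit and the block is not
    far. *)
Lemma far_sparse v l k : v < pNV P -> l < plev P -> k \in far P AR v (g * 2 ^ l) ->
  sparse P AR k (g * 2 ^ l).
Proof.
set s := g * 2 ^ l => ltv ltl kf; have [k1 k2 k3] := far_mem kf.
have [ltk _ _ _] := win_in ltv k1 k2.
rewrite /sparse ltnNge; apply/negP => dn.
suff : AR 2 k <= 51 * s by lia.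
apply: hit_best => //; apply: leq_trans dn _; rewrite -/s.
have s0 : 0 < s by rewrite /s muln_gt0 g0 expn_gt0.
have sw : 51 * s < w1 by apply: leq_trans k3 (AR2_le ltk).
have kn := NK_le wP ltk.
(* Encodes a candidate and an offset below [s] in one number. Candidates lie [s] apart, so [f] is
   injective. *)
pose f x := k * w1 + (H + nth 0 (cands P AR k s) (x %/ s) * s + x %% s).
have cand_ok x : x < size (cands P AR k s) * s ->
   nth 0 (cands P AR k s) (x %/ s) \in cands P AR k s.
  by move=> ltx; apply: mem_nth; rewrite ltn_divLR.
have cand_in i : i \in cands P AR k s -> i * s + s <= 2 * H /\ samp P AR k (H + i * s) <= 15 * s.
  rewrite mem_filter mem_iota => /and3P[h1 _ h2]; split=> //.
  apply: leq_trans (leq_divM (2 * H) s); rewrite addnC -mulSn leq_mul2r.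
  by rewrite add0n in h2; rewrite h2 orbT.
rewrite -(size_iota 0 (size (cands P AR k s) * s)) -(size_map f).
apply: uniq_leq_size.
  rewrite map_inj_in_uniq ?iota_uniq // => x y; rewrite !mem_iota !add0n => /andP[_ ltx] /andP[_ lty].
  rewrite /f => /addnI; have := ltn_pmod x s0; have := ltn_pmod y s0 => my mx e.
  have uc : uniq (cands P AR k s) by rewrite filter_uniq // iota_uniq.
  have ei : nth 0 (cands P AR k s) (x %/ s) = nth 0 (cands P AR k s) (y %/ s).
    have {}e : nth 0 (cands P AR k s) (x %/ s) * s + x %% s = nth 0 (cands P AR k s) (y %/ s) * s + y %% s by lia.
    by have := congr1 (fun z => z %/ s) e; rewrite /= !divnMDl // (divn_small mx) (divn_small my) !addn0.
  have ed : x %/ s = y %/ s by apply/eqP; rewrite -(nth_uniq 0 _ _ uc) ?ei // ltn_divLR.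
  by rewrite (divn_eq x s) (divn_eq y s) ed; move: e; rewrite ei; lia.
move=> _ /mapP[x ltx ->]; rewrite mem_iota add0n in ltx.
have [c1 c2] := cand_in _ (cand_ok x ltx).
have mx := ltn_pmod x s0; rewrite mem_filter mem_iota /f.
move: c1 c2; set i := nth _ _ _ => c1 c2.
apply/andP; split; last by rewrite add0n; have := Q_ge wP; have := H_le wP; lia.
apply/and3P; split; [lia | lia |].
have lo := @match_row_lower t (X0 + k * w1) (Y0 - 2 * H + k * w1) (4 * H) w1 (H + i * s) ltac:(lia).
apply: leq_trans (@wdist_shiftr t _ (Y0 - 2 * H + k * w1 + (H + i * s)) _ s _ _ _) _.
- by rewrite /pivot Y0E; lia.
- by rewrite /pivot Y0E; lia.
- by move: c2; rewrite /samp; lia.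
Qed.

(** The condition on [halfband] says that the extension sees the path: the entry column is within
    [cW v + s + g] of the sampled diagonal, and a distance of at most [3 * cW v + 2 * g] needs as
    much room again. *)
Lemma found v l u : v < pNV P -> l < plev P -> u < pL P ->
  let s := g * 2 ^ l in
  0 < size (far P AR v s) -> cw (chosen P AR v s u) <= s ->
  4 * cW v + s + 3 * g <= halfband P s -> C v (jx (v * w2) * g) <= 9 * cW v + 6 * g.
Proof.
move=> ltv ltl ltu s sz ck hh.
have kf : chosen P AR v s u \in far P AR v s by rewrite mem_nth // ltn_mod.
move: kf ck; set k := chosen P AR v s u => kf ck.
have [_ _ /(_ l ltl u ltu sz)] := out_boxes oc ltv; rewrite -/s -/k => sampl.
have {}sampl := sampl (far_sparse ltv ltl kf).
have [k1 k2 k3] := far_mem kf; have [ltk p1 p2 p3] := win_in ltv k1 k2.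
have s0 : 0 < s by rewrite /s muln_gt0 g0 expn_gt0.
have sw : 51 * s < w1 by apply: leq_trans k3 (AR2_le ltk).
have [e1 b1 b2] := @off_bounds (k * w1) ltac:(lia).
pose i := off (k * w1) %/ s.
have i1 : i * s <= off (k * w1) by exact: leq_divM.
have i2 : off (k * w1) < i * s + s by rewrite addnC -mulSn -ltn_divLR.
have isH : i * s + s <= 2 * H by lia.
have ic : i \in cands P AR k s.
  have isN : i < 2 * H %/ s by rewrite leq_divRL // mulSnr.
  rewrite mem_filter mem_iota leq0n add0n isN !andbT.
  have wk := wdist_size t (X0 + k * w1) (Y0 - 2 * H + k * w1 + (H + i * s)) w1.
  apply: leq_trans (match_row_upper _ _) _; [lia | lia |].
  (* 3 s for the block on the path and 2 s for moving to the multiple of [s] below; the band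
     estimate triples it to 15 s. *)
  suff : wd (X0 + k * w1) (Y0 - 2 * H + k * w1 + (H + i * s)) w1 <= 5 * s by lia.
  apply: leq_trans (@wdist_shiftr t _ (pos (k * w1)) _ s _ _ _) _.
  - by rewrite e1 Y0E; lia.
  - by rewrite e1 Y0E; lia.
  - by have := profile_window pr (i := k * w1) (l := w1) ltac:(lia); rewrite -/(cost _ _); lia.
have {}sampl := sampl i ic.
have [ej1 ej2 ej3] := @jx_bounds (v * w2) ltac:(lia).
have [f1 fb1 fb2] := @off_bounds (v * w2) ltac:(lia).
have dr := @off_drift (v * w2) (k * w1 - v * w2) ltac:(lia).
rewrite subnKC // in dr.
have cost_sub : cost (v * w2) (k * w1 - v * w2) <= cW v.
  rewrite /segment_cost subnKC // [leqRHS](@big_cat_nat _ _ _ (k * w1) (v * w2)) //=; last by lia.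
  exact: leq_addr.
have hw : halfband P s <= w2.
  by rewrite /halfband /pw2 mulnC leq_mul2l; apply/orP; right; lia.
have wc := @window_cost (v * w2) w2 p3.
clearbody i.
move: sampl hh hw wc ej2 ej3.
have ge : g %| jx (v * w2) * g by rewrite dvdn_mull.
have gh : g %| halfband P s by rewrite /halfband dvdn_mulr // dvdn_mull // /s dvdn_mulr.
rewrite /extended /ext; move: ge gh; move: (jx (v * w2) * g) (halfband P s) => e h ge gh sampl hh hw wc ej2 ej3.
have gs : g %| s by rewrite /s dvdn_mulr.
have gf : g %| e + h - i * s.
  by apply: dvdn_sub; [rewrite dvdn_add | rewrite dvdn_mull].
have ef : (e + h - i * s) %/ g * g = e + h - i * s by rewrite divnK.
have := sampl ((e + h - i * s) %/ g); rewrite ef => {}sampl.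
clear ef gf gs ge gh.
have eh : i * s <= e + h by lia.
have {}sampl := sampl ltac:(lia) ltac:(lia).
rewrite (_ : i * s + (e + h - i * s) - h = e) in sampl; last by lia.
apply: leq_trans sampl _.
have eq : Y0 + v * w2 + i * s - H - h + (e + h - i * s) = Y0 - H + v * w2 + e.
  by apply: band_shift eh; have w2n := w2_le wP; rewrite Y0E; clear - hw w2n; lia.
by apply: leq_trans (match_row_upper _ _) _; rewrite eq; lia.
Qed.

Lemma count_iota_sum (p : pred nat) i l : count p (iota i l) = \sum_(i <= k < i + l) p k.
Proof.
elim: l => [|l IH]; first by rewrite addn0 big_geq.
by rewrite -(addn1 l) iotaD count_cat /= addn0 addn1 addnS big_nat_recr /= ?leq_addr // IH.
Qed.

(** Block to pivot costs [AR 2 k]. Pivot to grid window is at most [AR 2 k + 3 * cw k + 2 * g] by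
    the triangle inequality, and its estimate at most three times that. *)
Lemma est_upper k : k < pNK P -> est P AR k (jx (k * w1)) <= 4 * AR 2 k + 9 * cw k + 6 * g.
Proof.
move=> ltk; have leN : k * w1 + w1 <= N.
  by rewrite -NK_N addnC -mulSn leq_mul2r ltk orbT.
rewrite /est; case: ifP => hk; last by have := AR2_le ltk; lia.
have [r [r1 r2 h1 h2]] := near_bounds wP w1H oc ltk hk.
have [j1 _ _] := jx_bounds (i := k * w1) ltac:(lia).
have hj := jg_le wP j1.
apply: leq_trans (geq_minr _ _) _; rewrite h2 //.
have e : pivot P r - 4 * H + (5 * H + k * w1 - r + jx (k * w1) * g) = Y0 - H + k * w1 + jx (k * w1) * g.
  by rewrite /pivot Y0E; lia.
have d1 := wdist_size t (pivot P r) (Y0 - H + k * w1 + jx (k * w1) * g) w1.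
have d2 := wdist_trans t (X0 + k * w1) (pivot P r) (Y0 - H + k * w1 + jx (k * w1) * g) w1.
have d3 := window_cost leN.
suff : match_row t (pivot P r) (pivot P r - 4 * H) (8 * H) w1 (5 * H + k * w1 - r + jx (k * w1) * g)
    <= 3 * wd (pivot P r) (Y0 - H + k * w1 + jx (k * w1) * g) w1 by lia.
by rewrite -e; apply: match_row_upper; rewrite e; lia.
Qed.

(** To [est_upper] each block adds [2 * cw k + 2 * g], for changing the grid column along with the
    path. *)
Lemma rows_upper v i (M : nat -> nat) : v < pNV P -> i <= m ->
  rows P AR (v * m) M i (jx (v * w2 + i * w1)) <=
  M (jx (v * w2)) + \sum_(v * m <= k < v * m + i) (4 * AR 2 k + 11 * cw k + 8 * g).
Proof.
move=> ltv; elim: i => [|i IH] lei; first by rewrite mul0n !addn0 big_geq ?addn0.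
have [ltk _ p2 p3] : [/\ v * m + i < pNK P, true, (v * m + i) * w1 + w1 <= v * w2 + w2 & v * w2 + w2 <= N].
  by have [] := win_in ltv (leq_addr i (v * m)) ltac:(lia).
have vw : v * w2 + i * w1 = (v * m + i) * w1 by rewrite /pw2 mulnDl mulnA.
have vwS : v * w2 + i.+1 * w1 = (v * m + i) * w1 + w1 by rewrite [i.+1 * _]mulSnr addnA vw.
have {}IH := IH (ltnW lei); rewrite vw in IH; rewrite vwS addnS big_nat_recr /= ?leq_addr //.
move: ltk p2 IH; set k := v * m + i => ltk p2 IH.
have [j1 j2 j3] := jx_bounds (i := k * w1) ltac:(lia).
have [i1 i2 i3] := jx_bounds (i := k * w1 + w1) ltac:(lia).
have [d1 d2] := off_drift (i := k * w1) (l := w1) ltac:(lia).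
set F := fun j => rows P AR (v * m) M i j + est P AR k j.
pose e := (jx (k * w1 + w1) - jx (k * w1)) + (jx (k * w1) - jx (k * w1 + w1)).
have eg : e * g <= cw k + g by rewrite /e mulnDl !mulnBl; lia.
have lip : relax (2 * g) JG F (jx (k * w1 + w1)) <= relax (2 * g) JG F (jx (k * w1)) + 2 * g * e.
  by apply: relax_lipschitz => //; rewrite /e; lia.
apply: leq_trans lip _; have := relax_le (2 * g) F j1; rewrite {2}/F => hr.
have := est_upper ltk; rewrite -[2 * g * e]mulnA [g * e]mulnC; lia.
Qed.

Lemma cost_windows v : \sum_(v * m <= k < v * m + m) cw k = cW v.
Proof.
have main i : \sum_(v * m <= k < v * m + i) cw k = cost (v * w2) (i * w1).
  elim: i => [|i IH]; first by rewrite addn0 mul0n /segment_cost addn0 !big_geq.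
  rewrite addnS big_nat_recr /= ?leq_addr // IH /segment_cost [i.+1 * _]mulSnr.
  rewrite (_ : (v * m + i) * w1 = v * w2 + i * w1); last by rewrite /pw2 mulnDl mulnA.
  by rewrite addnA [RHS](@big_cat_nat _ _ _ (v * w2 + i * w1)) //= ?leq_addr.
by rewrite main.
Qed.

(** [l0] is the first level whose band is wide enough. At the level before, 36 m s is below 4 cW + s
    + 3 g, hence 32 m s below 4 cW, so the levels that are skipped cost only O(cW). *)
Lemma start_level v : exists l0, [/\ l0 <= plev P,
  forall l, l0 <= l < plev P -> 4 * cW v + g * 2 ^ l + 3 * g <= halfband P (g * 2 ^ l) &
  4 * (m * (g * 2 ^ l0)) <= 4 * (m * g) + cW v].
Proof.
pose ok l := 4 * cW v + g * 2 ^ l + 3 * g <= halfband P (g * 2 ^ l).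
have hbE l : halfband P (g * 2 ^ l) = 36 * (m * (g * 2 ^ l)) by rewrite /halfband -mulnA [_ * m]mulnC.
have up l : ok l -> ok l.+1.
  rewrite /ok !hbE expnS (_ : g * (2 * 2 ^ l) = 2 * (g * 2 ^ l)); last by ring.
  have : g * 2 ^ l <= m * (g * 2 ^ l) by rewrite leq_pmull.
  by rewrite (_ : m * (2 * (g * 2 ^ l)) = 2 * (m * (g * 2 ^ l))); [lia | ring].
have [l0 [le0 h1 h2]] : exists l0, [/\ l0 <= plev P, l0 = plev P \/ ok l0 &
    l0 = 0 \/ ~~ ok l0.-1].
  elim: (plev P) => [|L [l0 [le0 h1 h2]]]; first by exists 0; split=> //; left.
  have [okl|nok] := boolP (ok l0); first by exists l0; split=> //; [exact: leqW | right].
  have e0 : l0 = L by case: h1 => // h; rewrite h in nok.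
  by exists L.+1; split=> //; [left | right; rewrite /= -e0].
exists l0; split=> //.
  move=> l /andP[ge lt]; case: h1 => [e|h1]; first by lia.
  rewrite -/(ok l) -(subnKC ge); elim: (l - l0) => [|x IH]; first by rewrite addn0.
  by rewrite addnS; exact: up.
case: h2 => [->|]; first by rewrite muln1; lia.
case: l0 {le0 h1} => [_|l0]; first by rewrite muln1; lia.
rewrite /= /ok -ltnNge hbE => h.
rewrite expnS (_ : m * (g * (2 * 2 ^ l0)) = 2 * (m * (g * 2 ^ l0))); last by ring.
have g1 : g <= g * 2 ^ l0 by rewrite leq_pmulr // expn_gt0.
have g2 : g * 2 ^ l0 <= m * (g * 2 ^ l0) by rewrite leq_pmull.
by move: (m * (g * 2 ^ l0)) g2 h => Z; lia.
Qed.

(** If no level from [l0] on has a quarter of its far blocks cheap, then far blocks number at most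
    4/3 of the blocks costlier than s. Summed over the levels this gives 51 (m g 2^l0 + 8/3 cW);
    four times that, with [start_level], has 595 = 51 + 544. *)
Lemma window_case v : v < pNV P -> C v (jx (v * w2) * g) <= 9 * cW v + 6 * g \/
  4 * \sum_(v * m <= k < v * m + m) AR 2 k <= 204 * (m * g) + 595 * cW v.
Proof.
move=> ltv; have [l0 [le0 lev0 lm0]] := start_level v.
pose S l := size (far P AR v (g * 2 ^ l)).
pose K l := count (fun k => cw k <= g * 2 ^ l) (far P AR v (g * 2 ^ l)).
have [/hasP[l]|/hasPn no] := boolP (has (fun l => (0 < S l) && (S l <= 4 * K l)) (iota l0 (plev P - l0))).
  rewrite mem_iota subnKC // => /andP[gel ltl] /andP[sz cnt]; left.
  have [u ltu ck] := lucky ltv ltl sz cnt.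
  by apply: (found ltv ltl ltu sz ck); apply: lev0; rewrite gel.
right.
have szE l : S l = \sum_(v * m <= k < v * m + m) (51 * (g * 2 ^ l) < AR 2 k).
  by rewrite /S size_filter count_iota_sum.
have few l : l0 <= l < plev P -> 3 * S l <= 4 * \sum_(v * m <= k < v * m + m) (g * 2 ^ l < cw k).
  move=> hl; have /no : l \in iota l0 (plev P - l0) by rewrite mem_iota subnKC.
  have := count_predC (fun k => cw k <= g * 2 ^ l) (far P AR v (g * 2 ^ l)).
  rewrite -/(S l) -/(K l); set K' := count _ _ => eS hn.
  have : K' <= \sum_(v * m <= k < v * m + m) (g * 2 ^ l < cw k).
    rewrite -count_iota_sum /K' /far count_filter.
    by apply: sub_count => k /andP[/=]; rewrite -ltnNge.
  by lia.
have aE : \sum_(v * m <= k < v * m + m) AR 2 k <=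
    51 * (m * (g * 2 ^ l0) + \sum_(l0 <= l < plev P) g * 2 ^ l * S l).
  have -> : \sum_(l0 <= l < plev P) g * 2 ^ l * S l =
      \sum_(v * m <= k < v * m + m) \sum_(l0 <= l < plev P) g * 2 ^ l * (51 * (g * 2 ^ l) < AR 2 k).
    rewrite exchange_big /=; apply: eq_bigr => l _; by rewrite szE big_distrr.
  have -> : m * (g * 2 ^ l0) = \sum_(v * m <= k < v * m + m) (g * 2 ^ l0).
    by rewrite sum_nat_const_nat addKn.
  rewrite -big_split /= big_distrr /= !big_nat; apply: leq_sum => k /andP[k1 k2].
  have [ltk _ _ _] := win_in ltv k1 k2.
  by apply: layer_cake => //; apply: leq_trans (AR2_le ltk) w1lev.
(* For each block the levels below its cost form a geometric sum of at most twice that cost. *)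
have bE : 3 * (\sum_(l0 <= l < plev P) g * 2 ^ l * S l) <= 8 * cW v.
  apply: leq_trans (_ : 4 * \sum_(v * m <= k < v * m + m) \sum_(l0 <= l < plev P) g * 2 ^ l * (g * 2 ^ l < cw k) <= _).
    rewrite exchange_big /= !big_distrr /= !big_nat; apply: leq_sum => l /few h.
    rewrite -big_distrr /= mulnCA [4 * _]mulnCA leq_mul2l; apply/orP; right; exact: h.
  rewrite -cost_windows (_ : 8 = 4 * 2) // -mulnA leq_mul2l /= big_distrr /=.
  apply: leq_sum => k _; have [_ h] := geom_sum_lt g (cw k) (plev P).
  apply: leq_trans h; rewrite [leqRHS](@big_cat_nat _ _ _ l0) //=; exact: leq_addl.
by move: aE bE lm0; move: (m * (g * 2 ^ l0)) (m * g) (\sum_(l0 <= l < _) _) => Z1 Z2 Z3; lia.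
Qed.

(** The worse case passes through the blocks: 606 = 595 + 11 and 212 = 204 + 8 combine [window_case]
    with [rows_upper]. *)
Lemma dp_step v : v < pNV P ->
  dp P AR C v.+1 (jx (v.+1 * w2)) <= dp P AR C v (jx (v * w2)) + 606 * cW v + 212 * (m * g).
Proof.
move=> ltv; have p3 : v * w2 + w2 <= N by rewrite addnC -mulSn leq_mul2r ltv orbT.
have vS : v.+1 * w2 = v * w2 + w2 by rewrite mulSnr.
rewrite vS; have [j1 j2 j3] := jx_bounds (i := v * w2) ltac:(lia).
have [i1 i2 i3] := jx_bounds (i := v * w2 + w2) ltac:(lia).
have [d1 d2] := off_drift (i := v * w2) (l := w2) ltac:(lia).
set F := fun j => minn (rows P AR (v * m) (dp P AR C v) m j) (dp P AR C v j + C v (j * g)).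
have mg : g <= m * g by rewrite leq_pmull.
case: (window_case ltv) => hcase.
  pose e := (jx (v * w2 + w2) - jx (v * w2)) + (jx (v * w2) - jx (v * w2 + w2)).
  have eg : e * g <= cW v + g by rewrite /e mulnDl !mulnBl; lia.
  have lip : relax (2 * g) JG F (jx (v * w2 + w2)) <= relax (2 * g) JG F (jx (v * w2)) + 2 * g * e.
    by apply: relax_lipschitz => //; rewrite /e; lia.
  apply: leq_trans lip _; have := relax_le (2 * g) F j1.
  have := geq_minr (rows P AR (v * m) (dp P AR C v) m (jx (v * w2))) (dp P AR C v (jx (v * w2)) + C v (jx (v * w2) * g)).
  rewrite {2}/F -[2 * g * e]mulnA [g * e]mulnC; lia.
apply: leq_trans (relax_le (2 * g) F i1) _; apply: leq_trans (geq_minl _ _) _.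
have := rows_upper (dp P AR C v) ltv (leqnn m); rewrite -/w2 => h; apply: leq_trans h _.
rewrite -addnA leq_add2l big_split [X in X + _ <= _]big_split /= sum_nat_const_nat addKn.
have -> : \sum_(v * m <= k < v * m + m) 11 * cw k = 11 * cW v by rewrite -cost_windows big_distrr.
have -> : \sum_(v * m <= k < v * m + m) 4 * AR 2 k = 4 * \sum_(v * m <= k < v * m + m) AR 2 k.
  by rewrite big_distrr.
by rewrite (_ : m * (8 * g) = 8 * (m * g)); [lia | ring].
Qed.

Lemma dp_upper v : v <= pNV P ->
  dp P AR C v (jx (v * w2)) <= 606 * cost 0 (v * w2) + 212 * (v * (m * g)).
Proof.
elim: v => [|v IH] lev //; apply: leq_trans (dp_step lev) _.
have := IH (ltnW lev); have -> : cost 0 (v.+1 * w2) = cost 0 (v * w2) + cW v.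
  by rewrite /segment_cost !add0n mulSnr [LHS](@big_cat_nat _ _ _ (v * w2)) //= leq_addr.
by rewrite mulSn; lia.
Qed.

(** The answer is read on the central column; the move there from the end of the path is paid by the
    final drift in [c0] and by [2 * g]. *)
Lemma outcome_upper : out <= 606 * c0 + 212 * (pNK P * g) + 2 * g + (n - N).
Proof.
rewrite (out_value oc) leq_add2r.
case E : (pNV P) => [|v]; first by [].
rewrite -E; have := dp_upper (leqnn (pNV P)); rewrite (mulnA (pNV P)) -/(pNK P) => hdp.
have [P0 _ PN sumd] := pr.
have [j1 j2 j3] := jx_bounds (leqnn N).
have [e1 _ _] := off_bounds (leqnn N).
have lip : dp P AR C (pNV P) (pG P) <= dp P AR C (pNV P) (jx N) + 2 * g * (pG P - jx N + (jx N - pG P)).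
  by rewrite {1 2}E; apply: relax_lipschitz => //; lia.
apply: leq_trans lip _; move: sumd; rewrite -[\sum_(0 <= _ < _) _]/(cost 0 N) => sumd.
have eg : (pG P - jx N + (jx N - pG P)) * g <= (Y0 + N - pos N) + g.
  by rewrite mulnDl !mulnBl Gd; move: PN; rewrite e1 Y0E; lia.
by rewrite -[2 * g * _]mulnA [g * (_ + _)]mulnC; lia.
Qed.

End Approximation.

(** * Random bits *)

(** Coins as plain lists, which can be cut into the parts read by pivots, samples and the rest. *)
Fixpoint bitseqs T : seq (seq bool) :=
  if T is T'.+1 then map (cons false) (bitseqs T') ++ map (cons true) (bitseqs T')
  else [:: [::]].

Lemma size_bitseqs T : size (bitseqs T) = 2 ^ T.
Proof. by elim: T => //= T IH; rewrite size_cat !size_map IH expnS mul2n addnn. Qed.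

Lemma mem_bitseqs T s : (s \in bitseqs T) = (size s == T).
Proof.
elim: T s => [|T IH] [|x s] //=.
  by rewrite mem_cat; apply/negP => /orP[] /mapP[].
rewrite mem_cat eqSS -IH; apply/orP/idP => [[] /mapP[s' hs [_ ->]] //|hs].
by case: x; [right | left]; rewrite map_f.
Qed.

Lemma bitseqs_uniq T : uniq (bitseqs T).
Proof.
elim: T => //= T IH; rewrite cat_uniq !map_inj_uniq ?IH //=; try by move=> ? ? [].
by rewrite andbT; apply/hasPn => _ /mapP[s _ ->]; apply/negP => /mapP[].
Qed.

Lemma card_bitseqs T (E : pred (seq bool)) :
  #|[pred r : T.-tuple bool | E r]| = count E (bitseqs T).
Proof.
rewrite cardE /enum_mem size_filter -(@count_map _ _ (@tval T bool) E) /=.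
apply/permP: E; rewrite uniq_perm ?bitseqs_uniq //.
  by rewrite map_inj_uniq -?enumT ?enum_uniq //; exact: val_inj.
move=> s; rewrite mem_bitseqs; apply/mapP/idP => [[r _ ->]|/eqP hs].
  by rewrite size_tuple.
by exists (tcast hs (in_tuple s)); [rewrite -enumT mem_enum | rewrite val_tcast].
Qed.

Lemma count_bitseqs_add p r (E : pred (seq bool)) : count E (bitseqs (p + r)) =
  \sum_(u <- bitseqs p) count (fun v => E (u ++ v)) (bitseqs r).
Proof.
elim: p E => [|p IH] E; first by rewrite /= big_seq1.
rewrite addSn [bitseqs _.+1]/= count_cat !count_map !IH [in RHS]/= big_cat !big_map /=.
by [].
Qed.

Definition bits_num (s : seq bool) := foldl (fun r (x : bool) => 2 * r + x) 0 s.

Lemma map_bits_num q : map bits_num (bitseqs q) = iota 0 (2 ^ q).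
Proof.
suff h r : map (foldl (fun r (x : bool) => 2 * r + x) r) (bitseqs q) = iota (r * 2 ^ q) (2 ^ q).
  by rewrite (h 0) mul0n.
elim: q r => [|q IH] r; first by rewrite /= muln1.
rewrite /= map_cat -!map_comp.
rewrite (eq_map (_ : _ \o _ =1 foldl (fun r (x : bool) => 2 * r + x) (2 * r + 0))) //.
rewrite [in X in _ ++ X](eq_map (_ : _ \o _ =1 foldl (fun r (x : bool) => 2 * r + x) (2 * r + 1))) //.
rewrite !IH expnS [2 * 2 ^ q]mul2n -addnn iotaD; congr (_ ++ _); congr (iota _ _); ring.
Qed.

Lemma eq_in_foldl_nth (f g : nat -> bool) z l : {in l, f =1 g} ->
  foldl (fun r i => 2 * r + f i) z l = foldl (fun r i => 2 * r + g i) z l.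
Proof.
elim: l z => //= i l IH z h; rewrite h ?mem_head // IH // => j hj.
by apply: h; rewrite in_cons hj orbT.
Qed.

Lemma rand_cat q p s u : size p = u * q -> size s = q -> forall rest,
  rand q (p ++ s ++ rest) u = bits_num s.
Proof.
move=> szp szs rest; rewrite /rand /bits_num -[in RHS](mkseq_nth false s) szs /mkseq.
have fm (f : nat -> bool -> nat) (h : nat -> bool) z l :
    foldl f z (map h l) = foldl (fun r i => f r (h i)) z l by elim: l z => /=.
rewrite fm; apply: eq_in_foldl_nth => i; rewrite mem_iota /= => lti.
by rewrite nth_cat szp ltnNge leq_addr /= addKn nth_cat szs lti.
Qed.

Lemma rand_prefix q p c u K : size p = K * q -> u < K -> rand q (p ++ c) u = rand q p u.
Proof.
move=> szp ltu; apply: eq_in_foldl_nth => i; rewrite mem_iota /= => lti.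
by rewrite nth_cat szp flat_lt.
Qed.

(** The prefix [p] holds coins already spent: none for the pivots, those of the pivots for the
    samples. Each further number reads [q] fresh coins. *)
Lemma count_avoid q (S : pred nat) K r p u0 : size p = u0 * q ->
  count (fun c => all (fun u => ~~ S (rand q (p ++ c) (u0 + u))) (iota 0 K)) (bitseqs (K * q + r)) =
  count (predC S) (iota 0 (2 ^ q)) ^ K * 2 ^ r.
Proof.
elim: K p u0 => [|K IH] p u0 szp.
  by rewrite mul0n add0n expn0 mul1n -size_bitseqs (eq_count (a2 := predT)) ?count_predT.
rewrite mulSn -addnA count_bitseqs_add.
have step s : s \in bitseqs q ->
    count (fun v => all (fun u => ~~ S (rand q (p ++ s ++ v) (u0 + u))) (iota 0 K.+1)) (bitseqs (K * q + r)) =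
    ~~ S (bits_num s) * (count (predC S) (iota 0 (2 ^ q)) ^ K * 2 ^ r).
  rewrite mem_bitseqs => /eqP szs.
  have szps : size (p ++ s) = u0.+1 * q by rewrite size_cat szp szs mulSn addnC.
  rewrite -(IH _ _ szps).
  case hS : (S (bits_num s)) => /=.
    rewrite mul0n (eq_count (a2 := pred0)) ?count_pred0 // => v /=.
    by rewrite addn0 (rand_cat szp szs) hS.
  rewrite mul1n; apply: eq_count => v /=; rewrite addn0 (rand_cat szp szs) hS /=.
  rewrite (iotaDl 1 0 K) all_map; apply: eq_all => u /=.
  by rewrite -catA addnA addn1.
rewrite big_seq (eq_bigr (fun s => ~~ S (bits_num s) * (count (predC S) (iota 0 (2 ^ q)) ^ K * 2 ^ r)));
  last by move=> s hs; exact: step.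
rewrite -big_seq -big_distrl /= expnS mulnA; congr (_ * _ * _).
rewrite -map_bits_num count_map -sum1_count [RHS]big_mkcond /=; apply: eq_bigr => s _.
by case: (S _).
Qed.

(** (1 - 1/M)^M is at most 1/2, from the first two terms of the binomial expansion. *)
Lemma pow_half M : 0 < M -> 2 * M.-1 ^ M <= M ^ M.
Proof.
case: M => // -[//|M] _; rewrite /=.
have bern x k : k * x ^ k.-1 + x ^ k <= x.+1 ^ k.
  elim: k => // k IH; rewrite /= [x.+1 ^ _]expnS.
  have h : x.+1 * (k * x ^ k.-1 + x ^ k) <= x.+1 * x.+1 ^ k by rewrite leq_mul2l IH orbT.
  apply: leq_trans h; case: k {IH} => [|k] /=; first by rewrite !expn0 !expn1; lia.
  rewrite !expnS; move: (x ^ k) => y; nia.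
apply: leq_trans (bern M.+1 M.+2); rewrite /= [M.+1 ^ M.+2]expnS.
by move: (M.+1 ^ M.+1) => y; lia.
Qed.

(** Six draws that each fail with probability at most 7/8 at least halve the failure, as 2 * 7^6 <
    8^6. *)
Lemma seven_eighths L : 2 ^ L * 7 ^ (6 * L) <= 8 ^ (6 * L).
Proof.
case: L => [|L]; first by rewrite muln0 !expn0.
rewrite !(expnM _ 6) -expnMn leq_exp2r //; vm_compute; reflexivity.
Qed.

(** Remainders are not quite uniform, but the complete periods fill more than half of the range, so
    a quarter of good entries leaves at least an eighth of good draws. *)
Lemma count_mod_nth (S : pred nat) F Q : 0 < size F <= Q ->
  size F <= 4 * count S F -> Q <= 8 * count (fun r => S (nth 0 F (r %% size F))) (iota 0 Q).
Proof.
move=> /andP[f0 fQ] hG; set f := size F in f0 fQ hG *.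
have blocks x : count (fun r => S (nth 0 F (r %% f))) (iota 0 (x * f)) = x * count S F.
  elim: x => // x IH; rewrite mulSnr iotaD count_cat IH mulSnr add0n; congr (_ + _).
  rewrite -[x * f]addn0 iotaDl count_map -[in RHS](mkseq_nth 0 F) /mkseq count_map.
  apply: eq_in_count => i; rewrite mem_iota /= => lti.
  by rewrite modnMDl modn_small.
have le : count (fun r => S (nth 0 F (r %% f))) (iota 0 (Q %/ f * f)) <=
    count (fun r => S (nth 0 F (r %% f))) (iota 0 Q).
  rewrite [in iota 0 Q](divn_eq Q f) iotaD count_cat; exact: leq_addr.
apply: leq_trans (_ : 8 * (Q %/ f * count S F) <= _); last by rewrite leq_mul2l -blocks le.
have q0 : 0 < Q %/ f by rewrite divn_gt0.
have h1 : Q %/ f * f <= Q %/ f * (4 * count S F) by rewrite leq_mul2l hG orbT.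
have h2 : f <= Q %/ f * f by rewrite leq_pmull.
have := divn_eq Q f; have := ltn_pmod Q f0.
by rewrite (mulnCA _ 4) in h1; lia.
Qed.

Lemma count_has_le (I : eqType) (T : Type) (E : I -> pred T) (ps : seq I) (l : seq T) B :
  (forall p, p \in ps -> count (E p) l <= B) ->
  count (fun c => has (fun p => E p c) ps) l <= size ps * B.
Proof.
elim: ps => [|p ps IH] h; first by rewrite (eq_count (a2 := pred0)) ?count_pred0.
have {}IH := IH (fun p' hp => h p' (mem_behead (s := p :: ps) hp)).
have hp := h p (mem_head _ _).
have := count_predUI (E p) (fun c => has (fun p => E p c) ps) l.
rewrite (eq_count (a2 := fun c => has (fun p => E p c) (p :: ps))) //= mulSn.
by lia.
Qed.

Lemma best_ext P t R R' U k : (forall u, u < U -> R u = R' u) ->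
  best P t R U k = best P t R' U k.
Proof.
elim: U => //= U IH e; rewrite e // IH // => u ltu; apply: e; lia.
Qed.

(** * Probability of the bad events *)

Section BadEvents.
Variables (n tau : nat) (t d : nat -> nat) (r : nat).
Hypothesis rg : regime n tau.
Local Notation P := (mkparams n tau).
Local Notation q := (pa P + 3).
Local Notation w1 := (pw1 P).
Local Notation w2 := (pw2 P).
Local Notation K1 := (pK1 P).
Local Notation L := (pL P).
Local Notation level l := (pg P * 2 ^ l).
Local Notation T := (K1 * q + (L * q + r)).

Definition run_best c k := best P t (rand q c) K1 k.
Definition run_far c v s := [seq k <- iota (v * pm P) (pm P) | 51 * s < run_best c k].
Definition cheap s k := segment_cost d (k * w1) w1 <= s.

Definition missed (kl : nat * nat) (c : seq bool) :=
  (w2 <= size (hits P t kl.1 (17 * level kl.2))) &&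
  all (fun u => rand q c u \notin hits P t kl.1 (17 * level kl.2)) (iota 0 K1).

Definition unlucky (vl : nat * nat) (c : seq bool) :=
  let s := level vl.2 in let F := run_far c vl.1 s in
  [&& 0 < size F, size F <= 4 * count (cheap s) F &
      all (fun u => ~~ cheap s (nth 0 F (rand q c (K1 + u) %% size F))) (iota 0 L)].

(** [w2] of the values are hits, a fraction 1/M; so M draws all miss with probability at most 1/2,
    and M L draws with at most 2^-L. *)
Lemma Q_def : exists2 M, 0 < M & pQ P = M * w2 /\ K1 = M * L.
Proof.
have [_ _ h1 h2] := regime_logs rg; rewrite (mkparams_w2 rg) /pQ /=.
set a := trunc_log 2 n in h1 h2 *; set b := trunc_log 2 tau in h1 h2 *.
have le : (2 * a + b) %/ 7 + 9 <= a + 3 by lia.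
exists (2 ^ (a + 3) %/ 2 ^ ((2 * a + b) %/ 7 + 9)); last by rewrite divnK // dvdn_exp2l.
by rewrite divn_gt0 ?expn_gt0 // leq_exp2l.
Qed.

Lemma L_gt0 : 0 < L.
Proof. by rewrite muln_gt0 addn1. Qed.

Lemma pow2_T : 2 ^ T = pQ P ^ K1 * (pQ P ^ L * 2 ^ r).
Proof. by rewrite /pQ -!expnM -!expnD (mulnC K1) (mulnC L). Qed.

Lemma missed_count kl : 2 ^ L * count (missed kl) (bitseqs T) <= 2 ^ T.
Proof.
rewrite /missed; set S := hits _ _ _ _.
case: (leqP w2 (size S)) => hs /=; last by rewrite (eq_count (a2 := pred0)) ?count_pred0 ?muln0.
have := @count_avoid q (mem S) K1 (L * q + r) [::] 0 erefl.
rewrite (eq_count (a2 := fun c => all (fun u => rand q c u \notin S) (iota 0 K1))) // => ->.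
have [M M0 [eQ eK]] := Q_def.
have cS : count (predC (mem S)) (iota 0 (2 ^ q)) <= M.-1 * w2.
  have := count_predC (mem S) (iota 0 (2 ^ q)); rewrite size_iota -/(pQ P) eQ.
  have -> : count (mem S) (iota 0 (M * w2)) = size S.
    rewrite /S size_filter -eQ; apply: eq_in_count => x hx.
    by rewrite [in LHS]/= mem_filter hx andbT.
  by rewrite -subn1 mulnBl; lia.
rewrite -/(pQ P) in cS *.
have -> : 2 ^ (L * q + r) = pQ P ^ L * 2 ^ r by rewrite /pQ -expnM -expnD mulnC.
rewrite pow2_T mulnA leq_mul2r; apply/orP; right.
apply: leq_trans (_ : 2 ^ L * (M.-1 * w2) ^ K1 <= _).
  rewrite leq_mul2l; apply/orP; right; case: (posnP K1) => [->//|K0].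
  by rewrite leq_exp2r.
rewrite eQ !expnMn mulnA leq_mul2r; apply/orP; right.
rewrite eK !(expnM _ M) -expnMn leq_exp2r ?pow_half //; exact: L_gt0.
Qed.

(** Condition on the coins [p] of the pivots. They determine the list of far blocks, while the
    samples are fresh and each is cheap with probability at least 1/8. *)
Lemma unlucky_count vl : 2 ^ (10 * (pa P + 1)) * count (unlucky vl) (bitseqs T) <= 2 ^ T.
Proof.
set s := level vl.2; have eL : L = 6 * (10 * (pa P + 1)) by rewrite /=; lia.
rewrite count_bitseqs_add pow2_T big_distrr /=.
have step p : p \in bitseqs (K1 * q) ->
   2 ^ (10 * (pa P + 1)) * count (fun c => unlucky vl (p ++ c)) (bitseqs (L * q + r)) <= pQ P ^ L * 2 ^ r.
  rewrite mem_bitseqs => /eqP szp; set F := run_far p vl.1 s.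
  have eF c : run_far (p ++ c) vl.1 s = F.
    apply: eq_filter => k; rewrite /run_best; congr (_ < _); apply: best_ext => u ltu.
    exact: rand_prefix szp ltu.
  have eU c : unlucky vl (p ++ c) = [&& 0 < size F, size F <= 4 * count (cheap s) F &
      all (fun u => ~~ cheap s (nth 0 F (rand q (p ++ c) (K1 + u) %% size F))) (iota 0 L)].
    by rewrite /unlucky eF.
  rewrite (eq_count eU).
  case: (posnP (size F)) => [_|F0]; first by rewrite (eq_count (a2 := pred0)) ?count_pred0 ?muln0.
  case: (leqP (size F) (4 * count (cheap s) F)) => hF /=; last by rewrite (eq_count (a2 := pred0)) ?count_pred0 ?muln0.
  pose S := fun x => cheap s (nth 0 F (x %% size F)).
  have := @count_avoid q S L r p K1 szp.
  rewrite /S => ->.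
  have FQ : 0 < size F <= pQ P.
    rewrite F0; apply: leq_trans (_ : pm P <= _).
      by rewrite size_filter -[leqRHS](size_iota (vl.1 * pm P) (pm P)) count_size.
    have wP := mkparams_wf rg; have h1 := w2_le wP; have h2 := Q_ge wP; have h3 := w1_gt0 wP.
    have : pm P <= pw2 P by rewrite /pw2 leq_pmulr.
    by clear - h1 h2; lia.
  have h8 := count_mod_nth FQ hF.
  have := count_predC S (iota 0 (2 ^ q)); rewrite size_iota -/(pQ P) => eS.
  have {h8 eS} fail : 8 * count (predC S) (iota 0 (pQ P)) <= 7 * pQ P.
    by move: h8 eS; rewrite -/(S _); set A := count _ _; set B := count _ _; lia.
  rewrite mulnA leq_mul2r; apply/orP; right.
  rewrite -(leq_pmul2l (_ : 0 < 8 ^ L)) ?expn_gt0 // mulnCA -expnMn.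
  apply: leq_trans (_ : 2 ^ (10 * (pa P + 1)) * (7 * pQ P) ^ L <= _).
    by rewrite leq_mul2l leq_exp2r ?fail ?orbT //; exact: L_gt0.
  rewrite expnMn mulnA leq_mul2r; apply/orP; right.
  rewrite eL; exact: seven_eighths.
apply: leq_trans (_ : \sum_(p <- bitseqs (K1 * q)) pQ P ^ L * 2 ^ r <= _).
  by rewrite big_seq [leqRHS]big_seq; apply: leq_sum => p /step.
by rewrite big_const_seq count_predT iter_addn_0 size_bitseqs mulnC (mulnC K1) expnM.
Qed.

Definition bad (c : seq bool) :=
  has (missed^~ c) (allpairs pair (iota 0 (pNK P)) (iota 0 (plev P))) ||
  has (unlucky^~ c) (allpairs pair (iota 0 (pNV P)) (iota 0 (plev P))).

(** There are at most 2^(3 (a + 1)) events, and [n ^ 7] is at most 2^(7 (a + 1)); this is why 60 = 6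
    * 10 samples per logarithm are drawn. *)
Lemma bad_count : count bad (bitseqs T) * n ^ 7 <= 2 ^ T.
Proof.
have [/andP[a1 a2] _ h1 h2] := regime_logs rg.
rewrite -[trunc_log 2 n]/(pa P) -[trunc_log 2 tau]/(pb P) in a1 a2 h1 h2.
set D := 2 ^ T %/ 2 ^ (10 * (pa P + 1)).
have X0 : 0 < 2 ^ (10 * (pa P + 1)) by rewrite expn_gt0.
have leD x : 2 ^ (10 * (pa P + 1)) * x <= 2 ^ T -> x <= D by rewrite /D leq_divRL // mulnC.
have c1 : count (fun c => has (missed^~ c) (allpairs pair (iota 0 (pNK P)) (iota 0 (plev P)))) (bitseqs T)
    <= pNK P * plev P * D.
  rewrite -[in leqRHS](size_iota 0 (pNK P)) -[plev P in leqRHS](size_iota 0 (plev P)) -(size_allpairs pair).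
  apply: count_has_le => kl _; apply: leD; apply: leq_trans (missed_count kl).
  by rewrite leq_mul2r leq_exp2l // -[pL P]/(60 * (pa P + 1)); apply/orP; right; lia.
have c2 : count (fun c => has (unlucky^~ c) (allpairs pair (iota 0 (pNV P)) (iota 0 (plev P)))) (bitseqs T)
    <= pNV P * plev P * D.
  rewrite -[in leqRHS](size_iota 0 (pNV P)) -[plev P in leqRHS](size_iota 0 (plev P)) -(size_allpairs pair).
  by apply: count_has_le => vl _; apply: leD; exact: unlucky_count.
have c3 : count bad (bitseqs T) <= (pNK P + pNV P) * plev P * D.
  rewrite mulnDl mulnDl; apply: leq_trans (leq_add c1 c2).
  by rewrite -count_predUI leq_addr.
have wP := mkparams_wf rg.
have NVK : pNV P <= pNK P by rewrite /pNK leq_pmulr // m_gt0.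
have NKn : pNK P <= n.
  by apply: leq_trans (N_le wP); rewrite /pw2 mulnA leq_pmulr // w1_gt0.
have lev2 : plev P <= 2 ^ (pa P).+1.
  apply: leq_trans (_ : (pa P).+1 <= _); last exact: ltnW (ltn_expl _ _).
  by rewrite -[plev P]/(8 + pa P - pb P); lia.
apply: leq_trans (leq_mul c3 (leqnn _)) _.
have DX : D * 2 ^ (10 * (pa P + 1)) <= 2 ^ T by exact: leq_divM.
apply: leq_trans DX; rewrite mulnAC [D * _]mulnC leq_mul2r; apply/orP; right.
rewrite (_ : 10 * (pa P + 1) = (pa P).+1 + (pa P).+1 + (pa P).+1 + (pa P).+1 * 7); last by lia.
rewrite !expnD expnM; apply: leq_mul; last by rewrite leq_exp2r // ltnW.
apply: leq_mul lev2.
apply: leq_trans (_ : 2 * 2 ^ (pa P).+1 <= _).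
  by rewrite mul2n -addnn leq_add //; apply: ltnW; [|apply: leq_ltn_trans NVK _];
    apply: leq_ltn_trans NKn a2.
by apply: leq_mul => //; rewrite -[X in X <= _](expn1 2) leq_exp2l.
Qed.

End BadEvents.

(** With [2 ^ plev] about 256 n / tau, the rounding errors [g] of all blocks add up to at most tau /
    128, and the top level still reaches [w1]. The identity between [w1] and [g] uses that the
    exponent of [g] is not truncated, which is where 4 a <= 5 b + 5 matters. *)
Lemma mkparams_ineqs n tau (P := mkparams n tau) : regime n tau ->
  [/\ 2 * pw1 P <= pH P, pw1 P = pg P * 2 ^ plev P, 64 * pw2 P <= tau,
      128 * (pNK P * pg P) <= tau & pg P <= pw2 P] /\ 4 * tau <= pH P.
Proof.
move=> rg; have wP := mkparams_wf rg; have ew2 := mkparams_w2 rg.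
have [/andP[a1 a2] /andP[b1 b2] h1 h2] := regime_logs rg.
have ew1 : pw1 P = 2 ^ ((3 * trunc_log 2 n - 2 * trunc_log 2 tau) %/ 7 + 9) by [].
have eg : pg P = 2 ^ ((3 * trunc_log 2 n - 2 * trunc_log 2 tau) %/ 7 + 1 - (trunc_log 2 n - trunc_log 2 tau)) by [].
have eH : pH P = 2 ^ (trunc_log 2 tau + 3) by [].
have el : plev P = 8 + trunc_log 2 n - trunc_log 2 tau by [].
rewrite -/P in ew2.
set a := trunc_log 2 n in a1 a2 h1 h2 ew1 eg eH el ew2.
set b := trunc_log 2 tau in b1 b2 h1 h2 ew1 eg eH el ew2.
have w1E : pw1 P = pg P * 2 ^ plev P by rewrite ew1 eg el -expnD; congr (2 ^ _); lia.
have gw : pg P <= pw2 P by rewrite eg ew2 leq_exp2l //; lia.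
have w2t : 64 * pw2 P <= tau.
  by apply: leq_trans b1; rewrite ew2 -[64]/(2 ^ 6) -expnD leq_exp2l //; lia.
split; last by rewrite eH expnD mulnC -[2 ^ 3]/8; rewrite expnS in b2; lia.
split=> //; first by rewrite ew1 eH -expnS leq_exp2l //; lia.
have h : pNK P * pg P * 2 ^ plev P < 2 ^ a.+1.
  rewrite -mulnA -w1E; apply: leq_ltn_trans a2; apply: leq_trans (N_le wP).
  by rewrite /pNK /pw2 mulnA.
apply: leq_trans b1; apply: ltnW.
rewrite -(ltn_pmul2r (_ : 0 < 2 ^ a.+1)) ?expn_gt0 // -expnD.
rewrite (_ : b + a.+1 = a.+1 + b) ?(expnD 2 a.+1); last by lia.
apply: leq_ltn_trans (_ : _ <= pNK P * pg P * 2 ^ plev P * 2 ^ b) _; last by rewrite ltn_pmul2r // expn_gt0.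
rewrite [128 * _]mulnC -!mulnA !leq_mul2l -expnD -[128]/(2 ^ 7) -expnD leq_exp2l // el.
by apply/orP; right; apply/orP; right; lia.
Qed.

Lemma good_outcome n tau inp c AR C out c0 pos d (P := mkparams n tau) : regime n tau ->
  outcome P inp c AR C out ->
  profile (text P inp) (pX0 P) (pY0 P) (pNV P * pw2 P) c0 pos d -> c0 <= tau + 2 * pw2 P ->
  ~~ bad n tau (text P inp) d c -> out <= 840 * tau.
Proof.
move=> rg oc pr hc0 nbad; have wP := mkparams_wf rg.
have [[w1H w1lev w2t NKg gw2] tH] := mkparams_ineqs rg; rewrite -/P in w1H w1lev w2t NKg gw2 tH.
move: nbad; rewrite /bad negb_or => /andP[/hasPn nmiss /hasPn nlucky].
have mem_pair (A B : nat) k l : k < A -> l < B -> (k, l) \in allpairs pair (iota 0 A) (iota 0 B).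
  by move=> hk hl; apply/allpairsP; exists (k, l); rewrite !mem_iota.
have w1lev' : pw1 P <= 51 * (pg P * 2 ^ plev P) by rewrite -w1lev leq_pmull.
have hit k l : k < pNK P -> l < plev P -> pw2 P <= size (hits P (AR 0) k (17 * (pg P * 2 ^ l))) ->
    exists2 u, u < pK1 P & AR 1 u \in hits P (AR 0) k (17 * (pg P * 2 ^ l)).
  move=> ltk ltl; rewrite (out_text oc) => hs.
  have /nmiss : (k, l) \in allpairs pair (iota 0 (pNK P)) (iota 0 (plev P)) by exact: mem_pair.
  rewrite /missed /= hs /= => /allPn[u]; rewrite mem_iota add0n negbK => ltu hu.
  exists u => //; rewrite (out_rand oc) //; exact: ltn_addr.
have farE v s : v < pNV P -> far P AR v s = run_far n tau (text P inp) c v s.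
  move=> ltv; apply: eq_in_filter => k; rewrite mem_iota => /andP[k1 k2].
  rewrite (out_best oc) // -(subnKC k1); apply: flat_lt => //.
  by rewrite ltn_subLR.
have lucky v l : v < pNV P -> l < plev P -> 0 < size (far P AR v (pg P * 2 ^ l)) ->
    size (far P AR v (pg P * 2 ^ l)) <= 4 * count (fun k => segment_cost d (k * pw1 P) (pw1 P) <= pg P * 2 ^ l)
       (far P AR v (pg P * 2 ^ l)) ->
    exists2 u, u < pL P & segment_cost d (chosen P AR v (pg P * 2 ^ l) u * pw1 P) (pw1 P) <= pg P * 2 ^ l.
  move=> ltv ltl; rewrite /chosen farE // => s0 s4.
  have /nlucky : (v, l) \in allpairs pair (iota 0 (pNV P)) (iota 0 (plev P)) by exact: mem_pair.
  rewrite /unlucky /= s0 s4 /= => /allPn[u]; rewrite mem_iota add0n negbK => ltu hu.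
  by exists u => //; rewrite (out_rand oc) // ltn_add2l.
have hc : 2 * c0 <= pH P.
  by move: tH w2t hc0; move: (pH P) (pw2 P); clear; lia.
have pr' : profile (AR 0) (pX0 P) (pY0 P) (pNV P * pw2 P) c0 pos d by rewrite (out_text oc).
have := outcome_upper wP w1H oc w1lev' pr' hc hit lucky; rewrite -/P.
have Nn : pn P < pNV P * pw2 P + pw2 P.
  have -> : pNV P = n %/ pw2 P by rewrite (mkparams_w2 rg).
  rewrite -[pn P]/n {1}(divn_eq n (pw2 P)) ltn_add2l ltn_pmod //.
  by rewrite /pw2 muln_gt0 (m_gt0 wP) (w1_gt0 wP).
(* 606 (tau + 2 w2) + 212 tau / 128 + 2 g + w2 is below 627 tau, as g <= w2 <= tau / 64. *)
move: Nn; move: (pNV P * pw2 P) (pNK P * pg P) (pw2 P) (pg P) (pn P) w2t NKg gw2 hc0 => N Z w2 g nn.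
by clear; lia.
Qed.

(** * The algorithm on the word RAM *)

Section Machine.
Variables (n tau w : nat).
Hypotheses (n0 : 0 < n) (t0 : 0 < tau) (tn : tau <= n) (nt : n ^ 4 <= tau.+1 ^ 5).
Hypothesis wn : n.+1 ^ 20 <= 2 ^ w.

Definition Pmain : prog := PIf ($0 < #840 * $1 + #1) Pskip Pbig.

(** Register 2 is the base of the arrays and closed to for-programs, so it is set before. *)
Definition gap_ub : cmd := Seq (Assign 2 (Bin OpAdd (Reg 0) (Reg 0))) (compile Pmain).

Definition Tmain := if n <= 840 * tau then 10 else Tbig (mkparams n tau) + 10.

Lemma word_large : 840 * n + 100 <= 2 ^ w.
Proof.
apply: leq_trans wn; rewrite (expnD _ 19 1) expn1.
apply: leq_trans (_ : 2 ^ 10 * n.+1 <= _); first by rewrite -[2 ^ 10]/1024; lia.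
rewrite leq_mul2r; apply/orP; right; apply: leq_trans (_ : 2 ^ 19 <= _); first by rewrite leq_exp2l.
by rewrite leq_exp2r.
Qed.

Definition start (inp : nat -> nat) (c : seq bool) : astate :=
  AState (fun i => if i == 2 then 2 * n else nth 0 [:: n; tau] i) (fun _ _ => 0) inp c.

Lemma Pmain_spec inp c : wp w (2 * n) Pmain (start inp c) (Tmain - 2) (fun s' =>
  if n <= 840 * tau then areg s' 0 = n else
  exists AR C, outcome (mkparams n tau) inp c AR C (areg s' 0)).
Proof.
have wl := word_large; rewrite /Tmain.
apply: (@wp_if _ _ _ _ _ _ _ (if n <= 840 * tau then 7 else Tbig (mkparams n tau))).
- by rewrite /=; safe_split; lia.
- by case: ifP => _; [| lia].
- move=> hn; have le : n <= 840 * tau by move: hn; rewrite /=; lia.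
  by rewrite le; apply: wp_set => //=; lia.
- move=> hn; have lt : 840 * tau < n by move: hn; rewrite /=; lia.
  rewrite leqNgt lt /=.
  have rg : regime n tau by [].
  have [/andP[a1 _] _ h1 h2] := regime_logs rg.
  have wX : 2 * n + 16 * pX (mkparams n tau) + 32 < 2 ^ w.
    have Xn : pX (mkparams n tau) <= n ^ 4 by rewrite /= mulnC expnM leq_exp2r.
    apply: leq_trans wn; apply: leq_trans (_ : n.+1 ^ 5 <= _); last by rewrite leq_exp2l.
    apply: leq_trans (_ : n.+1 * n ^ 4 <= _); last by rewrite (expnS n.+1 4) leq_mul2l leq_exp2r // leqnSn orbT.
    have n4 : n <= n ^ 4 by rewrite -[X in X <= _]expn1 leq_exp2l //; lia.
    rewrite mulSn; have : 100 * n ^ 4 <= n * n ^ 4 by rewrite leq_mul2r; lia.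
    by move: (n ^ 4) (pX _) Xn n4 => N4 X; lia.
  apply: (wp_conseq (Pbig_spec rg wX (s := start inp c) _ _ _ _ _)) => //.
  by move=> i hi; rewrite /= ifF ?nth_default //=; lia.
Qed.

End Machine.

Lemma output_comp p w b T f g r (c1 : state) m : m + 2 <= T ->
  (f 0 + f 0) %% 2 ^ w = b ->
  (forall k T, run w (m + T) (compile p :: k) (State (upd f 2 b) g r) = run w T k c1) ->
  output (Seq (Assign 2 (Bin OpAdd (Reg 0) (Reg 0))) (compile p)) w T (State f g r) = Some (reg c1 0).
Proof.
move=> leT eb hrun; rewrite (_ : T = (m + (T - 2 - m)).+2); last by lia.
rewrite /output -[run _ _ _ _]/(run w (m + (T - 2 - m)) [:: compile p]
  (State (upd f 2 ((f 0 + f 0) %% 2 ^ w)) g r)) eb hrun.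
by case: (T - 2 - m).
Qed.

Section Discrete.
Variables (n tau w : nat).
Hypotheses (n0 : 0 < n) (t0 : 0 < tau) (tn : tau <= n) (nt : n ^ 4 <= tau.+1 ^ 5).
Hypothesis wn : n.+1 ^ 20 <= 2 ^ w.
Variables (Sigma : Type) (enc : Sigma -> nat) (x y : n.-tuple Sigma).
Hypothesis enc_inj : injective enc.

Let inp := nth 0 (map enc (x ++ y)).

Lemma gap_ub_run (r : seq bool) T : Tmain n tau <= T ->
  exists2 out, output gap_ub w T (input enc tau x y r) = Some out &
    if n <= 840 * tau then out = n else exists AR C, outcome (mkparams n tau) inp r AR C out.
Proof.
move=> leT; have wl := word_large n0 t0 tn nt wn.
have w16 : 16 < 2 ^ w by lia.
have wfm : wf Pmain by vm_compute.
have [sm tmle Qm] := Pmain_spec n0 t0 tn nt wn inp r.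
set s0 := start n tau inp r in sm tmle Qm.
pose c0 := State (upd (nth 0 [:: n; tau]) 2 (2 * n)) inp r.
have R0 : repr w (2 * n) s0 c0.
  split=> //.
  by move=> q z _ _; rewrite /= /inp nth_default // size_map size_cat !size_tuple; lia.
have [c1 [h1 _ _ _ _] hrun] := compile_correct w16 wfm sm R0.
exists (areg (den Pmain s0) 0).
  rewrite -h1 /input -/inp; apply: (output_comp _ _ hrun); last by rewrite /= addnn -mul2n modn_small //; lia.
  have T2 : 2 <= Tmain n tau by rewrite /Tmain; case: ifP => _; lia.
  by lia.
exact: Qm.
Qed.

Lemma window_text P l : pn P = n -> l <= n ->
  window (text P inp) (pX0 P) l = take l (map enc x) /\
  window (text P inp) (pX0 P + n) l = take l (map enc y).
Proof.
move=> en ln; split; apply: (@eq_from_nth _ 0);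
  rewrite ?size_mkseq ?size_takel ?size_map ?size_tuple // => i lti;
  rewrite nth_mkseq // nth_take // /text en /inp map_cat nth_cat size_map size_tuple.
  by rewrite ifT ?ifT; [rewrite addKn | lia | lia].
rewrite ifT; last by lia.
rewrite ifF; last by lia.
by congr nth; lia.
Qed.


Lemma edit_distance_lower P : pn P = n -> pNV P * pw2 P <= n ->
  edit_distance x y <= wdist (text P inp) (pX0 P) (pY0 P) (pNV P * pw2 P) + (n - pNV P * pw2 P).
Proof.
move=> en leN; rewrite -(edit_distance_map x y enc_inj).
have [ex ey] := window_text en (leqnn n); have {en} eY : pY0 P = pX0 P + n.
  by rewrite /pY0 en.
have mk (z : seq nat) : size z = n -> take n z = z by move=> <-; exact: take_size.
rewrite -(mk (map enc x)) ?size_map ?size_tuple // -ex -(mk (map enc y)) ?size_map ?size_tuple // -ey -eY.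
rewrite -/(wdist _ _ _ n) -{1}(subnKC leN); apply: leq_trans (wdistD _ _ _ _ _) _.
by rewrite leq_add2l wdist_size.
Qed.

(** Cutting the tail off each string costs at most its length; both tails are shorter than [w2] for
    the actual parameters. *)
Lemma edit_distance_upper P : pn P = n -> pNV P * pw2 P <= n ->
  wdist (text P inp) (pX0 P) (pY0 P) (pNV P * pw2 P) <= edit_distance x y + 2 * (n - pNV P * pw2 P).
Proof.
move=> en leN; rewrite -(edit_distance_map x y enc_inj).
have [ex ey] := window_text en leN; have {en} eY : pY0 P = pX0 P + n.
  by rewrite /pY0 en.
have pre (s : seq nat) : size s = n -> edit_distance (take (pNV P * pw2 P) s) s <= n - pNV P * pw2 P.
  move=> es; rewrite -{2}(cat_take_drop (pNV P * pw2 P) s) -{1}(cats0 (take _ s)).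
  apply: leq_trans (edit_distance_cat _ _ _ _) _; rewrite edit_distance_refl add0n -es -size_drop.
  elim: (drop _ s) => [|a l IH]; first by rewrite edit_distance_refl.
  apply: leq_trans (edit_distance_trans l _ _) _; rewrite /= -add1n addnC leq_add //.
  exact: edit_distance_le (EditsS (@Insertion _ [::] l a) (Edits0 _)).
rewrite /wdist eY ex ey.
apply: leq_trans (edit_distance_trans (map enc x) _ _) _.
have h1 := pre _ (etrans (size_map enc x) (size_tuple x)).
have h2 := pre _ (etrans (size_map enc y) (size_tuple y)).
have := edit_distance_trans (map enc y) (map enc x) (take (pNV P * pw2 P) (map enc y)).
rewrite [edit_distance (map enc y) (take _ _)]edit_distance_sym.
by lia.
Qed.

Lemma gap_ub_lower (r : seq bool) T : Tmain n tau <= T ->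
  exists2 out, output gap_ub w T (input enc tau x y r) = Some out & edit_distance x y <= out.
Proof.
move=> leT; have [out eo h] := gap_ub_run r leT; exists out => //; move: h.
case: leqP => [_ ->|ltn [AR [C oc]]].
  by apply: leq_trans (edit_distance_size _) _; rewrite !size_tuple.
have rg : regime n tau by [].
have wP := mkparams_wf rg; have [[w1H _ _ _ _] _] := mkparams_ineqs rg.
apply: leq_trans (edit_distance_lower _ (N_le wP)) _ => //.
apply: leq_trans (outcome_lower wP w1H oc).
by rewrite (out_text oc).
Qed.

Lemma gap_ub_upper : edit_distance x y <= tau -> exists2 B : pred (seq bool),
  count B (bitseqs (Tmain n tau)) * n ^ 7 <= 2 ^ Tmain n tau &
  forall r, ~~ B r -> exists2 out,
    output gap_ub w (Tmain n tau) (input enc tau x y r) = Some out & out <= 840 * tau.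
Proof.
move=> led; case: (leqP n (840 * tau)) => [le|lt].
  exists xpred0; first by rewrite count_pred0.
  move=> r _; have [out eo] := gap_ub_run r (leqnn _); rewrite le => e.
  by exists out => //; rewrite e.
have rg : regime n tau by [].
have wP := mkparams_wf rg; set P := mkparams n tau in wP.
(* The path, and with it the bad set, depends on the input alone. *)
have [pos [d pr]] := profile_exists (text P inp) (pX0 P) (pY0 P) (pNV P * pw2 P).
exists (bad n tau (text P inp) d).
  (* The time bound exceeds the number of coins read, so the coin sequence splits as [bad_count]
     requires. *)
  have [rest ->] : exists rest, Tmain n tau = pK1 P * (pa P + 3) + (pL P * (pa P + 3) + rest).
    exists (Tmain n tau - (pK1 P * (pa P + 3) + pL P * (pa P + 3))).
    rewrite addnA subnKC // /Tmain ifF; last by rewrite leqNgt lt.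
    rewrite /Tbig -mulnDl -/P.
    have : (pK1 P + pL P) * (pa P + 3) <= (pK1 P + pL P) * (10 + 6 * (pa P + 3)).
      by rewrite leq_mul2l; apply/orP; right; clear; lia.
    move: (10 + _ + _) (200 * _) (5 + 8 * _) (pNV P * _) => A B C D.
    by move: ((_ + _) * (_ + 3)) ((_ + _) * (10 + _)) => E F; clear; lia.
  exact: bad_count rg.
move=> r nb; have [out eo] := gap_ub_run r (leqnn _); rewrite leqNgt lt /= => -[AR [C oc]].
exists out => //; apply: (good_outcome rg oc pr _ nb).
apply: leq_trans (edit_distance_upper _ (N_le wP)) _ => //.
have NV : pNV P * pw2 P = n %/ pw2 P * pw2 P by rewrite (mkparams_w2 rg).
rewrite leq_add // leq_mul2l /= NV {1}(divn_eq n (pw2 P)) addKn ltnW // ltn_pmod //.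
by rewrite /pw2 muln_gt0 (m_gt0 wP) (w1_gt0 wP).
Qed.

End Discrete.

(** * Running time and probability *)

(** [A] stands for a logarithm and [Z] for the common bound of pivots times band, sampled bands,
    extensions, grid cells and pivots times blocks. *)
Lemma Tbig_le P A K Z : pL P = 60 * A -> pK1 P = K * pL P -> 0 < A -> pa P < A -> plev P <= 9 * A ->
  0 < pG P -> 0 < pm P -> 0 < pw1 P -> 0 < pH P ->
  pNV P * pw2 P <= pn P -> pn P <= Z -> K <= Z -> 0 < Z ->
  K * (pw1 P * pH P) <= Z -> pNV P * (pw1 P * pH P) <= Z -> pNV P * (pm P * (pw2 P * pw2 P)) <= Z ->
  pNK P * pG P <= Z -> K * pNK P <= Z -> Tbig P + 10 <= 4096 * (4096 * (A * A * Z)).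
Proof.
rewrite /Tbig /Twin /Tlevel /Tsample /pNK; set w2 := pw2 P.
have mw2 : 0 < pm P -> 0 < pw1 P -> pm P <= w2 by move=> m0 w0; rewrite leq_pmulr.
move: w2 mw2; move: (pL P) (pK1 P) (plev P) (pG P) (pm P) (pw1 P) (pH P) (pNV P) (pn P) (pa P).
move=> L K1 lev G m w1 H NV n a w2 mw2 -> -> A0 ltaA hlev G0 m0 w10 H0 Nn nZ KZ Z0 h1 h2 h3 h4 h5.
have {}mw2 := mw2 m0 w10; have w20 : 0 < w2 by apply: leq_trans mw2.
have a1 : K * H <= Z by apply: leq_trans h1; rewrite leq_mul2l leq_pmull ?orbT.
have a2 : NV * H <= Z by apply: leq_trans h2; rewrite leq_mul2l leq_pmull ?orbT.
have a3 : NV * (m * w2) <= Z by apply: leq_trans h3; rewrite !leq_mul2l leq_pmull ?orbT.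
have a4 : NV * m <= Z by apply: leq_trans h4; rewrite leq_pmulr.
have a5 : NV <= Z by apply: leq_trans a4; rewrite leq_pmulr.
have a6 : NV * G <= Z by apply: leq_trans h4; rewrite leq_mul2r leq_pmulr ?orbT.
have AZ : Z <= A * Z by rewrite leq_pmull.
have AAZ : A * Z <= A * A * Z by rewrite leq_mul2r leq_pmull ?orbT.
have b1 : NV * (100 * (w1.+1 * H) + 40 + 3600 * (m * (w2 * w2.+1)) + 10) <= 2 * (4000 * Z).
  by clear -a2 a3 a5 h2 h3; lia.
move: (100 * (w1.+1 * H) + _ + _) b1 => S b1.
have b2 : NV * (20 + 7 * m + 60 * A * (S + 10) + 6) <= 60 * (A * (2 * (4020 * Z))).
  have : A * (NV * (S + 10)) <= A * (2 * (4000 * Z)) by rewrite leq_mul2l b1 orbT.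
  by clear -AZ a5 a4; lia.
move: (20 + 7 * m + 60 * A * (S + 10)) b2 => L1 b2.
have b3 : NV * (lev * (L1 + 6)) <= 9 * (60 * (A * A * (2 * (4020 * Z)))).
  apply: leq_trans (_ : 9 * A * (60 * (A * (2 * (4020 * Z)))) <= _); last by clear; lia.
  by rewrite mulnCA leq_mul.
have b4 : NV * (100 * (2 * G).+1 + lev * (L1 + 6) + m * (30 * (2 * G).+1 + 3) + 30 + 3) <=
    9 * (60 * (A * A * (2 * (4020 * Z)))) + 600 * Z.
  by clear -b3 a6 h4 a4 a5; lia.
move: (100 * _ + _ + _ + 30) b4 => W b4.
have c1 : K * (60 * A) * (480 * (w1 * H) + 24 * (NV * m) + 60 + 240 * H) <= 60 * (A * (804 * Z)).
  have : A * (K * (480 * (w1 * H) + 24 * (NV * m) + 60 + 240 * H)) <= A * (804 * Z).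
    by rewrite leq_mul2l; apply/orP; right; clear -h1 h5 KZ a1; lia.
  by clear; lia.
move: (480 * _ + _ + _ + _) c1 => S1 c1.
have c2 : (K * (60 * A) + 60 * A) * (10 + 6 * (a + 3)) <= 120 * (A * Z) * (28 * A).
  apply: leq_mul; last by clear -ltaA; lia.
  have : A * K <= A * Z by rewrite leq_mul2l KZ orbT.
  have : A <= A * Z by rewrite leq_pmulr.
  by clear; lia.
by clear -c1 c2 b4 nZ a4 AZ AAZ Z0; lia.
Qed.

(** In exponents, pivots times band, extensions and grid cells all come to (8 a + 4 b) / 7 up to
    constants; pivots times blocks to (9 a + b) / 7, which is no more as a <= 3 b. The factor 2 ^ 30
    absorbs the roundings. *)
Lemma Tmain_le n tau (a := trunc_log 2 n) (b := trunc_log 2 tau) : 0 < n -> 0 < tau -> tau <= n ->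
  n ^ 4 <= tau.+1 ^ 5 ->
  exists2 E, 2 ^ (7 * E) <= n ^ 8 * tau ^ 4 & Tmain n tau <= 2 ^ 24 * (a.+1 ^ 2 * (2 ^ E * 2 ^ 30)).
Proof.
move=> n0 t0 tn nt; rewrite /Tmain; case: (leqP n (840 * tau)) => [le|lt].
  exists 0; first by rewrite muln_gt0 !expn_gt0 n0 t0.
  by apply: leq_trans (_ : 2 ^ 4 <= _).
have rg : regime n tau by [].
have wP := mkparams_wf rg; have ew2 := mkparams_w2 rg.
have [/andP[a1 a2] /andP[b1 b2] h1 h2] := regime_logs rg.
set P := mkparams n tau in wP ew2 *.
have eK : pK1 P = 2 ^ (a + 3) %/ pw2 P * pL P by rewrite ew2.
have ew1 : pw1 P = 2 ^ ((3 * a - 2 * b) %/ 7 + 9) by [].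
have eg : pg P = 2 ^ ((3 * a - 2 * b) %/ 7 + 1 - (a - b)) by [].
have eH : pH P = 2 ^ (b + 3) by [].
rewrite -/a -/b in ew2 a1 a2 b1 b2 h1 h2.
have [E eE] : exists E, E = (8 * a + 4 * b) %/ 7 by eexists.
have Edef : 7 * E <= 8 * a + 4 * b < 7 * E + 7 by rewrite eE; clear; lia.
have [u eu] : exists u, u = (3 * a - 2 * b) %/ 7 by eexists.
have udef : 7 * u <= 3 * a - 2 * b < 7 * u + 7 by rewrite eu; clear; lia.
have [v ev] : exists v, v = (2 * a + b) %/ 7 by eexists.
have vdef : 7 * v <= 2 * a + b < 7 * v + 7 by rewrite ev; clear; lia.
rewrite -eu in ew1 eg; rewrite -ev in ew2; clear eE eu ev.
exists E.
  apply: leq_trans (_ : 2 ^ (8 * a + 4 * b) <= _); first by rewrite leq_exp2l //; lia.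
  rewrite (expnD 2 (8 * a)) (mulnC 8) (mulnC 4) (expnM 2 a) (expnM 2 b).
  by apply: leq_mul; rewrite leq_exp2r.
rewrite (_ : 2 ^ 24 * _ = 4096 * (4096 * (a.+1 * a.+1 * 2 ^ (E + 30)))); last first.
  rewrite (expnD 2 E) (expnS a.+1) expn1.
  have -> : 2 ^ 24 = 2 ^ 12 * 2 ^ 12 by rewrite -expnD.
  by rewrite -[2 ^ 12]/4096 !mulnA.
have w20 : 0 < pw2 P by rewrite ew2 expn_gt0.
have w10 : 0 < pw1 P by rewrite ew1 expn_gt0.
have g0 : 0 < pg P by rewrite eg expn_gt0.
have mw : pm P * pw1 P = pw2 P by [].
have Kw : 2 ^ (a + 3) %/ pw2 P * pw2 P <= 2 ^ (a + 3) by exact: leq_divM.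
have Nw : pNV P * pw2 P <= 2 ^ a.+1 by apply: leq_trans (N_le wP) _; exact: ltnW.
have wH X : X * pw2 P <= 2 ^ (a + 3) -> X * (pw1 P * pH P) <= 2 ^ (E + 30).
  move=> hX; rewrite -(leq_pmul2r w20) mulnAC.
  apply: leq_trans (_ : 2 ^ (a + 3) * (pw1 P * pH P) <= _); first by rewrite leq_mul2r hX orbT.
  by rewrite ew1 eH ew2 -!expnD leq_exp2l //; clear -udef vdef Edef h1 h2; lia.
have NKw : pNK P * pw1 P <= 2 ^ a.+1 by rewrite /pNK -mulnA mw.
apply: (@Tbig_le P a.+1 (2 ^ (a + 3) %/ pw2 P) (2 ^ (E + 30))) => //.
- by rewrite -[a.+1]addn1.
- by rewrite [plev P]/(8 + a - b); clear; lia.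
- by rewrite -(ltn_pmul2r g0) mul0n (G_def wP) (H_gt0 wP).
- exact: m_gt0 wP.
- exact: H_gt0 wP.
- exact: N_le wP.
- by apply: leq_trans (ltnW a2) _; rewrite leq_exp2l //; clear -Edef; lia.
- by apply: leq_trans (leq_div _ _) _; rewrite leq_exp2l //; clear -Edef; lia.
- by rewrite expn_gt0.
- exact: wH.
- by apply: wH; apply: leq_trans Nw _; rewrite leq_exp2l //; clear; lia.
- rewrite -(leq_pmul2r w10).
  have -> : pNV P * (pm P * (pw2 P * pw2 P)) * pw1 P = pNV P * pw2 P * (pw2 P * pw2 P) by rewrite -{3}mw; ring.
  apply: leq_trans (_ : 2 ^ a.+1 * (pw2 P * pw2 P) <= _); first by rewrite leq_mul2r Nw orbT.
  by rewrite ew1 ew2 -!expnD leq_exp2l //; clear -udef vdef Edef h1 h2; lia.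
- rewrite -(leq_pmul2r w10) -(leq_pmul2r g0).
  have -> : pNK P * pG P * pw1 P * pg P = pNK P * pw1 P * pH P by rewrite -(G_def wP); ring.
  apply: leq_trans (_ : 2 ^ a.+1 * pH P <= _); first by rewrite leq_mul2r NKw orbT.
  by rewrite ew1 eH eg -!expnD leq_exp2l //; clear -udef vdef Edef h1 h2; lia.
- rewrite -(leq_pmul2r w10) -(leq_pmul2r w20).
  move: (2 ^ (a + 3) %/ pw2 P) Kw => K Kw.
  have -> : K * pNK P * pw1 P * pw2 P = K * pw2 P * (pNK P * pw1 P) by ring.
  apply: leq_trans (leq_mul Kw NKw) _.
  by rewrite ew1 ew2 -!expnD leq_exp2l //; clear -udef vdef Edef h1 h2; lia.
Qed.

Local Open Scope ring_scope.

(** Since ln 2 >= 1/2, read off from ln (1 - 1/2) <= -1/2. *)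
Lemma real_trunc_log (R : realType) n : (0 < n)%N -> (trunc_log 2 n).+1%:R <= 2 * (1 + ln n%:R) :> R.
Proof.
move=> n0.
have ln2 : 2^-1 <= ln 2 :> R.
  have : ln (1 + (- 2^-1)) <= - 2^-1 :> R by apply: le_ln1Dx; lra.
  rewrite (_ : 1 + - 2^-1 = 2^-1); last by lra.
  by rewrite lnV ?posrE //; lra.
have : (2 ^ trunc_log 2 n)%:R <= n%:R :> R by rewrite ler_nat trunc_logP.
rewrite -ler_ln ?posrE ?ltr0n ?expn_gt0 // natrX lnXn // -[ln 2 *+ _]mulr_natl.
move=> h; have k0 : 0 <= (trunc_log 2 n)%:R :> R by [].
have : (trunc_log 2 n)%:R * 2^-1 <= (trunc_log 2 n)%:R * ln 2 :> R by rewrite ler_wpM2l.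
move=> /le_trans/(_ h); rewrite -(natr1 (trunc_log 2 n)); lra.
Qed.

Lemma powRXn (R : realType) (x s : R) k : (x `^ s) ^+ k = x `^ (s * k%:R).
Proof. by rewrite powRrM powR_mulrn ?powR_ge0. Qed.

(** Seventh powers clear the exponents: the right-hand side becomes n^12 theta^4 = n^8 (theta
    n)^4. *)
Lemma root7_bound (R : realType) n tau E (theta : R) : (0 < n)%N -> 0 < theta -> tau%:R <= theta * n%:R ->
  (2 ^ (7 * E) <= n ^ 8 * tau ^ 4)%N -> (2 ^ E)%:R <= n%:R `^ (2 - 2 / 7) * theta `^ (4 / 7).
Proof.
move=> n0 th0 le h.
have n0' : 0 < n%:R :> R by rewrite ltr0n.
set x := _ * _; have x0 : 0 <= x by rewrite mulr_ge0 ?powR_ge0.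
rewrite -(@ler_pXn2r _ 7) ?nnegrE //.
have -> : x ^+ 7 = n%:R ^+ 8 * (theta * n%:R) ^+ 4.
  rewrite exprMn !powRXn.
  rewrite (_ : (2 - 2 / 7) * 7%:R = 12%:R :> R); last by lra.
  rewrite (_ : 4 / 7 * 7%:R = 4%:R :> R); last by lra.
  by rewrite !powR_mulrn ?ltW // exprMn; ring.
rewrite -[_%:R ^+ 7]natrX -expnM mulnC; apply: le_trans (_ : (n ^ 8 * tau ^ 4)%:R <= _); first by rewrite ler_nat.
rewrite natrM !natrX ler_wpM2l ?exprn_ge0 ?ler0n //.
by rewrite lerXn2r ?nnegrE ?ler0n // (le_trans _ le).
Qed.

(** From theta^5 >= 1/n follow n^4 <= (theta n)^5 < (tau + 1)^5 and, as theta <= 1, also theta >=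
    theta^5 >= 1/n, so that tau is positive. *)
Lemma tau_bounds (R : realType) n (theta : R) (tau := Num.truncn (theta * n%:R)) : (0 < n)%N ->
  n%:R `^ (- (1 / 5)) <= theta <= 1 ->
  [/\ (0 < tau)%N, (tau <= n)%N, (n ^ 4 <= tau.+1 ^ 5)%N & tau%:R <= theta * n%:R < tau.+1%:R].
Proof.
move=> n0 /andP[th1 th2].
have n0' : 0 < n%:R :> R by rewrite ltr0n.
have th0 : 0 < theta by apply: lt_le_trans th1; exact: powR_gt0.
have tn : 0 <= theta * n%:R by rewrite mulr_ge0 ?ltW.
have /andP[le lt] := Num.Theory.truncn_itv tn; rewrite -/tau in le lt.
have nV : n%:R^-1 <= theta ^+ 5.
  apply: le_trans (_ : (n%:R `^ (- (1 / 5))) ^+ 5 <= _).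
    rewrite powRXn (_ : - (1 / 5) * 5%:R = -1 :> R); last by lra.
    by rewrite powRN powRr1 ?ler0n.
  by rewrite lerXn2r ?nnegrE ?powR_ge0 // ltW.
have th1' : n%:R^-1 <= theta.
  apply: le_trans nV _; rewrite (exprS _ 4); apply: ler_piMr; first exact: ltW.
  by apply: exprn_ile1; first exact: ltW.
split.
- rewrite truncn_gt0.
  by apply: le_trans (_ : n%:R^-1 * n%:R <= _); [rewrite mulVf ?lt0r_neq0 | rewrite ler_wpM2r // ltW].
- by rewrite -(ler_nat R) (le_trans le) // ler_piMl // ltW.
- rewrite -(ler_nat R) !natrX; apply: le_trans (_ : (theta * n%:R) ^+ 5 <= _).
    rewrite exprMn (exprS _ 4) mulrA -[leLHS]mul1r ler_wpM2r ?exprn_ge0 ?ler0n //.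
    by apply: le_trans (_ : n%:R^-1 * n%:R <= _); [rewrite mulVf ?lt0r_neq0 | rewrite ler_wpM2r // ltW].
  by rewrite lerXn2r ?nnegrE ?ler0n // ltW.
- by rewrite le lt.
Qed.

Lemma prob_ge (R : realType) T n (B E : pred (seq bool)) : (0 < n)%N ->
  (count B (bitseqs T) * n ^ 7 <= 2 ^ T)%N -> (forall r, ~~ B r -> E r) ->
  1 - n%:R ^- 7 <= prob R [pred r : T.-tuple bool | E r].
Proof.
move=> n0 h sub; have n7 : 0 < n%:R ^+ 7 :> R by rewrite exprn_gt0 ?ltr0n.
have T0 : 0 < 2 ^+ T :> R by rewrite exprn_gt0.
rewrite /prob card_bitseqs ler_pdivlMr // mulrBl mul1r lerBlDr.
have e : (count (predC B) (bitseqs T) + count B (bitseqs T) = 2 ^ T)%N.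
  by rewrite addnC count_predC size_bitseqs.
apply: le_trans (_ : (count (predC B) (bitseqs T))%:R + (count B (bitseqs T))%:R <= _).
  by rewrite -natrD e natrX.
apply: lerD; first by rewrite ler_nat sub_count // => r /sub.
by rewrite mulrC ler_pdivlMr // -!natrX -natrM ler_nat.
Qed.

Lemma natr_time (R : realType) i j T A E (l x : R) : (T <= 2 ^ i * (A ^ 2 * (2 ^ E * 2 ^ j)))%N ->
  A%:R <= 2 * (1 + l) -> (2 ^ E)%:R <= x -> T%:R <= 4 * 2 ^+ (i + j) * x * (1 + l) ^+ 2.
Proof.
rewrite -(ler_nat R) => hT hA hx; apply: le_trans hT _.
have -> : 4 * 2 ^+ (i + j) * x * (1 + l) ^+ 2 = 2 ^+ (i + j) * ((2 * (1 + l)) ^+ 2 * x).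
  by move: (2 ^+ (i + j)) => c; ring.
have -> : (2 ^ i * (A ^ 2 * (2 ^ E * 2 ^ j)))%:R = 2 ^+ (i + j) * (A%:R ^+ 2 * (2 ^ E)%:R) :> R.
  rewrite (natrM R (2 ^ i)) (natrM R (A ^ 2)) (natrM R (2 ^ E)) (natrX R A 2) (natrX R 2 i) (natrX R 2 j) exprD.
  by move: (2 ^+ i) (2 ^+ j) (A%:R ^+ 2) => c d e; ring.
have A0 : 0 <= A%:R :> R by rewrite ler0n.
by rewrite ler_wpM2l ?exprn_ge0 // ler_pM ?exprn_ge0 ?ler0n // lerXn2r ?nnegrE // (le_trans A0).
Qed.

Theorem theorem2 (R : realType) :
  exists (GAP_UB : cmd) (c k : nat) (C : R),
  forall (n : nat) (theta : R), (0 < n)%N ->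
    n%:R `^ (- (1 / 5)) <= theta <= 1 ->
  exists2 T : nat,
    T%:R <= C * (n%:R `^ (2 - 2 / 7) * theta `^ (4 / 7)) * (1 + ln n%:R) ^+ k &
    forall (w : nat), (n.+1 ^ c <= 2 ^ w)%N ->
    forall (Sigma : Type) (enc : Sigma -> nat), injective enc ->
      (forall a : Sigma, (enc a < 2 ^ w)%N) ->
    forall x y : n.-tuple Sigma,
    let u (r : T.-tuple bool) : option nat :=
      output GAP_UB w T (input enc (Num.truncn (theta * n%:R)) x y r) in
    (forall r : T.-tuple bool,
       exists2 v : nat, u r = Some v & (edit_distance x y <= v)%N) /\
    ((edit_distance x y)%:R <= theta * n%:R ->
      1 - n%:R ^- 7 <=
        prob R [pred r : T.-tuple bool |
                 if u r is Some v then v%:R <= 840 * (theta * n%:R) else false]).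
Proof.
(* 24 and 30 are the exponents in [Tmain_le]; the 4 and the power 2 come from squaring the bound 2
   (1 + ln n) of the logarithm. *)
exists gap_ub, 20%N, 2%N, (4 * 2 ^+ (24 + 30)) => n theta n0 hth.
have [t0 tn nt /andP[le lt]] := tau_bounds n0 hth.
have th0 : 0 < theta.
  by have /andP[th1 _] := hth; apply: lt_le_trans th1; apply: powR_gt0; rewrite ltr0n.
move: (Num.truncn _) t0 tn nt le lt => tau t0 tn nt le lt.
exists (Tmain n tau).
  have [E hE hT] := Tmain_le n0 t0 tn nt.
  have hx := root7_bound n0 th0 le hE.
  have hA := real_trunc_log R n0.
  exact: natr_time hT hA hx.
move=> w wn Sigma enc enc_inj _ x y u; split=> [r|led].
  exact: gap_ub_lower.
(* The distance is an integer, so rounding theta n down loses nothing. *)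
have {}led : (edit_distance x y <= tau)%N.
  by rewrite -ltnS -(ltr_nat R) (le_lt_trans led).
have [B hB good] := gap_ub_upper n0 t0 tn nt wn enc_inj led.
pose E (r : seq bool) := if output gap_ub w (Tmain n tau) (input enc tau x y r) is Some v
  then v%:R <= 840 * (theta * n%:R) else false.
apply: (prob_ge R (E := E) n0 hB).
move=> r /good[v ev lev]; rewrite /E ev.
apply: le_trans (_ : (840 * tau)%:R <= _); first by rewrite ler_nat.
by rewrite natrM ler_wpM2l.
Qed.
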